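(* Let $n\ge2$ and $r\in\{1,\ldots,n-1\}$, let $\alpha\vDash(n-r)$ be a composition and $\lambda\vdash r$ a partition. Then $$\mathbf{S}_\alpha\star\mathbf{s}_\lambda=\sum_\beta C_{\alpha\lambda}^\beta\,\mathbf{S}_\beta,$$ summed over compositions $\beta$ of $n$, with $C_{\alpha\lambda}^\beta=[S_\beta](S_\alpha s_\lambda)\in\mathbb{N}$, the coefficient of the quasisymmetric Schur function $S_\beta$ in the expansion of the product $S_\alpha s_\lambda$ of a quasisymmetric Schur function and a Schur function in commuting variables.
   Context: Noncommuting variables $\mathbf{x}=(\mathbf{x}_1,\mathbf{x}_2,\ldots)$. A permutation $\delta\in\mathfrak{S}_n$ acts on degree-$n$ monomials by $\delta\circ(\mathbf{x}_{i_1}\cdots\mathbf{x}_{i_n})=\mathbf{x}_{i_{\delta^{-1}(1)}}\cdots\mathbf{x}_{i_{\delta^{-1}(n)}}$, extended linearly. Star product. For $1\le r<n$ let $$\mathcal{S}_{r,n}=\{(i_r\ n)(i_{r-1}\ n-1)\cdots(i_1\ n-r+1): 1\le i_k\le n-r+k,\ 1\le k\le r\}\subseteq\mathfrak{S}_n,$$ where $(i\ j)$ is the transposition of $i$ and $j$ (the identity if $i=j$); permutations are composed right to left, and this is a set of representatives of the left cosets $\delta\,\mathfrak{S}_{n-r}$ in $\mathfrak{S}_n$. For $\mathcal{F},\mathcal{G}$ homogeneous power series in the noncommuting variables of degrees $n-r$ and $r$ respectively, $\mathcal{F}\star\mathcal{G}=\sum_{\delta\in\mathcal{S}_{r,n}}\delta^{-1}\circ(\mathcal{F}\mathcal{G})$.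 Quasisymmetric Schur functions. For compositions $\alpha,\beta$ of the same size, $K_{\alpha\beta}$ is the number of semistandard composition tableaux of shape $\alpha$ and weight $\beta$: fillings $T$ of the left-justified diagram with $\alpha_i$ boxes in row $i$ (rows numbered from the top) by positive integers, with exactly $\beta_k$ entries equal to $k$, such that rows weakly decrease from left to right, the first column strictly increases from top to bottom, and, after extending $T$ by zeros to a rectangular array $\hat T$ with $\ell(\alpha)$ rows and $\max_i\alpha_i$ columns, for all rows $i<j$ and columns $k\ge2$: if $\hat T(j,k)\ne0$ and $\hat T(j,k)\ge\hat T(i,k)$ then $\hat T(j,k)>\hat T(i,k-1)$. The quasisymmetric Schur function (Haglund-Luoto-Mason-van Willigenburg) in commuting variables is $S_\alpha=\sum_\beta K_{\alpha\beta}M_\beta$, where $M_\beta=\sum_{i_1<\cdots<i_k}x_{i_1}^{\beta_1}\cdots x_{i_k}^{\beta_k}$; the $S_\alpha$ with $\alpha\vDash n$ form a basis of the degree-$n$ quasisymmetric functions. $s_\lambda$ is the ordinary Schur function. Lifted and non-lifted functions. A set composition $\vartheta=\vartheta_1/\!/\cdots/\!/\vartheta_l\vDash[m]$ is a sequence of disjoint nonempty blocks with union $[m]$, and $\alpha(\vartheta)=(|\vartheta_1|,\ldots,|\vartheta_l|)$. $\mathbf{M}_\vartheta=\sum\mathbf{x}_{i_1}\cdots\mathbf{x}_{i_m}$ over tuples of positive integers such that $i_a=i_b$ iff $a,b$ lie in the same block of $\vartheta$, and $i_a<i_b$ whenever the block containing $a$ precedes the block containing $b$. For a composition $\alpha$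 of $m$, the lifted quasisymmetric Schur function is $$\mathbf{S}_\alpha=\sum_{\beta\vDash m}\beta!\,K_{\alpha\beta}\sum_{\alpha(\vartheta)=\beta}\mathbf{M}_\vartheta,\qquad \beta!=\beta_1!\beta_2!\cdots.$$ For $\lambda\vdash r$, the non-lifted Schur function is $\mathbf{s}_\lambda=\sum_{T}\mathbf{x}_{c(T_1)}\mathbf{x}_{c(T_2)}\cdots\mathbf{x}_{c(T_r)}$, summed over semistandard Young tableaux $T$ of shape $\lambda$ (rows weakly increasing, columns strictly increasing, positive integer entries), where $T_1,\ldots,T_r$ are the boxes read row by row from top to bottom and left to right within each row, and $c(T_i)$ is the entry of box $T_i$. *)

(* Defs.v *)
From HB Require Import structures.
From mathcomp Require Import all_boot all_order all_fingroup all_algebra.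
From mathcomp Require Import finmap multiset.

Set Implicit Arguments.
Unset Strict Implicit.
Unset Printing Implicit Defensive.

Import GRing.Theory.

Local Open Scope nat_scope.

(* Conventions.  Variables are indexed by nat: index i stands for x_(i+1).
   Positions in a word, rows and columns are numbered from 0.  Power series
   have rational coefficients and are given by their coefficient functions:
   a monomial x_(i_1)...x_(i_n) is the word [:: i_1; ...; i_n] when the
   variables do not commute, and the multiset {i_1, ..., i_n} when they do. *)

Definition is_composition (n : nat) (a : seq nat) : bool :=
  (sumn a == n) && (0 \notin a).

Record composition (n : nat) := Composition {
  parts :> seq nat;
  partsP : is_composition n parts }.

HB.instance Definition _ n := [isSub for @parts n].
HB.instance Definition _ n := [Countable of composition n by <:].

Lemma size_composition n (a : composition n) :
  size [seq inord b : 'I_n.+1 | b <- a] <= n.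
Proof.
rewrite size_map; case: a => a /= /andP[/eqP <-] {n}.
by elim: a => //= -[|b] a IHa //; rewrite inE /= => /IHa; rewrite addSn ltnS;
  move/leq_trans; apply; exact: leq_addl.
Qed.

Definition composition_bseq n (a : composition n) : n.-bseq 'I_n.+1 :=
  Bseq (size_composition a).

Definition bseq_composition n (s : n.-bseq 'I_n.+1) : option (composition n) :=
  insub [seq val i | i <- s].

Lemma composition_bseqK n :
  pcancel (@composition_bseq n) (@bseq_composition n).
Proof.
move=> a; rewrite /bseq_composition /composition_bseq /= -map_comp.
have E : [seq val (inord i : 'I_n.+1) | i <- parts a] = parts a.
  rewrite -[X in _ = X]map_id; apply/eq_in_map => b ab /=.
  rewrite inordK // ltnS; have /andP[/eqP {2}<- _] := partsP a.
  by rewrite sumnE (big_rem b) //= leq_addr.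
by rewrite E; exact: valK.
Qed.

HB.instance Definition _ n :=
  isFinite.Build (composition n) (pcan_enumP (@composition_bseqK n)).

Definition is_partition (r : nat) (lam : seq nat) : bool :=
  is_composition r lam && sorted geq lam.

(* Entry in row i and column j, and 0 outside of T: this is the extension of T
   by zeros. *)
Definition entry (T : seq (seq nat)) (i j : nat) : nat :=
  nth 0 (nth [::] T i) j.

Definition is_ssyt (T : seq (seq nat)) : bool :=
  all (sorted leq) T &&
  [forall i : 'I_(size T), forall j : 'I_(size T), (i < j) ==>
    [forall k : 'I_(size (nth [::] T j)), entry T i k < entry T j k]].

(* In the last condition the columns of the pair are k and k.+1, the latter
   being any column but the first. *)
Definition is_ssct (T : seq (seq nat)) : bool :=
  [&& all (all (leq 1)) T,
      all (sorted geq) T,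
      sorted ltn [seq head 0 row | row <- T] &
      [forall i : 'I_(size T), forall j : 'I_(size T), (i < j) ==>
        [forall k : 'I_(\max_(row <- T) size row).-1,
          (entry T j k.+1 != 0) && (entry T i k.+1 <= entry T j k.+1) ==>
          (entry T i k < entry T j k.+1)]]].

(* The filling of the diagram with row lengths sh that has row reading word w
   belongs to the family P. *)
Definition reads (P : pred (seq (seq nat))) (sh w : seq nat) : bool :=
  (size w == sumn sh) && P (reshape sh w).

(* Fillings of a given diagram correspond to their row reading words, so those
   with multiset of entries c are enumerated by the distinct rearrangements
   of c. *)
Definition num_tableaux (P : pred (seq (seq nat))) (sh c : seq nat) : nat :=
  count (reads P sh) (permutations c).

(* The word 1^(b_1) 2^(b_2) ... *)
Definition weight_word (b : seq nat) : seq nat :=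
  flatten [seq nseq (nth 0 b k) k.+1 | k <- iota 0 (size b)].

Definition kostka_ssct (a b : seq nat) : nat :=
  num_tableaux is_ssct a (weight_word b).

Definition com_series := {mset nat}%mset -> rat.

Definition submsets (m : {mset nat}%mset) : seq {mset nat}%mset :=
  undup [seq seq_mset (mask t m) | t : (size m).-tuple bool].

Definition com_mul (f g : com_series) : com_series := fun m =>
  (\sum_(u <- submsets m) f u * g (m `\` u)%mset)%R.

(* The coefficient of a monomial in M_b is 1 or 0 according to whether its
   nonzero exponents, in increasing order of the variables, form b. *)
Definition mono_qsym (b : seq nat) : com_series := fun m =>
  ([seq m i | i <- sort leq (finsupp m)] == b)%:R%R.

Definition qschur n (a : composition n) : com_series := fun m =>
  (\sum_(b : composition n) (kostka_ssct a b)%:R * mono_qsym b m)%R.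

Definition schur (lam : seq nat) : com_series := fun m =>
  (num_tableaux is_ssyt lam m)%:R%R.

(* c is the family of coefficients of f on the functions S_b, b a composition
   of n. *)
Definition qschur_expansion n (f : com_series) (c : composition n -> rat) :=
  forall m, (f m = \sum_(b : composition n) c b * qschur b m)%R.

Definition nc_series := seq nat -> rat.

Definition nc_mul (F G : nc_series) : nc_series := fun w =>
  (\sum_(i < (size w).+1) F (take i w) * G (drop i w))%R.

Definition act_word n (d : 'S_n) (w : seq nat) : seq nat :=
  [seq nth 0 w (d^-1%g k) | k : 'I_n].

(* The coefficient of w in d o F, for F homogeneous of degree n, is that of the
   monomial sent to w by d. *)
Definition act_series n (d : 'S_n) (F : nc_series) : nc_series := fun w =>
  if size w == n then F (act_word d^-1%g w) else 0%R.

(* The image i p of position p plays the role of i_k for p = n - r + k, in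
   1-based numbering; i p is irrelevant for p < n - r.  The group law of 'S_n
   composes permutations from left to right, so that the factors of
   (i_r n) ... (i_1 n-r+1) occur here by increasing p. *)
Definition star_reps (r n : nat) : {set 'S_n} :=
  [set (\prod_(p < n | n - r <= p) tperm (i p) p)%g
     | i : {ffun 'I_n -> 'I_n} & [forall p, i p <= p]].

(* For F and G homogeneous of degrees n - r and r. *)
Definition star (r n : nat) (F G : nc_series) : nc_series := fun w =>
  (\sum_(d in star_reps r n) act_series d^-1%g (nc_mul F G) w)%R.

Definition is_set_composition m (th : seq {set 'I_m}) : bool :=
  [&& set0 \notin th,
      pairwise (fun A B : {set 'I_m} => [disjoint A & B]) th &
      \bigcup_(B <- th) B == [set: 'I_m]].

Definition block m (th : seq {set 'I_m}) (x : 'I_m) : nat :=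
  find (fun B : {set 'I_m} => x \in B) th.

(* w is one of the monomials of M_th. *)
Definition has_pattern m (th : seq {set 'I_m}) (w : seq nat) : bool :=
  (size w == m) &&
  [forall x : 'I_m, forall y : 'I_m,
    ((nth 0 w x == nth 0 w y) == (block th x == block th y)) &&
    ((block th x < block th y) ==> (nth 0 w x < nth 0 w y))].

Definition nc_mono m (th : seq {set 'I_m}) : nc_series := fun w =>
  (has_pattern th w)%:R%R.

Definition composition_fact (b : seq nat) : nat := \prod_(p <- b) p`!.

Definition lifted_qschur m (a : composition m) : nc_series := fun w =>
  (\sum_(b : composition m)
     (composition_fact b * kostka_ssct a b)%N%:R *
     \sum_(th : (size b).-tuple {set 'I_m} |
             is_set_composition th && ([seq #|B| | B : {set _} <- th] == b))
        nc_mono th w)%R.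

Definition nc_schur (lam : seq nat) : nc_series := fun w =>
  (reads is_ssyt lam w)%:R%R.

(* Main.v *)
(* Semistandard composition tableaux are built one box at a time, from the
   largest entry down and, for equal entries, from left to right: adding a box
   at the end of a row of length j extends the topmost such row (for j = 0, it
   creates a new first row).  The coefficients of S_b are thus values of a
   product of strip-adding operators, where a strip adds boxes to rows of
   increasing lengths.  The box-removing operators satisfy the plactic (Knuth)
   relations on functions of compositions, so the sums over decreasing words of
   given length commute, and the alternating sum of their products given by the
   Jacobi-Trudi determinant of lambda straightens, by a sign-reversing
   cancellation, to a nonnegative sum over Yamanouchi words; the number of those
   leading from b to alpha is C_b.  Moving the adding operators past this
   Jacobi-Trudi sum splits the content in all possible ways and, by the branching
   rule of semistandard Young tableaux, the part removed is accounted for by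
   s_lambda; this gives S_alpha s_lambda = sum_b C_b S_b.  Uniqueness of the
   C_b follows from unitriangularity.

   On the noncommutative side, the coefficient of w in the lifted function of a
   is m! [x^w] S_a, where m! is the product of the factorials of the
   multiplicities in w.  Since this only depends on the multiset of letters, the
   sum over coset representatives defining the star product is the sum over all
   permutations divided by (n - r)!, and every word of S_alpha * s_lambda gets
   m! times the coefficient of the commutative product. *)

Require Import Defs.
From HB Require Import structures.
From mathcomp Require Import all_boot all_order all_fingroup all_algebra.
From mathcomp Require Import finmap multiset boolp functions.
From mathcomp Require Import zify ring.

Set Implicit Arguments.
Unset Strict Implicit.
Unset Printing Implicit Defensive.

Import Order.TTheory GRing.Theory Num.Theory.

(** The operators act on functions of compositions, so that a partially defined box move becomes a
    linear map, and in a product the outermost operator is performed first. Let A_k add a strip of k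
    boxes and R_l remove one of l. They satisfy A_k R_l = sum_i R_(l-i) A_(k-i), the rule by which
    skewing by h_k passes multiplication by h_l. The commutator of a single up step and down step is
    not scalar: it is a difference of projections onto compositions without a given part. Along a
    strip these differences telescope, and the one that remains is the identity as soon as the
    column bound N exceeds the size of the compositions met. This is why a bound N and locality
    statements accompany the relations. On the coefficients of products of h, skewing acts by
    shifting indices. For Jacobi-Trudi coefficients the shifted sum is again a determinant, which
    expands over interlacing sequences in the way Young tableaux lose their largest entry. *)

Local Open Scope nat_scope.

(** * Box-adding and box-removing operators *)

(* [grow j] lengthens the leftmost part j ([j = 0]: it adds a part 1 in front);
   [shrink j] shortens the rightmost part j + 1, removing it when j = 0. *)
Fixpoint bump_part (j : nat) (b : seq nat) : option (seq nat) :=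
  if b is x :: b' then
    if x == j then Some (j.+1 :: b') else omap (cons x) (bump_part j b')
  else None.

Definition grow (j : nat) (b : seq nat) : option (seq nat) :=
  if j == 0 then Some (1 :: b) else bump_part j b.

Fixpoint shrink (j : nat) (b : seq nat) : option (seq nat) :=
  if b is x :: b' then
    if shrink j b' is Some g then Some (x :: g)
    else if x == j.+1 then Some (if j == 0 then b' else j :: b') else None
  else None.

Definition has_part (j : nat) (b : seq nat) : bool := (j == 0) || (j \in b).

Lemma shrink_None j b : (shrink j b == None) = (j.+1 \notin b).
Proof.
elim: b => //= x b; rewrite inE negb_or (eq_sym j.+1).
case: (shrink j b) => [g|] /= <-; rewrite ?andbF ?andbT //.
by case: ifP.
Qed.

Lemma bump_part_None j b : (bump_part j b == None) = (j \notin b).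
Proof.
elim: b => //= x b; rewrite inE negb_or (eq_sym j) => <-.
by case: ifP => //= _; case: (bump_part j b).
Qed.

Lemma shrink_mem i j b g :
  shrink j b = Some g -> i != j.+1 -> i \in b -> i \in g.
Proof.
move=> + ij; elim: b g => //= x b IHb g.
case: (shrink j b) IHb => [h /(_ h erefl) IHb [<-]|_].
  by rewrite !inE => /orP[->//|/IHb ->]; rewrite orbT.
case: (x =P j.+1) => // -> [<-]; rewrite inE (negPf ij) /= => ib.
by case: (j =P 0) => //; rewrite inE ib orbT.
Qed.

Lemma shrink_bump_part i j b :
  0 < i -> i != j -> obind (shrink j) (bump_part i b) = obind (bump_part i) (shrink j b).
Proof.
move=> i0 ij; elim: b => //= x b.
have [->|/eqP xi] := x =P i; rewrite /=.
  case Es: (shrink j b) => [g|] _ /=; first by rewrite eqxx.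
  rewrite eqSS (negPf ij); case: (i =P j.+1) => //= Ei.
  have /eqP Eb : bump_part i b == None by rewrite bump_part_None Ei -shrink_None Es.
  by case: (j =P 0) => _ /=; rewrite ?(eq_sym j i) ?(negPf ij) Eb.
case Eb: (bump_part i b) => [g|]; case Es: (shrink j b) => [h|] /= IH.
- rewrite IH (negPf xi); case Eh: (bump_part i h) => [//|]; case: (x =P j.+1) => // Ex.
  have ib : i \in b by rewrite -[_ \in _]negbK -bump_part_None Eb.
  have := shrink_mem Es _ ib; rewrite -Ex (eq_sym i) => /(_ xi).
  by rewrite -[_ \in _]negbK -bump_part_None Eh.
- rewrite IH; case: (x =P j.+1) => //= _.
  case: (j =P 0) => [_|j0] /=; first by rewrite Eb.
  by rewrite (eq_sym j i) (negPf ij) Eb.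
- by rewrite (negPf xi) -IH.
- case: (x =P j.+1) => //= _; case: (j =P 0) => [_|j0] /=; first by rewrite Eb.
  by rewrite (eq_sym j i) (negPf ij) Eb.
Qed.

Lemma shrink_grow i j b :
  i != j -> obind (shrink j) (grow i b) = obind (grow i) (shrink j b).
Proof.
rewrite /grow; case: (i =P 0) => [->|/eqP i0] ij; last first.
  by apply: shrink_bump_part; rewrite // lt0n.
by rewrite /= eqSS (negPf ij); case: (shrink j b).
Qed.

Lemma grow_has_part j b g : grow j b = Some g -> j.+1 \in g.
Proof.
rewrite /grow; case: (j =P 0) => [->|_]; first by case=> <-; rewrite inE.
elim: b g => //= x b IHb g; case: (x =P j) => [_ [<-]|_]; first by rewrite inE eqxx.
by case: (bump_part j b) IHb => //= h IHb [<-]; rewrite inE IHb ?orbT.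
Qed.

Lemma shrink_has_part j b g : shrink j b = Some g -> has_part j g.
Proof.
rewrite /has_part; elim: b g => //= x b IHb g.
case: (shrink j b) IHb => [h /(_ h erefl) IHb [<-]|_].
  by rewrite inE; case/orP: IHb => ->; rewrite ?orbT.
by case: (x =P j.+1) => // _ [<-]; case: (j =P 0) => //= _; rewrite inE eqxx.
Qed.

Lemma grow_None j b : (grow j b == None) = ~~ has_part j b.
Proof. by rewrite /grow /has_part; case: (j =P 0) => //= _; rewrite bump_part_None. Qed.

Lemma shrink_grow_new j b :
  has_part j b -> j.+1 \notin b -> obind (shrink j) (grow j b) = Some b.
Proof.
rewrite /has_part /grow -shrink_None; case: (j =P 0) => [->|/eqP j0] /=.
  by move=> _ /eqP ->.
elim: b => //= x b IHb; rewrite inE.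
have [->|/eqP xj] := x =P j; rewrite /=.
  move=> _; case: (shrink j b) => //= _.
  by rewrite eqxx (negPf j0).
rewrite eq_sym (negPf xj) /= => Hj.
case Es: (shrink j b) IHb => [//|] /(_ Hj erefl) IHb.
case: (x =P j.+1) => // xSj _; case: (bump_part j b) IHb => //= g ->.
by [].
Qed.

Lemma grow_shrink_new j b :
  ~~ has_part j b -> j.+1 \in b -> obind (grow j) (shrink j b) = Some b.
Proof.
rewrite /has_part /grow; case: (j =P 0) => //= /eqP j0.
elim: b => //= x b IHb; rewrite !inE negb_or => /andP[jx jb].
have := IHb jb; rewrite -[_ \in b]negbK -shrink_None.
case Es: (shrink j b) => [g|] /= H; first by rewrite (eq_sym x j) (negPf jx) H.
by rewrite orbF => /eqP <-; rewrite eqxx (negPf j0) /= eqxx.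
Qed.

Lemma shrink_grow_same j b :
  has_part j b -> j.+1 \in b ->
  obind (shrink j) (grow j b) = obind (grow j) (shrink j b).
Proof.
rewrite /has_part; case: (j =P 0) => [->|/eqP j0] /=.
  by move=> _; rewrite -[_ \in _]negbK -shrink_None /= /grow /=; case: (shrink 0 b).
elim: b => //= x b IHb; rewrite !inE /grow (negPf j0) /=.
have [->|/eqP xj] := x =P j; rewrite /=.
  rewrite eqxx eqn_leq ltnn /= => _ Hb.
  have := Hb; rewrite -[_ \in _]negbK -shrink_None; case: (shrink j b) => //= g _.
  by rewrite eqxx.
rewrite eq_sym (negPf xj) /= => Hj.
have [Sb|Sb] := boolP (j.+1 \in b).
  move=> _; have := IHb Hj Sb; have := Sb; rewrite -[_ \in b]negbK -shrink_None.
  rewrite /grow (negPf j0); case Es: (shrink j b) => [g|] //= _.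
  have jg : j \in g by apply: shrink_mem Es _ Hj; rewrite ltn_eqF.
  rewrite (negPf xj); case Eb: (bump_part j b) => [h|] /= ->; last first.
    by move: Eb => /eqP; rewrite bump_part_None Hj.
  by have := jg; rewrite -[_ \in _]negbK -bump_part_None; case: (bump_part j g).
rewrite orbF => /eqP Ex; subst x.
have := shrink_grow_new (b:=b) (j:=j); rewrite /has_part Hj orbT => /(_ isT Sb).
rewrite /grow (negPf j0); case: (bump_part j b) => //= h ->.
by move: Sb; rewrite -shrink_None => /eqP ->; rewrite eqxx /= eqxx.
Qed.

Local Open Scope ring_scope.

Notation fct := (seq nat -> rat^o).

Definition up (j : nat) (f : fct) : fct :=
  fun b => if grow j b is Some g then f g else 0.

Definition dn (j : nat) (f : fct) : fct :=
  fun b => if shrink j b is Some g then f g else 0.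

Lemma up_is_linear j : linear (up j).
Proof.
move=> a f g; apply/funext => b; rewrite /up !fctE.
by case: (grow j b) => [h|]; rewrite ?fctE // scaler0 addr0.
Qed.
HB.instance Definition _ j :=
  GRing.isLinear.Build rat fct fct _ (up j) (up_is_linear j).

Lemma dn_is_linear j : linear (dn j).
Proof.
move=> a f g; apply/funext => b; rewrite /dn !fctE.
by case: (shrink j b) => [h|]; rewrite ?fctE // scaler0 addr0.
Qed.
HB.instance Definition _ j :=
  GRing.isLinear.Build rat fct fct _ (dn j) (dn_is_linear j).

(** A projection; the commutator of [up j] and [dn j] is a difference of two of these. As
    [has_part 0] always holds, [if_no_part 0] is zero, which starts the telescoping in
    [add_rem_strip]. *)
Definition if_no_part (j : nat) (f : fct) : fct :=
  fun b => if has_part j b then 0 else f b.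

Lemma if_no_part_is_linear j : linear (if_no_part j).
Proof.
move=> a f g; apply/funext => b; rewrite /if_no_part !fctE.
by case: (has_part j b); rewrite ?fctE // scaler0 addr0.
Qed.
HB.instance Definition _ j :=
  GRing.isLinear.Build rat fct fct _ (if_no_part j) (if_no_part_is_linear j).

Lemma up_dn i j f : i != j -> up i (dn j f) = dn j (up i f).
Proof.
move=> ij; apply/funext => b; have := shrink_grow b ij; rewrite /up /dn.
by case: (grow i b) (shrink j b) => [g|] [h|] //= => [->|->|<-].
Qed.

(** The two moves interfere only when one of them has no other part to act on than the one just
    made: without a part [j.+1] the box added is the one removed, without a part [j] the box removed
    is the one put back. *)
Lemma up_dn_same j f :
  up j (dn j f) = dn j (up j f) + if_no_part j.+1 f - if_no_part j f.
Proof.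
apply/funext => b; rewrite !fctE /up /dn /if_no_part /has_part /=.
have := @shrink_grow_new j b; have := @grow_shrink_new j b.
have := @shrink_grow_same j b; have := grow_None j b; have := shrink_None j b.
rewrite /has_part; case: (_ || _); case: (_ \in _) => /=.
- case: (shrink j b) (grow j b) => [h|] [g|] //= _ _ /(_ isT isT) H _ _.
  by rewrite H addr0 subr0.
- move=> /eqP -> /=; case: (grow j b) => [g|] // _ _ _ /(_ isT isT) /= ->.
  by rewrite add0r subr0.
- case: (shrink j b) => [h|] // _ /eqP -> _ /(_ isT isT) /= -> _.
  by rewrite addr0 subrr.
- by move=> /eqP -> /eqP -> _ _ _; rewrite add0r subrr.
Qed.

Lemma up_if_no_part j f : up j (if_no_part j.+1 f) = 0.
Proof.
apply/funext => b; rewrite /up /if_no_part; case E: (grow j b) => [g|] //.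
by rewrite /has_part (grow_has_part E).
Qed.

Lemma if_no_part_dn j f : if_no_part j.+1 (dn j f) = if_no_part j.+1 0.
Proof.
apply/funext => b; rewrite /dn /if_no_part /has_part /=.
by rewrite -[_ \in _]negbK -shrink_None; case: (shrink j b).
Qed.

Lemma dn_if_no_part j f : dn j (if_no_part j f) = 0.
Proof.
apply/funext => b; rewrite /dn /if_no_part; case E: (shrink j b) => [g|] //.
by rewrite (shrink_has_part E).
Qed.

Lemma if_no_part_up j f : if_no_part j (up j f) = 0.
Proof.
apply/funext => b; rewrite /up /if_no_part -[has_part _ _]negbK -grow_None.
by case: (grow j b).
Qed.

(* The index k stands for k - 1 boxes, and for the zero operator when k = 0. *)
Fixpoint add_strip (c k : nat) (f : fct) : fct :=
  match c, k with
  | 0, 1 => f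
  | c'.+1, k'.+1 => add_strip c' k f + add_strip c' k' (up c' f)
  | _, _ => 0
  end.

Fixpoint rem_strip (lo d k : nat) (f : fct) : fct :=
  match d, k with
  | 0, 1 => f
  | d'.+1, k'.+1 =>
      rem_strip lo d' k f + dn (lo + d')%N (rem_strip lo d' k' f)
  | _, _ => 0
  end.

Lemma add_stripS c k f :
  add_strip c.+1 k.+1 f = add_strip c k.+1 f + add_strip c k (up c f).
Proof. by []. Qed.

Lemma rem_stripS lo d k f :
  rem_strip lo d.+1 k.+1 f =
  rem_strip lo d k.+1 f + dn (lo + d)%N (rem_strip lo d k f).
Proof. by []. Qed.

Lemma add_strip_is_linear c k : linear (add_strip c k).
Proof.
elim: c k => [|c IHc] [|k] a f g /=; rewrite ?scaler0 ?addr0 //.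
  by case: k => //; rewrite scaler0 addr0.
by rewrite linearP !IHc scalerDr addrACA.
Qed.
HB.instance Definition _ c k :=
  GRing.isLinear.Build rat fct fct _ (add_strip c k) (add_strip_is_linear c k).

Lemma rem_strip_is_linear lo d k : linear (rem_strip lo d k).
Proof.
elim: d k => [|d IHd] [|k] a f g /=; rewrite ?scaler0 ?addr0 //.
  by case: k => //; rewrite scaler0 addr0.
by rewrite !IHd linearP scalerDr addrACA.
Qed.
HB.instance Definition _ lo d k :=
  GRing.isLinear.Build rat fct fct _ (rem_strip lo d k)
    (rem_strip_is_linear lo d k).

Lemma add_strip0 c f : add_strip c 0 f = 0.
Proof. by case: c. Qed.

Lemma rem_strip0 lo d f : rem_strip lo d 0 f = 0.
Proof. by case: d. Qed.

Lemma add_strip_dn c k j f :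
  (c <= j)%N -> add_strip c k (dn j f) = dn j (add_strip c k f).
Proof.
elim: c k f => [|c IHc] [|k] f cj; rewrite ?linear0 //.
  by case: k => [|k] //=; rewrite linear0.
by rewrite /= up_dn ?ltn_eqF // !IHc ?raddfD // ltnW.
Qed.

Lemma up_rem_strip d k j f :
  (d <= j)%N -> up j (rem_strip 0 d k f) = rem_strip 0 d k (up j f).
Proof.
elim: d k f => [|d IHd] [|k] f dj; rewrite ?linear0 //.
  by case: k => [|k] //=; rewrite linear0.
by rewrite /= raddfD /= up_dn ?gtn_eqF // !IHd // ltnW.
Qed.

(** From [c] to [c.+1] the new noncommuting pair is [up c] and [dn c]. Its commutator is
    [if_no_part c.+1] minus [if_no_part c], and the second projection cancels the correction
    inherited from [c]. *)
Lemma add_rem_strip c k l f :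
  add_strip c k (rem_strip 0 c l f) = rem_strip 0 c l (add_strip c k f) +
    add_strip c k.-1 (if_no_part c (rem_strip 0 c l.-1 f)).
Proof.
elim: c k l f => [|c IHc] k l f.
  have -> g : if_no_part 0 g = 0 by apply/funext => b.
  by rewrite linear0 addr0; case: k l => [|[|k]] [|[|l]].
case: k => [|k]; first by rewrite !add_strip0 linear0 addr0.
case: l => [|l]; first by rewrite !rem_strip0 !linear0 addr0.
(* The correction only involves columns below [c]: [up c] would create a part [c.+1], and [dn c]
   would need one. *)
have -> : add_strip c.+1 k.+1.-1 (if_no_part c.+1 (rem_strip 0 c.+1 l.+1.-1 f)) =
          add_strip c k (if_no_part c.+1 (rem_strip 0 c l f)).
  rewrite !succnK; case: k => [|k]; first by rewrite !add_strip0.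
  rewrite add_stripS up_if_no_part linear0 addr0; case: l => [|l].
    by rewrite !rem_strip0.
  by rewrite rem_stripS linearD /= if_no_part_dn linear0 addr0.
rewrite !rem_stripS !add_stripS add0n.
rewrite !linearD /= !add_strip_dn // !up_rem_strip //.
rewrite (up_dn_same c) !linearD linearN /= add_strip_dn // !up_rem_strip //.
have dnC i g : dn c (add_strip c i g) = add_strip c i (dn c g).
  by rewrite add_strip_dn.
rewrite !(IHc k.+1) !(IHc k) !linearD /= !dnC.
rewrite !dn_if_no_part -!up_rem_strip // if_no_part_up !linear0.
rewrite !addr0; apply/funext => b; rewrite !fctE; ring.
Qed.

Lemma grow_sumn j b g : grow j b = Some g -> sumn g = (sumn b).+1.
Proof.
rewrite /grow; case: (j =P 0%N) => [_ [<-]|_] //.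
elim: b g => //= x b IHb g; case: (x =P j) => [->|_]; first by case=> <-.
by case: (bump_part j b) IHb => //= h IHb [<-] /=; rewrite (IHb h) // addnS.
Qed.

Lemma shrink_sumn j b g : shrink j b = Some g -> sumn b = (sumn g).+1.
Proof.
elim: b g => //= x b IHb g; case: (shrink j b) IHb => [h|] IHb.
  by case=> <- /=; rewrite (IHb h) // addnS.
by case: (x =P j.+1) => // -> [<-]; case: (j =P 0%N) => [->|].
Qed.

(** Allows relations that hold only at compositions of bounded size to be used underneath further
    operators. *)
Lemma add_strip_local c k (f h : fct) b :
  (forall g, sumn g = (sumn b + k)%N -> f g = h g) ->
  add_strip c k.+1 f b = add_strip c k.+1 h b.
Proof.
elim: c k f h => [|c IHc] k f h fh.
  by case: k fh => //= fh; apply: fh; rewrite addn0.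
rewrite !add_stripS !fctE; congr (_ + _); first exact: IHc.
case: k fh => [|k] fh; first by rewrite !add_strip0.
apply: IHc => g gb; rewrite /up; case E: (grow c g) => [g'|] //.
by apply: fh; rewrite (grow_sumn E) gb addnS.
Qed.

Lemma rem_strip_local lo d k (f h : fct) b :
  (forall g, sumn b = (sumn g + k)%N -> f g = h g) ->
  rem_strip lo d k.+1 f b = rem_strip lo d k.+1 h b.
Proof.
elim: d k f h b => [|d IHd] k f h b fh.
  by case: k fh => //= fh; apply: fh; rewrite addn0.
rewrite !rem_stripS !fctE; congr (_ + _); first exact: IHd.
case: k fh => [|k] fh; first by rewrite !rem_strip0.
rewrite /dn; case E: (shrink _ b) => [g'|] //; apply: IHd => g gb.
by apply: fh; rewrite (shrink_sumn E) gb addnS.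
Qed.

Lemma leq_sumn x (s : seq nat) : x \in s -> (x <= sumn s)%N.
Proof.
by elim: s => //= y s IHs; rewrite inE => /orP[/eqP ->|/IHs]; lia.
Qed.

Lemma add_strip1 N f : add_strip N 1 f = f.
Proof. by elim: N => //= N IHN; rewrite add_strip0 addr0. Qed.

Lemma rem_strip1 lo d f : rem_strip lo d 1 f = f.
Proof. by elim: d => //= d IHd; rewrite rem_strip0 linear0 addr0. Qed.

(** No composition of size less than [N] has a part [N], so the projection left by the telescoping
    acts as the identity. *)
Lemma add_rem_strip1 N k l (f : fct) b :
  (sumn b + k < N)%N ->
  add_strip N k.+2 (rem_strip 0 N l.+2 f) b =
  rem_strip 0 N l.+2 (add_strip N k.+2 f) b +
  add_strip N k.+1 (rem_strip 0 N l.+1 f) b.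
Proof.
move=> bN; rewrite add_rem_strip fctE; congr (_ + _); rewrite !succnK.
apply: add_strip_local => g gb; rewrite /if_no_part /has_part.
case: eqP => [N0|_]; first by move: bN; rewrite N0.
by case: ifP => // /leq_sumn Ng; move: bN; rewrite ltnNge -gb Ng.
Qed.

(** Compare h_k^perp h_l = sum_i h_(l-i) h_(k-i)^perp: adding strips plays the role of skewing,
    removing strips that of multiplication. *)
Lemma add_rem_strip_sum N k l (f : fct) b :
  (sumn b + k <= N)%N ->
  add_strip N k.+1 (rem_strip 0 N l.+1 f) b =
  \sum_(i < k.+1 | (i <= l)%N)
     rem_strip 0 N (l - i).+1 (add_strip N (k - i).+1 f) b.
Proof.
elim: k l => [|k IHk] l bN; rewrite big_mkcond big_ord_recl /= !subn0.
  by rewrite big_ord0 addr0 !add_strip1.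
case: l => [|l].
  by rewrite !rem_strip1 big1 ?addr0.
rewrite add_rem_strip1; last by rewrite addnS in bN.
congr (_ + _); rewrite IHk; last by lia.
by rewrite big_mkcond; apply: eq_bigr => i _; rewrite /bump /= add1n !subSS.
Qed.

Local Open Scope nat_scope.

(** * Knuth relations *)

Lemma shrink_cat j u w :
  shrink j (u ++ w) =
  if shrink j w is Some w' then Some (u ++ w')
  else omap (cat^~ w) (shrink j u).
Proof.
elim: u => /= [|x u ->]; first by case: (shrink j w).
case: (shrink j w) => [w'|] //; case: (shrink j u) => [u'|] //=.
by case: ifP => // _; case: ifP.
Qed.

Lemma split_last (T : Type) (a : pred T) t :
  has a t -> exists u x w, [/\ t = u ++ x :: w, a x & ~~ has a w].
Proof.
elim: t => //= x t IHt; have [/IHt [u [y [w [-> ay aw]]]] _|at_] := boolP (has a t).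
  by exists (x :: u), y, w.
by rewrite orbF => ax; exists [::], x, t.
Qed.

Definition drop_part (j : nat) : seq nat := if j == 0 then [::] else [:: j].

Lemma shrink_last j u w :
  shrink j w = None -> shrink j (u ++ j.+1 :: w) = Some (u ++ drop_part j ++ w).
Proof.
by move=> Ew; rewrite shrink_cat /= Ew eqxx /drop_part; case: ifP.
Qed.

Lemma shrink_skip j u x w :
  shrink j w = None -> x != j.+1 ->
  shrink j (u ++ x :: w) = omap (cat^~ (x :: w)) (shrink j u).
Proof. by move=> Ew xj; rewrite shrink_cat /= Ew (negPf xj). Qed.

Lemma shrink_skip_drop i j u w :
  shrink j w = None -> i != j.+1 ->
  shrink j (u ++ drop_part i ++ w) = omap (cat^~ (drop_part i ++ w)) (shrink j u).
Proof.
move=> Ew xj; rewrite shrink_cat /drop_part; case: ifP => /= _; rewrite Ew //.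
by rewrite (negPf xj).
Qed.

(** [shrink n] takes its box from the displayed part, and [shrink n.+1] acts to the left of it; the
    new part [n.+1] made there is not the last one, so neither move disturbs the other. *)
Lemma shrinkC_last n u w :
  shrink n w = None -> shrink n.+1 w = None ->
  obind (shrink n) (shrink n.+1 (u ++ n.+1 :: w)) =
  obind (shrink n.+1) (shrink n (u ++ n.+1 :: w)).
Proof.
move=> E0 E1; rewrite shrink_skip ?ltn_eqF // shrink_last //=.
rewrite shrink_skip_drop //; last by rewrite ltn_eqF // ltnW.
by case: (shrink n.+1 u) => //= u'; rewrite shrink_last.
Qed.

(** The last part equal to [n.+1] or [n.+2] decides both Knuth relations, since neither operator can
    act to its right. *)
Lemma shrink_split n t :
  (n.+1 \notin t) && (n.+2 \notin t) \/
  exists u x w, [/\ t = u ++ x :: w, (x = n.+1 \/ x = n.+2),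
                   shrink n w = None & shrink n.+1 w = None].
Proof.
have [/split_last[u [x [w [-> Hx Hw]]]]|H] := boolP (has (pred2 n.+1 n.+2) t).
  right; exists u, x, w; split=> //.
  - by case/pred2P: Hx; [left|right].
  - apply/eqP; rewrite shrink_None; apply: contra Hw => Hw.
    by apply/hasP; exists n.+1; rewrite //= eqxx.
  - apply/eqP; rewrite shrink_None; apply: contra Hw => Hw.
    by apply/hasP; exists n.+2; rewrite //= eqxx orbT.
left; apply/andP; split; apply: contra H => H.
  by apply/hasP; exists n.+1; rewrite //= eqxx.
by apply/hasP; exists n.+2; rewrite //= eqxx orbT.
Qed.

Lemma shrink_knuth1 n t :
  obind (shrink n) (obind (shrink n.+1) (shrink n t)) =
  obind (shrink n) (obind (shrink n) (shrink n.+1 t)).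
Proof.
have [/andP[]|[u [x [w [-> [] -> E0 E1]]]]] := shrink_split n t.
- by rewrite -!shrink_None => /eqP -> /eqP ->.
- by rewrite -shrinkC_last.
rewrite shrink_skip // ?gtn_eqF // shrink_last //= shrink_last //=.
rewrite shrink_skip_drop ?ltn_eqF //; case: (shrink n u) => //= u'.
by rewrite shrink_last //= shrink_last.
Qed.

Lemma shrink_knuth2 n t :
  obind (shrink n) (obind (shrink n.+1) (shrink n.+1 t)) =
  obind (shrink n.+1) (obind (shrink n) (shrink n.+1 t)).
Proof.
have [/andP[]|[u [x [w [-> [] -> E0 E1]]]]] := shrink_split n t.
- by rewrite -!shrink_None => _ /eqP ->.
- rewrite shrink_skip ?ltn_eqF //; case: (shrink n.+1 u) => //= u'.
  exact: shrinkC_last.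
by rewrite shrink_last //=; exact: shrinkC_last.
Qed.

Lemma shrinkC i j t :
  i.+1 < j -> obind (shrink i) (shrink j t) = obind (shrink j) (shrink i t).
Proof.
move=> ij; have iSj : i.+1 != j.+1 by lia.
elim: t => //= x b.
case Ej: (shrink j b) => [g|]; case Ei: (shrink i b) => [h|] /= IH.
- have ig : i.+1 \in g.
    by apply: (shrink_mem Ej) => //; rewrite -[_ \in _]negbK -shrink_None Ei.
  rewrite -IH; have := ig; rewrite -[_ \in _]negbK -shrink_None.
  by case: (shrink i g).
- by rewrite IH; case: ifP => // _; case: ifP => //= _; rewrite Ej.
- rewrite -IH; case: ifP => // _; case: ifP => [|_] /=; first by lia.
  by rewrite Ei.
- case: (x =P j.+1) => [->|_].
    case: ifP => /= [|_]; first by lia.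
    rewrite Ei eqSS; case: (j =P i.+1) => [|_]; first by lia.
    by case: ifP; first by lia.
  case: ifP => //= _; case: ifP => /= _; rewrite Ej //.
  by case: ifP => //; lia.
Qed.

Local Open Scope ring_scope.

Lemma dnC i j f : (i.+1 < j)%N -> dn i (dn j f) = dn j (dn i f).
Proof.
move=> ij; apply/funext => b; rewrite /dn; have := shrinkC b ij.
by case: (shrink i b) (shrink j b) => [g|] [h|] //= => [->|<-|->].
Qed.

Lemma dn_knuth1 n f : dn n (dn n.+1 (dn n f)) = dn n.+1 (dn n (dn n f)).
Proof.
apply/funext => b; rewrite /dn; have := shrink_knuth1 n b.
case: (shrink n b) (shrink n.+1 b) => [g|] [h|] //=.
- case: (shrink n.+1 g) (shrink n h) => [g'|] [h'|] //=; first by move=> ->.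
    by move=> ->.
  by move=> <-.
- by case: (shrink n.+1 g) => [g'|] //= ->.
- by case: (shrink n h) => [g'|] //= <-.
Qed.

Lemma dn_knuth2 n f : dn n.+1 (dn n.+1 (dn n f)) = dn n.+1 (dn n (dn n.+1 f)).
Proof.
apply/funext => b; rewrite /dn; have := shrink_knuth2 n b.
case: (shrink n.+1 b) => [g|] //=.
case: (shrink n.+1 g) (shrink n g) => [g'|] [h'|] //=; first by move=> ->.
  by move=> ->.
by move=> <-.
Qed.

(** Letters at distance at least two commute, so a genuine Knuth relation is needed only for p = q
    and y = p + 1. *)
Lemma dn_knuth p q y f :
  (p <= q < y)%N -> dn p (dn y (dn q f)) = dn y (dn p (dn q f)).
Proof.
case/andP=> pq qy; have [py|py] := ltnP p.+1 y; first by rewrite dnC.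
have -> : q = p by lia.
have -> : y = p.+1 by lia.
exact: dn_knuth1.
Qed.

Definition dn_word (w : seq nat) (f : fct) : fct := foldr dn f w.

Lemma dn_word_is_linear w : linear (dn_word w).
Proof. by move=> a f g; elim: w => //= c w ->; rewrite linearP. Qed.
HB.instance Definition _ w :=
  GRing.isLinear.Build rat fct fct _ (dn_word w) (dn_word_is_linear w).

Lemma dn_word_cat v w f : dn_word (v ++ w) f = dn_word v (dn_word w f).
Proof. exact: foldr_cat. Qed.

Fixpoint dominated (P Q : seq nat) : bool :=
  match P, Q with
  | [::], _ => true
  | p :: P', q :: Q' => (p <= q)%N && dominated P' Q'
  | _ :: _, [::] => false
  end.

Lemma dominated_cons P Q u :
  sorted gtn (u :: Q) -> dominated P Q -> dominated P (u :: Q).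
Proof.
elim: P Q u => //= p P IHP [|q Q] u //= /andP[uq sQ] /andP[pq PQ].
by rewrite (leq_trans pq (ltnW uq)) IHP.
Qed.

(** To let [y] pass a letter [p] of [P], the corresponding letter [q] of [Q] is first brought next
    to them; then p <= q < y, as [dn_knuth] requires, and [q] is moved back. *)
Lemma dn_word_move P Q y f :
  sorted gtn P -> sorted gtn (y :: Q) -> dominated P Q ->
  all (ltn^~ y) P ->
  dn_word (P ++ y :: Q) f = dn_word (y :: P ++ Q) f.
Proof.
elim: P Q y => [|p P IHP] Q y //=; case: Q => [|q Q] // sP /andP[yq sQ].
case/andP=> pq PQ /andP[py Py].
have sP' := path_sorted sP.
have Pq : all (ltn^~ q) P.
  by apply: sub_all (order_path_min _ sP) => [x /= xp|a b c /= ba cb]; lia.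
rewrite (IHP (q :: Q)) //=; last exact: dominated_cons.
by rewrite (IHP Q) //= dn_knuth //; apply/andP.
by apply/andP. Qed.

Lemma dominated_cat P U Q :
  sorted gtn (U ++ Q) -> dominated P Q -> dominated P (U ++ Q).
Proof.
elim: U => //= u U IHU sUQ PQ; apply: dominated_cons => //.
by apply: IHU => //; exact: path_sorted sUQ.
Qed.

Lemma dn_word_moves P U Q f :
  sorted gtn P -> sorted gtn (U ++ Q) -> dominated P Q ->
  all (fun u => all (ltn^~ u) P) U ->
  dn_word (P ++ U ++ Q) f = dn_word (U ++ P ++ Q) f.
Proof.
elim: U => //= u U IHU sP sUQ PQ /andP[uP UP].
have sUQ' := path_sorted sUQ.
by rewrite dn_word_move //= ?IHU // dominated_cat.
Qed.

Lemma rem_stripS0 lo d f : rem_strip lo d.+1 0 f = 0.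
Proof. by []. Qed.

Lemma dn_rem_strip lo d k j f :
  (lo + d < j)%N -> dn j (rem_strip lo d k f) = rem_strip lo d k (dn j f).
Proof.
elim: d k f => [|d IHd] [|k] f dj; rewrite ?linear0 //.
  by case: k => [|k] //=; rewrite linear0.
rewrite !rem_stripS linearD /= -dnC; last by lia.
by rewrite !IHd //; lia.
Qed.

(** * Commutation of the strip-removing operators *)

Definition strips_commute lo d := forall a b f,
  rem_strip lo d a (rem_strip lo d b f) = rem_strip lo d b (rem_strip lo d a f).

(** Move the letter just above the strip to the left through it. The term in which it arrives at the
    front is killed by [L]; in the other it is preceded by the top letter of the strip. By a Knuth
    relation, [L] composed with these two letters kills the lower of them, so the induction
    continues with this composite in place of [L]. *)
Lemma annihilated_symmetry lo d (L : {linear fct -> fct}) a b f :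
  (forall e, (e <= d)%N -> strips_commute lo e) ->
  (forall g, L (dn (lo + d)%N g) = 0) ->
  L (rem_strip lo d a.+1 (dn (lo + d)%N (rem_strip lo d b f))) =
  L (rem_strip lo d b.+1 (dn (lo + d)%N (rem_strip lo d a f))).
Proof.
elim: d L a b f => [|d IHd] L a b f comm Ld.
  have H c g : L (rem_strip lo 0 c.+1 (dn (lo + 0)%N g)) = 0.
    by case: c => [|c] /=; rewrite ?Ld ?linear0.
  by rewrite !H.
pose L' : {linear fct -> fct} := (L \o dn (lo + d)%N \o dn (lo + d.+1)%N).
have H c g : L (rem_strip lo d.+1 c.+1 (dn (lo + d.+1)%N g)) =
    L' (rem_strip lo d c g).
  rewrite rem_stripS -!dn_rem_strip; [|by lia..].
  by rewrite linearD /= Ld add0r.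
have Ld' g : L' (dn (lo + d)%N g) = 0.
  by rewrite /= addnS dn_knuth1 -addnS Ld.
rewrite !H; case: a b => [|a] [|b] //; rewrite ?rem_strip0 ?rem_stripS0 ?linear0 //.
rewrite !rem_stripS !(linearD (rem_strip lo d _)) !(linearD L') /= (comm d) //; congr (_ + _).
by apply: (IHd L') => // e ed; apply: comm; exact: leqW.
Qed.

(** Strips are sums over strictly decreasing words, that is, elementary symmetric functions in
    letters subject to the Knuth relations. Passing the top letter [m] through a shorter strip
    leaves the commutator [L] of the two top letters. [L] annihilates the lower one, so
    [annihilated_symmetry] makes the leftover terms symmetric in [a] and [b]. *)
Lemma rem_strip_comm lo d : strips_commute lo d.
Proof.
elim/ltn_ind: d => -[|d] IHd a b f.
  by case: a b => [|[|a]] [|[|b]].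
case: a b => [|a] [|b]; rewrite ?rem_strip0 ?rem_stripS0 ?linear0 //.
set m := (lo + d)%N.
rewrite !rem_stripS -/m !linearD /= (IHd d) //.
case: d @m IHd => [|d] m IHd.
  rewrite !addrA; case: a b => [|[|a]] [|[|b]] /=; rewrite ?linear0 ?addr0 ?add0r //.

have mE : m = (lo + d).+1 by rewrite /m addnS.
have E c g : rem_strip lo d.+1 c.+1 (dn m g) = dn m (rem_strip lo d.+1 c.+1 g) +
   (dn (lo + d)%N (dn m (rem_strip lo d c g)) - dn m (dn (lo + d)%N (rem_strip lo d c g))).
  rewrite !rem_stripS linearD /= -!dn_rem_strip; try by rewrite /m; lia.
  by rewrite addrA addrAC addrK.
have F c g : dn m (rem_strip lo d.+1 c (dn m g)) = dn m (dn m (rem_strip lo d.+1 c g)).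
  case: c => [|c]; first by rewrite !rem_strip0 !linear0.
  by rewrite E linearD linearB /= mE dn_knuth2 subrr addr0.
pose L : {linear fct -> fct} := ((dn (lo + d)%N \o dn m) \- (dn m \o dn (lo + d)%N)).
have LE g : L g = dn (lo + d)%N (dn m g) - dn m (dn (lo + d)%N g) by [].
have sym : L (rem_strip lo d a (rem_strip lo d.+1 b f)) =
           L (rem_strip lo d b (rem_strip lo d.+1 a f)).
  case: a b => [|a] [|b]; rewrite ?rem_strip0 ?rem_stripS0 ?linear0 //.
  rewrite !rem_stripS !(linearD (rem_strip lo d _)) !(linearD L).
  congr (_ + _); first by congr (L _); apply: IHd.
  apply: (annihilated_symmetry (L := L)); first by move=> e ed; apply: IHd; lia.
  by move=> g; rewrite LE /m addnS dn_knuth1 subrr.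
rewrite !E !F -!LE (IHd d.+1 _ b a) // (IHd d.+1 _ b.+1 a) // (IHd d.+1 _ b a.+1) //.
rewrite -sym; apply/funext => x; rewrite !fctE; ring.
Qed.

(** The definition splits off the largest letter of a strip; the straightening needs the smallest,
    which is innermost. *)
Lemma rem_strip_low lo d k f :
  rem_strip lo d.+1 k.+1 f =
  rem_strip lo.+1 d k.+1 f + rem_strip lo.+1 d k (dn lo f).
Proof.
elim: d k f => [|d IHd] k f.
  by case: k => [|[|k]]; rewrite rem_stripS /= addn0 ?linear0.
case: k => [|k]; first by rewrite !rem_strip1 rem_strip0 addr0.
by rewrite rem_stripS !IHd !rem_stripS addSnnS linearD /= addrACA.
Qed.

(** * Straightening of the Jacobi-Trudi sum *)

(* A Jacobi-Trudi sum in the course of its straightening: [rem_strip] runs over the letters of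
   [lo, lo + d), while ws holds the letters below lo already extracted from each
   row; eps weights the total row lengths. *)
Fixpoint strips_sum (M lo d : nat) (ws : seq (seq nat)) (eps : seq nat -> rat)
    (f : fct) : fct :=
  if ws is w :: ws' then
    \sum_(a < M) rem_strip lo d a.+1 (dn_word w
       (strips_sum M lo d ws' (fun s => eps ((a + size w)%N :: s)) f))
  else eps [::] *: f.

Lemma strips_sum_scale M lo d ws k (eps eps' : seq nat -> rat) f :
  (forall s, size s = size ws -> eps s = k * eps' s) ->
  strips_sum M lo d ws eps f = k *: strips_sum M lo d ws eps' f.
Proof.
elim: ws eps eps' => [|w ws IHws] eps eps' E /=.
  by rewrite E // scalerA.
rewrite scaler_sumr; apply: eq_bigr => a _.
rewrite (IHws _ (fun s => eps' ((a + size w)%N :: s))) ?linearZ //.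
by move=> s Hs; apply: E; rewrite /= Hs.
Qed.

Lemma strips_sum0 M lo d ws (eps : seq nat -> rat) f :
  (forall s, size s = size ws -> eps s = 0) -> strips_sum M lo d ws eps f = 0.
Proof.
move=> E; rewrite (strips_sum_scale M lo d (k := 0) (eps' := eps)) ?scale0r //.
by move=> s /E ->; rewrite mul0r.
Qed.

Fixpoint extend (c : nat) (ws : seq (seq nat)) : seq (seq (seq nat)) :=
  if ws is w :: ws' then
    [seq w :: W | W <- extend c ws'] ++ [seq (c :: w) :: W | W <- extend c ws']
  else [:: [::]].

Lemma strips_sum_cons M lo d w ws eps f :
  strips_sum M lo d (w :: ws) eps f =
  \sum_(a < M) rem_strip lo d a.+1 (dn_word w
       (strips_sum M lo d ws (fun s => eps ((a + size w)%N :: s)) f)).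
Proof. by []. Qed.

Arguments rem_strip : simpl never.
Arguments strips_sum : simpl never.

Lemma size_extend c ws W : W \in extend c ws -> size W = size ws.
Proof.
elim: ws W => [|w ws IHws] W /=; first by rewrite inE => /eqP ->.
by rewrite mem_cat => /orP[] /mapP[W' /IHws <- ->].
Qed.

Lemma strips_sum_extend M lo d ws (eps : seq nat -> rat) f :
  (forall s, size s = size ws -> has (leq M) s -> eps s = 0) ->
  strips_sum M lo d.+1 ws eps f =
  \sum_(W <- extend lo ws) strips_sum M lo.+1 d W eps f.
Proof.
elim: ws eps => [|w ws IHws] eps E; first by rewrite big_seq1.
rewrite /= big_cat !big_map strips_sum_cons /=.
have IH a : strips_sum M lo d.+1 ws (fun s => eps ((a + size w)%N :: s)) f =
  \sum_(W <- extend lo ws) strips_sum M lo.+1 d W (fun s => eps ((a + size w)%N :: s)) f.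
  by apply: IHws => s Hs hs; apply: E; rewrite /= ?Hs // hs orbT.
under eq_bigr do rewrite IH rem_strip_low.
rewrite big_split /=; congr (_ + _).
  under [RHS]eq_bigr do rewrite strips_sum_cons.
  rewrite [RHS]exchange_big; apply: eq_bigr => a _.
  by rewrite !linear_sum.
under [RHS]eq_bigr do rewrite strips_sum_cons.
rewrite [RHS]exchange_big; case: M E IHws IH => [|M] E IHws IH; first by rewrite !big_ord0.
(* The two sums differ by a shift of the index. The first term on the left has no letter to give up;
   the last one on the right has a row of length at least [M.+1], where [eps] vanishes. *)
rewrite big_ord_recl rem_strip0 add0r big_ord_recr /=.
rewrite [X in _ = _ + X]big_seq [X in _ = _ + X]big1 ?addr0; last first.
  move=> W /size_extend HW; rewrite strips_sum0 ?linear0 // => s Hs.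
  by apply: E; rewrite /= ?addnS ?ltnS ?leq_addr // Hs HW.
apply: eq_bigr => a _; rewrite !linear_sum; apply: eq_bigr => W _.
by have -> : bump 0 a = a.+1 by []; rewrite addSnnS.
Qed.

Lemma sorted_gtn_cat s t :
  sorted gtn (s ++ t) = [&& sorted gtn s, sorted gtn t & allrel gtn s t].
Proof.
have tr : transitive gtn by move=> x y z /= yx xz; exact: ltn_trans xz yx.
by rewrite !(sorted_pairwise tr) pairwise_cat andbC andbA.
Qed.

(** [V] collects the letters picked from the strip. They are at least [lo], hence larger than [c],
    so that [V], [c] and [B] make up one decreasing word, and [A] moves past [V] and [c] by
    [dn_word_moves]. The case of interest is [V] empty. *)
Lemma strip_low A B c lo d k V g :
  sorted gtn A -> sorted gtn (c :: B) -> dominated A B -> all (ltn^~ c) A ->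
  (c < lo)%N -> sorted gtn V -> all (leq (lo + d)) V ->
  dn_word (A ++ V) (rem_strip lo d k (dn_word (c :: B) g)) =
  dn_word V (rem_strip lo d k (dn_word (c :: A ++ B) g)).
Proof.
move=> sA sB AB Ac cl; have sB' := path_sorted sB.
have cB : all (ltn^~ c) B.
  by apply: order_path_min sB => x y z /= yx xz; exact: ltn_trans xz yx.
elim: d k V => [|d IHd] k V sV Vl.
  case: k => [|[|k]]; rewrite ?linear0 // !rem_strip1 -!dn_word_cat.
  have := @dn_word_moves A (rcons V c) B; rewrite -!cats1 -!catA /=; apply=> //.
    rewrite sorted_gtn_cat sV sB /=; apply/allrelP => x y /(allP Vl) /=.
    by rewrite inE => xl /orP[/eqP ->|/(allP cB) /=]; lia.
  rewrite all_cat /= Ac !andbT; apply: sub_all Vl => x /= xl.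
  by apply: sub_all Ac => y /=; lia.
case: k => [|k]; first by rewrite !rem_strip0 !linear0.
rewrite !rem_stripS !linearD /=; congr (_ + _).
  by apply: IHd => //; apply: sub_all Vl => x /=; lia.
rewrite -[dn _ _]/(dn_word [:: (lo + d)%N] _).
rewrite -[dn _ (rem_strip lo d k (dn c (dn_word (A ++ B) g)))]/(dn_word [:: (lo + d)%N] _).
rewrite -!dn_word_cat -catA; apply: IHd.
  rewrite sorted_gtn_cat sV /=; apply/allrelP => x y /(allP Vl) /=.
  by rewrite inE => xl /eqP ->; lia.
by rewrite all_cat /= leqnn !andbT; apply: sub_all Vl => x /=; lia.
Qed.

(* The two displayed rows can be exchanged by Knuth moves, and eps changes sign. *)
Lemma strips_sum_fail M lo d pre A B c post (eps : seq nat -> rat) f :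
  sorted gtn A -> sorted gtn (c :: B) -> dominated A B -> all (ltn^~ c) A ->
  (c < lo)%N -> size A = size B ->
  (forall s x y t, size s = size pre -> size t = size post ->
     eps (s ++ x :: y.+1 :: t) = - eps (s ++ y :: x.+1 :: t)) ->
  strips_sum M lo d (pre ++ A :: (c :: B) :: post) eps f = 0.
Proof.
move=> sA sB AB Ac cl AB'; elim: pre eps => [|w pre IHpre] eps E; last first.
  rewrite /= strips_sum_cons big1 // => a _; rewrite IHpre ?linear0 //.
  by move=> s x y t Hs Ht; apply: (E ((a + size w)%N :: s)); rewrite /= ?Hs.
rewrite /= strips_sum_cons.
pose G a b := strips_sum M lo d post
  (fun s => eps ((a + size A)%N :: (b + size B).+1 :: s)) f.
have GE a b : G a b = - G b a.
  rewrite -scaleN1r; apply: strips_sum_scale => s Hs.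
  by rewrite mulN1r AB' (E [::]).
pose T a b := rem_strip lo d a.+1 (rem_strip lo d b.+1
  (dn_word (c :: A ++ B) (G a b))).
have TE a b : T a b = - T b a.
  by rewrite /T GE !linearN /= rem_strip_comm.
(* With the letters of both rows gathered to the right of both strips, the strips commute, and
   exchanging [a] and [b] only changes the sign of [eps]. *)
have -> : \sum_(a < M) rem_strip lo d a.+1 (dn_word A (strips_sum M lo d
    ((c :: B) :: post) (fun s => eps ((a + size A)%N :: s)) f)) =
  \sum_(a < M) \sum_(b < M) T a b.
  apply: eq_bigr => a _; rewrite strips_sum_cons !linear_sum.
  apply: eq_bigr => b _; rewrite /T /=; congr (rem_strip _ _ _ _).
  have /= := @strip_low A B c lo d b.+1 [::]; rewrite cats0 => -> //.
  by rewrite /G; congr (rem_strip _ _ _ (dn _ (dn_word _ _)));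
     congr strips_sum; apply/funext => s; rewrite addnS.
set S := LHS; have SN : S = - S.
  rewrite /S {1}exchange_big -sumrN; apply: eq_bigr => a _.
  by rewrite -sumrN; apply: eq_bigr => b _; rewrite TE.
apply/funext => x; have := congr1 (fun h : fct => h x) SN; rewrite !fctE => Sx.
by apply/eqP; move/eqP: Sx; rewrite -addr_eq0 -mulr2n mulrn_eq0.
Qed.

Lemma strips_sum_end M N ws (eps : seq nat -> rat) f :
  strips_sum M.+1 N 0 ws eps f = eps (map size ws) *: dn_word (flatten ws) f.
Proof.
elim: ws eps => [|w ws IHws] eps //.
rewrite strips_sum_cons big_ord_recl big1 ?addr0 /= => [|i _]; last by [].
by rewrite /rem_strip IHws linearZ /= add0n dn_word_cat.
Qed.

Definition decreasing_below (c : nat) (w : seq nat) : bool :=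
  sorted gtn w && all (ltn^~ c) w.

(** Rows are aligned at their ends, where the smallest letters stand. Read from the right they form
    a tableau with strictly increasing rows and weakly increasing columns, the transpose of a
    semistandard one. *)
Definition good_pair (A B : seq nat) : bool :=
  (size B <= size A)%N && dominated (drop (size A - size B) A) B.

Definition good_config (c : nat) (W : seq (seq nat)) : bool :=
  all (decreasing_below c) W && sorted good_pair W.

Definition extends (c : nat) (w v : seq nat) : bool := (v == w) || (v == c :: w).

Lemma extend_all2 c W V : V \in extend c W -> all2 (extends c) W V.
Proof.
elim: W V => [|w W IHW] V /=; first by rewrite inE => /eqP ->.
by rewrite mem_cat => /orP[] /mapP[V' /IHW H ->] /=; rewrite /extends eqxx ?orbT.
Qed.

Lemma decreasing_below_extends c w v :
  decreasing_below c w -> extends c w v -> decreasing_below c.+1 v.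
Proof.
case/andP=> sw cw; have cw' : all (ltn^~ c.+1) w.
  by apply: sub_all cw => x /=; lia.
rewrite /decreasing_below => /orP[] /eqP ->; first by rewrite sw cw'.
rewrite /= cw' /= ltnS leqnn andbT.
by case: w sw cw {cw'} => //= x w -> /andP[-> _].
Qed.

Lemma good_pair_extends c w w' v v' :
  decreasing_below c w -> good_pair w w' -> extends c w v -> extends c w' v' ->
  (size v' <= size v)%N -> good_pair v v'.
Proof.
move=> /andP[_ cw] /andP[ww' dom].
(* A [c] put in front of a shorter second row is matched with a letter of [w], and these are all
   less than [c]. *)
have dropS : (size w' < size w)%N -> dominated (drop (size w - size w').-1 w) (c :: w').
  move=> lt; rewrite (drop_nth 0%N); last by lia.
  rewrite /= prednK ?subn_gt0 // dom andbT; apply/ltnW.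
  have lt2 : ((size w - size w').-1 < size w)%N by lia.
  exact: (allP cw _ (mem_nth 0%N lt2)).
rewrite /good_pair => /orP[] /eqP -> /orP[] /eqP -> /= vv'; rewrite ?vv' ?andTb //=.
- by rewrite subnS dropS.
- by rewrite subSn //= dom.
- rewrite subSS; case: (ltnP (size w') (size w)) => lt.
    by rewrite -(prednK (n := size w - size w')) ?subn_gt0 //= dropS.
  have E : (size w - size w' = 0)%N by lia.
  by move: dom; rewrite E !drop0 /= leqnn.
Qed.

Lemma extend_good c W V :
  good_config c W -> V \in extend c W -> sorted geq (map size V) ->
  good_config c.+1 V.
Proof.
move=> /andP[] + + /extend_all2; rewrite /good_config.
elim: W V => [|w W IHW] [|v V] //= /andP[cw cW] sW /andP[wv WV] sV.
have := IHW V cW (path_sorted sW) WV (path_sorted sV) => /andP[-> sV'].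
rewrite (decreasing_below_extends cw wv) /=.
case: W V cW sW WV sV sV' {IHW} => [|w' W] [|v' V] //= _ /andP[ww' _] /andP[wv' _].
by case/andP=> vv' _ ->; rewrite andbT; apply: good_pair_extends wv wv' vv'.
Qed.

(** A row receives at most one letter, so the lengths stop forming a partition only where two
    adjacent rows of equal length get [c] in the second alone. For equal lengths [good_pair] is full
    domination, which is what [strips_sum_fail] asks for. *)
Lemma extend_fail c W V :
  good_config c W -> V \in extend c W -> ~~ sorted geq (map size V) ->
  exists pre A B post, [/\ V = pre ++ A :: (c :: B) :: post,
    decreasing_below c A, sorted gtn (c :: B), dominated A B & size A = size B].
Proof.
move=> /andP[] + + /extend_all2.
elim: W V => [|w W IHW] [|v V] //= /andP[cw cW] sW /andP[wv WV] sV.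
have [sV'|sV'] := boolP (sorted geq (map size V)); last first.
  have [pre [A [B [post [-> ? ? ? ?]]]]] := IHW V cW (path_sorted sW) WV sV'.
  by exists (v :: pre), A, B, post; split.
case: W V cW sW WV sV sV' {IHW} => [|w' W] [|v' V] //= /andP[cw' _] /andP[ww' _].
case/andP=> wv' _ + sV'; rewrite sV' andbT -ltnNge => vv'.
have dec := decreasing_below_extends cw' wv'.
case/andP: ww' => szw dom; case/orP: wv vv' => /eqP -> /=; case/orP: wv' dec => /eqP -> dec /=; try by lia.
move=> lt; exists [::], w, w', V; split=> //; first by case/andP: dec.
  move: dom; have -> : (size w - size w' = 0)%N by lia. by rewrite drop0.
by lia.
Qed.

(** The filter, applied after each letter, is the Yamanouchi condition: an element records a chain
    of partitions in which each letter adds at most one box to each row. *)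
Fixpoint yam (c l : nat) : seq (seq (seq nat)) :=
  if c is c'.+1 then
    [seq V <- flatten [seq extend c' W | W <- yam c' l] | sorted geq (map size V)]
  else [:: nseq l [::]].

Lemma yam_good c l W :
  W \in yam c l -> [/\ good_config c W, size W = l & sorted geq (map size W)].
Proof.
elim: c W => [|c IHc] W /=.
  rewrite inE => /eqP ->; rewrite size_nseq; split=> //.
    rewrite /good_config all_nseq /= orbT /=.
    by elim: l => //= -[|l] //= ->.
  by rewrite map_nseq; elim: l => //= -[|l] //= ->.
rewrite mem_filter => /andP[sW /flatten_mapP[V /IHc[gV sV _] WV]].
by rewrite (extend_good gV WV sW) (size_extend WV).
Qed.

(** Letters are extracted from all rows in increasing order; after each one, the configurations
    leaving [yam] vanish by [strips_sum_fail], so that all cancellation is local to two adjacent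
    rows. *)
Lemma strips_sum_yam M N l (eps : seq nat -> rat) f :
  (forall s, size s = l -> has (leq M.+1) s -> eps s = 0) ->
  (forall s x y t, (size s + size t).+2 = l ->
     eps (s ++ x :: y.+1 :: t) = - eps (s ++ y :: x.+1 :: t)) ->
  strips_sum M.+1 0 N (nseq l [::]) eps f =
  \sum_(W <- yam N l) eps (map size W) *: dn_word (flatten W) f.
Proof.
move=> bnd anti; have key c d : (c + d = N)%N ->
    strips_sum M.+1 0 N (nseq l [::]) eps f =
    \sum_(W <- yam c l) strips_sum M.+1 c d W eps f.
  elim: c d => [|c IHc] d cd /=; first by rewrite big_seq1 -cd add0n.
  rewrite (IHc d.+1); last by rewrite -cd addnS.
  rewrite big_filter big_flatten big_map /= big_seq [RHS]big_seq.
  apply: eq_bigr => W /yam_good [gW sW _].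
  rewrite strips_sum_extend; last by rewrite sW.
  rewrite [RHS]big_mkcond /= big_seq [RHS]big_seq; apply: eq_bigr => V WV.
  case: ifPn => // /(extend_fail gW WV) [pre [A [B [post [EV cA cB AB szAB]]]]].
  case/andP: cA => sA cA.
  rewrite EV strips_sum_fail // => s x y t Hs Ht; apply: anti.
  by rewrite -sW -(size_extend WV) EV size_cat /= Hs Ht; lia.
rewrite (key N 0%N) ?addn0 //; apply: eq_bigr => W _.
by rewrite strips_sum_end.
Qed.

(** * Jacobi-Trudi determinants and interlacing *)

Lemma leq_nth_sumn (s : seq nat) i : (nth 0 s i <= sumn s)%N.
Proof.
by elim: s i => [|x s IHs] [|i] //=; [exact: leq_addr | exact: leq_trans (IHs i) (leq_addl _ _)].
Qed.

Lemma sumn_ord (s : seq nat) : sumn s = (\sum_(i < size s) nth 0 s i)%N.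
Proof. by rewrite sumnE (big_nth 0%N) big_mkord. Qed.

Lemma det_zero_row n (A : 'M[rat]_n) i : (forall j, A i j = 0) -> \det A = 0.
Proof.
by move=> Ai; rewrite (expand_det_row _ i) big1 // => j _; rewrite Ai mul0r.
Qed.

(** Beta-numbers: adding the staircase makes a partition strictly decreasing. *)
Definition beta (l : nat) (s : seq nat) (i : nat) : nat :=
  (nth 0 s i + (l - i.+1))%N.

(* The coefficient of h_s in the Jacobi-Trudi determinant of s_k. *)
Definition jt_sign (k s : seq nat) : rat :=
  \det (\matrix_(i < size k, j < size k)
          (beta (size k) s i == beta (size k) k j)%:R).

(** The large entry gives a beta-number exceeding all those of [k], hence a zero row. *)
Lemma jt_sign_bounded k s M :
  size s = size k -> (sumn k + size k <= M)%N -> has (leq M) s -> jt_sign k s = 0.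
Proof.
move=> sk kM /(has_nthP 0%N) [i]; rewrite sk => ik Mi.
apply: (det_zero_row (i := Ordinal ik)) => j; rewrite mxE /=.
case: eqP => // H; exfalso; move: H; rewrite /beta.
have := leq_nth_sumn k j.
by have := ltn_ord j; lia.
Qed.

(** Consecutive entries x, y + 1 and y, x + 1 have the same two beta-numbers in opposite orders, so
    two rows of the matrix are exchanged. *)
Lemma jt_sign_swap k s x y t :
  (size s + size t).+2 = size k ->
  jt_sign k (s ++ x :: y.+1 :: t) = - jt_sign k (s ++ y :: x.+1 :: t).
Proof.
move=> sk; rewrite /jt_sign.
have i1P : (size s < size k)%N by lia.
have i2P : ((size s).+1 < size k)%N by lia.
pose i1 := Ordinal i1P; pose i2 := Ordinal i2P.
set A := (X in \det X = _); set B := (X in _ = - \det X).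
have -> : A = xrow i1 i2 B.
  apply/matrixP => i j; rewrite !mxE; congr (_ == _)%:R.
  rewrite /beta !nth_cat; case: tpermP => [->|->|/eqP i_1 /eqP i_2] /=.
  - by rewrite ltnn subnn ltnNge leqnSn /= subSnn /=; lia.
  - by rewrite ltnn subnn ltnNge leqnSn /= subSnn /=; lia.
  - case: ltnP => // si; congr (_ + _)%N; case E: (i - size s)%N => [|[|m]] //=.
      by have := i_1; rewrite -val_eqE /=; lia.
    by have := i_2; rewrite -val_eqE /=; lia.
rewrite xrowE det_mulmx det_perm odd_tperm -val_eqE /=.
by rewrite neq_ltn leqnn /= expr1 mulN1r.
Qed.

Lemma beta_sorted l s : size s = l -> sorted geq s -> sorted gtn (mkseq (beta l s) l).
Proof.
move=> sl ss; apply: (homo_sorted_in (e := ltn) (P := mem (iota 0 l))).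
- move=> i j; rewrite ?inE !mem_iota /= !add0n => il jl ij; rewrite /beta.
  have tr : transitive geq by move=> x y z /= yx xz; exact: leq_trans xz yx.
  have := sorted_leq_nth tr (fun x => leqnn x) 0%N ss.
  by move=> /(_ i j); rewrite !inE sl => /(_ il jl (ltnW ij)) /=; lia.
- by apply/allP.
- exact: iota_ltn_sorted.
Qed.

(** Both sequences of beta-numbers decrease strictly. If they have the same members they coincide
    and the matrix is the identity; otherwise some beta-number of [s] is missing from [k] and gives
    a zero row. *)
Lemma jt_sign_partition k s : size s = size k -> sorted geq s -> sorted geq k ->
  jt_sign k s = (s == k)%:R.
Proof.
move=> sk ss kk; have sbs := beta_sorted sk ss; have sbk := beta_sorted erefl kk.
have tr : transitive gtn by move=> x y z /= yx xz; exact: ltn_trans xz yx.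
have irr : irreflexive gtn by move=> x; rewrite /= ltnn.
have [->|sNk] := eqVneq s k.
  rewrite -[RHS](det1 _ (size k)); congr (\det _); apply/matrixP => i j.
  rewrite !mxE -val_eqE; congr (_ : bool)%:R.
  have := nth_uniq 0%N _ _ (sorted_uniq tr irr sbk) (i := i) (j := j).
  by rewrite size_mkseq !nth_mkseq // => ->.
have [sub|/allPn [x]] := boolP (all (mem (mkseq (beta (size k) k) (size k)))
                              (mkseq (beta (size k) s) (size k))).
  case/negP: sNk; apply/eqP; apply: (eq_from_nth (x0 := 0%N)) => // i.
  rewrite sk => ik.
  have Ebs : mkseq (beta (size k) s) (size k) = mkseq (beta (size k) k) (size k).
    apply: (irr_sorted_eq tr irr) => // x.
    have [] := uniq_min_size (sorted_uniq tr irr sbs) (allP sub); last by [].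
    by rewrite !size_mkseq.
  have := congr1 (nth 0%N ^~ i) Ebs; rewrite !nth_mkseq // /beta.
  by move/addIn.
case/mapP => i; rewrite mem_iota /= add0n => ik -> iN.
apply: (det_zero_row (i := Ordinal ik)) => j; rewrite mxE /=.
case: eqP => // E; case/negP: iN; rewrite /= E; apply: map_f.
by rewrite mem_iota /= add0n.
Qed.

Lemma jt_sign_sumn k s :
  size s = size k -> jt_sign k s != 0 -> sumn s = sumn k.
Proof.
move=> sk; apply: contraNeq => sNk; rewrite /jt_sign /determinant.
apply/eqP; apply: big1 => p _.
suff [i Hi] : exists i : 'I_(size k), beta (size k) s i != beta (size k) k (p i).
  by rewrite (bigD1 i) //= mxE (negPf Hi) mul0r mulr0.
apply/existsP; apply: contra_neqT sNk; rewrite negb_exists => /forallP H.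
have E : (\sum_(i < size k) beta (size k) s i = \sum_(i < size k) beta (size k) k i)%N.
  rewrite [RHS](reindex_inj (@perm_inj _ p)) /=; apply: eq_bigr => i _.
  by apply/eqP; have := H i; rewrite negbK.
move: E; rewrite !big_split /= => /addIn E.
by rewrite !sumn_ord sk.
Qed.

(** The total [t] is distributed over the entries of [s] in all ways. If [eps] lists the
    coefficients of a symmetric function on the products h_u, this is the coefficient of h_s after
    skewing by h_t. *)
Fixpoint shift_sum (s : seq nat) (t : nat) (eps : seq nat -> rat) : rat :=
  if s is a :: s' then
    \sum_(i < t.+1) shift_sum s' (t - i) (fun u => eps ((a + i)%N :: u))
  else (t == 0%N)%:R * eps [::].

Lemma shift_sum_ext s t (eps eps' : seq nat -> rat) :
  (forall u, size u = size s -> sumn u = (sumn s + t)%N -> eps u = eps' u) ->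
  shift_sum s t eps = shift_sum s t eps'.
Proof.
elim: s t eps eps' => [|a s IHs] t eps eps' E /=.
  by case: eqP => [t0|_]; rewrite ?mul0r // E // t0.
apply: eq_bigr => i _; apply: IHs => u Hu Su; apply: E => /=; rewrite ?Hu ?Su //.
by have := ltn_ord i; lia.
Qed.

Lemma shift_sum_sum s t (I : Type) (r : seq I) (c : I -> rat) (e : I -> seq nat -> rat) :
  shift_sum s t (fun u => \sum_(i <- r) c i * e i u) =
  \sum_(i <- r) c i * shift_sum s t (e i).
Proof.
elim: s t e => [|a s IHs] t e /=.
  by rewrite mulr_sumr; apply: eq_bigr => i _; rewrite mulrCA.
under eq_bigr do rewrite IHs.
by rewrite exchange_big; apply: eq_bigr => i _; rewrite mulr_sumr.
Qed.

Lemma shift_sumC s t t' (eps : seq nat -> rat) :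
  shift_sum s t (fun u => shift_sum u t' eps) =
  shift_sum s t' (fun u => shift_sum u t eps).
Proof.
elim: s t t' eps => [|a s IHs] t t' eps /=; first by rewrite mulrCA.
have H v v' : \sum_(i < v.+1) shift_sum s (v - i) (fun u =>
      \sum_(j < v'.+1) shift_sum u (v' - j) (fun u0 => eps ((a + i + j)%N :: u0)))
  = \sum_(i < v.+1) \sum_(j < v'.+1) shift_sum s (v - i) (fun u =>
      shift_sum u (v' - j) (fun u0 => eps ((a + i + j)%N :: u0))).
  apply: eq_bigr => i _; have := @shift_sum_sum s (v - i) _ (index_enum 'I_v'.+1)
    (fun=> 1) (fun j u => shift_sum u (v' - j) (fun u0 => eps ((a + i + j)%N :: u0))).
  by under shift_sum_ext do [under eq_bigr do rewrite mul1r]; under [RHS]eq_bigr do rewrite mul1r.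
rewrite !H exchange_big; apply: eq_bigr => i _; apply: eq_bigr => j _.
by rewrite IHs; apply: shift_sum_ext => u _ _; apply: shift_sum_ext => v _ _; rewrite addnAC.
Qed.

(** The matrix size is a separate parameter, so that another sequence of the same length can replace
    [k] without changing the type of the matrix. *)
Definition jt_det (l : nat) (k s : seq nat) : rat :=
  \det (\matrix_(i < l, j < l) (beta l s i == beta l k j)%:R).

Lemma jt_signE l k s : size k = l -> jt_sign k s = jt_det l k s.
Proof. by move=> <-. Qed.

(** The product selects the single sequence u_i = z_i - r_i; it is reached from [s] exactly when it
    is entrywise at least [s] and exceeds it by [t] in total. *)
Lemma shift_sum_prod s t (r z : nat -> nat) :
  shift_sum s t (fun u => \prod_(i < size s) (nth 0%N u i + r i == z i)%:R) =
  (\prod_(i < size s) (nth 0%N s i + r i <= z i)%N%:R) *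
  (\sum_(i < size s) (nth 0%N s i + r i) + t == \sum_(i < size s) z i)%N%:R.
Proof.
elim: s t r z => [|a s IHs] t r z; first by rewrite /= !big_ord0 add0n mulr1 mul1r.
rewrite [LHS]/=.
have H i : shift_sum s (t - i) (fun u => \prod_(i0 < (size s).+1)
      (nth 0%N ((a + i)%N :: u) i0 + r i0 == z i0)%:R) =
    (a + i + r 0 == z 0)%N%:R *
    ((\prod_(i < size s) (nth 0%N s i + r i.+1 <= z i.+1)%N%:R) *
    (\sum_(i < size s) (nth 0%N s i + r i.+1) + (t - i) ==
      \sum_(i < size s) z i.+1)%N%:R).
  rewrite -(IHs (t - i) (fun i => r i.+1) (fun i => z i.+1))%N.
  have := @shift_sum_sum s (t - i) _ [:: tt] (fun=> (a + i + r 0 == z 0)%N%:R)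
   (fun _ u => \prod_(i0 < size s) (nth 0%N u i0 + r i0.+1 == z i0.+1)%N%:R).
  rewrite big_seq1 => <-; apply: shift_sum_ext => u _ _.
  by rewrite big_seq1 big_ord_recl.
under eq_bigr do rewrite H.
rewrite [in RHS]big_ord_recl [X in (X + t)%N]big_ord_recl.
rewrite [X in (_ == X)%N%:R]big_ord_recl [size (a :: s)]/=.
set P := \prod_(i < size s) _; set S1 := (\sum_(i < size s) (_ + _))%N.
set S2 := (\sum_(i < size s) z i.+1)%N.
rewrite /=.
case: (leqP (a + r 0%N) (z 0%N)) => az; last first.
  rewrite !mul0r big1 // => i _; case: eqP => [E|]; last by rewrite mul0r.
  by exfalso; lia.
rewrite mul1r; have [it|it] := leqP (z 0%N - (a + r 0%N)) t; last first.
  rewrite big1 => [|i _].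
    case: eqP => [E|]; rewrite ?mulr0 // mulr1.
    have [/forallP H1|] :=
        boolP [forall i : 'I_(size s), nth 0 s i + r i.+1 <= z i.+1]%N.
      have : (S1 <= S2)%N by apply: leq_sum => i _; exact: H1.
      by lia.
    by rewrite negb_forall => /existsP[i /negPf Hi]; rewrite /P (bigD1 i) //= Hi mul0r.
  case: eqP => [E|]; last by rewrite mul0r.
  by exfalso; have := ltn_ord i; lia.
have it' : (z 0%N - (a + r 0%N) < t.+1)%N by [].
rewrite (bigD1 (Ordinal it')) //= [X in _ + X]big1 => [|i].
  rewrite addr0; have -> : (a + (z 0 - (a + r 0)) + r 0 == z 0)%N by lia.
  rewrite mul1r; congr (_ * (_ : bool)%:R); apply/eqP/eqP; lia.
rewrite -val_eqE /= => iN; case: eqP => [E|]; last by rewrite mul0r.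
by exfalso; lia.
Qed.

(* Differences of adjacent columns turn this determinant into a sum over the
   interlacing sequences of determinants of the form [jt_det]. *)
Definition le_det (l : nat) (k s : seq nat) : rat :=
  \det (\matrix_(i < l, j < l) (beta l s i <= beta l k j)%N%:R).

Lemma sum_beta l s :
  size s = l -> (\sum_(i < l) beta l s i = sumn s + \sum_(i < l) (l - i.+1))%N.
Proof.
by move=> sl; rewrite big_split sumnE (big_nth 0%N) big_mkord sl.
Qed.

(** [shift_sum_prod] applies to each term of the Leibniz expansion, and the condition on the total
    is the same for all permutations, so it factors out. *)
Lemma shift_sum_jt_det l k s t : size s = l -> size k = l ->
  shift_sum s t (jt_det l k) = (sumn s + t == sumn k)%N%:R * le_det l k s.
Proof.
move=> sl kl; pose z (p : 'S_l) i := if insub i is Some o then beta l k (p o) else 0%N.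
have zE p (i : 'I_l) : z p i = beta l k (p i) by rewrite /z valK.
have step := @shift_sum_prod s t (fun i => (l - i.+1)%N).
rewrite sl in step; rewrite [LHS](@shift_sum_ext s t _ (fun u => \sum_(p : 'S_l) (-1) ^+ p *
   \prod_(i < l) (nth 0%N u i + (l - i.+1) == z p i)%N%:R)); last first.
  move=> u _ _; apply: eq_bigr => p _; congr (_ * _); apply: eq_bigr => i _.
  by rewrite mxE zE.
rewrite shift_sum_sum mulr_sumr; apply: eq_bigr => p _.
rewrite step mulrA [RHS]mulrC; congr (_ * _).
  by congr (_ * _); apply: eq_bigr => i _; rewrite mxE zE.
congr (_ : bool)%:R; have := sum_beta sl; rewrite /beta => ->.
have -> : (\sum_(i < l) z p i = sumn k + \sum_(i < l) (l - i.+1))%N.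
  rewrite -sum_beta // [RHS](reindex_inj (@perm_inj _ p)).
  by apply: eq_bigr => i _; rewrite zE.
by rewrite addnAC eqn_add2r.
Qed.

Definition row_seq (l m : nat) (g : {ffun 'I_l -> 'I_m}) : seq nat :=
  [seq val (g j) | j <- enum 'I_l].

Lemma size_row_seq l m (g : {ffun 'I_l -> 'I_m}) : size (row_seq g) = l.
Proof. by rewrite size_map size_enum_ord. Qed.

Lemma nth_row_seq l m (g : {ffun 'I_l -> 'I_m}) (j : 'I_l) :
  nth 0%N (row_seq g) j = g j.
Proof. by rewrite (nth_map j) ?size_enum_ord // nth_ord_enum. Qed.

Definition interlaced (l : nat) (k h : seq nat) : bool :=
  [forall j : 'I_l, (nth 0 k j.+1 <= nth 0 h j <= nth 0 k j)%N].

Lemma le_det_expand l k s : size k = l -> sorted geq k ->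
  le_det l k s =
  \sum_(g : {ffun 'I_l -> 'I_(sumn k).+1} | interlaced l k (row_seq g))
     jt_det l (row_seq g) s.
Proof.
move=> kl kk.
pose A : 'M[rat]_l := \matrix_(i, j) (beta l s i <= beta l k j)%N%:R.
(* Multiplication by [V] on the right subtracts from each column the next one. The last column
   stays, which fits the value 0 of [nth] beyond the end of [k]. *)
pose V : 'M[rat]_l := \matrix_(i, j) ((i == j)%:R - (val i == j.+1)%:R).
pose C : 'M[rat]_l := \matrix_(i, j) \sum_(x < (sumn k).+1 |
   (nth 0 k j.+1 <= x <= nth 0 k j)%N) (beta l s i == x + (l - j.+1))%N%:R.
have detV : \det V = 1.
  rewrite det_trig.
    by rewrite big1 // => i _; rewrite mxE eqxx ltn_eqF // subr0.
  apply/is_trig_mxP => i j ij; rewrite mxE -val_eqE !ltn_eqF ?subr0 //.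
  exact: ltnW.
have CE : C = A *m V.
  apply/matrixP => i j; rewrite !mxE.
  under [RHS]eq_bigr do rewrite !mxE mulrBr.
  rewrite sumrB (bigD1 j) //= eqxx mulr1 [X in _ + X - _]big1 ?addr0; last first.
    by move=> x /negPf xj; rewrite xj mulr0.
  have -> : \sum_(i0 < l) (beta l s i <= beta l k i0)%N%:R * (val i0 == j.+1)%:R =
    (beta l s i < nth 0 k j.+1 + (l - j.+1))%N%:R :> rat.
    case: (ltnP j.+1 l) => [jl|lj].
      rewrite (bigD1 (Ordinal jl)) //= eqxx mulr1 big1 ?addr0.
        by congr (_ : bool)%:R; rewrite /beta /=; lia.
      by move=> x; rewrite -val_eqE /= => /negPf ->; rewrite mulr0.
    rewrite big1 => [|x _].
      by rewrite nth_default ?kl //; case: ltnP => //; have := ltn_ord j; lia.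
    case: eqP => [E|]; last by rewrite mulr0.
    by exfalso; have := ltn_ord x; move: E => /=; lia.
  have kj : (nth 0 k j.+1 <= nth 0 k j)%N.
    case: (ltnP j.+1 l) => [jl|lj]; last by rewrite nth_default ?kl.
    have tr : transitive geq by move=> x y z /= yx xz; exact: leq_trans xz yx.
    have := sorted_leq_nth tr (fun x => leqnn x) 0%N kk.
    by move=> /(_ j j.+1); rewrite !inE kl ltn_ord => /(_ isT jl (leqnSn _)).
  rewrite /beta; set v := (_ + _)%N; set r := (l - j.+1)%N.
  have [H|H] := boolP ((nth 0 k j.+1 + r <= v) && (v <= nth 0 k j + r))%N.
    have vP : (v - r < (sumn k).+1)%N by have := leq_nth_sumn k j; lia.
    rewrite (bigD1 (Ordinal vP)) /=; last by lia.
    have -> : (v == v - r + r)%N by lia.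
    rewrite big1 ?addr0 => [|x]; last first.
      rewrite -val_eqE /= => /andP[_ xN]; case: eqP => // E; exfalso; lia.
    have -> : (v <= nth 0 k j + r)%N by lia.
    have -> : (v < nth 0 k j.+1 + r)%N = false by lia.
    by rewrite subr0.
  rewrite big1 => [|x xP]; last by case: eqP => // E; exfalso; lia.
  case: (leqP v (nth 0%N k j + r)%N) => H1; case: ltnP => H2; rewrite ?subrr //; lia.
have -> : le_det l k s = \det C by rewrite CE det_mulmx detV mulr1.
rewrite -det_tr /determinant.
under eq_bigr => p _.
  have -> : \prod_i C^T i (p i) =
    \prod_(j < l) \sum_(x < (sumn k).+1 | (nth 0 k j.+1 <= x <= nth 0 k j)%N)
       (beta l s (p j) == x + (l - j.+1))%N%:R.
    by apply: eq_bigr => j _; rewrite !mxE.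
  rewrite bigA_distr_big_dep mulr_sumr; over.
rewrite exchange_big; apply: eq_big => [g|g _].
  apply/familyP/forallP => H j; have := H j; rewrite ?nth_row_seq //.
rewrite -[jt_det _ _ _]det_tr /determinant; apply: eq_bigr => p _; congr (_ * _).
by apply: eq_bigr => j _; rewrite !mxE /beta nth_row_seq.
Qed.

Lemma interlaced_sorted l k h : size h = l -> interlaced l k h -> sorted geq h.
Proof.
move=> hl /forallP H; apply/(sortedP 0%N) => i; rewrite hl => il.
have /andP[+ _] := H (Ordinal (ltnW il)); have /andP[_ +] := H (Ordinal il).
by move=> /= h1 h2; exact: leq_trans h1 h2.
Qed.

(** Skewing a Schur function by h_t removes horizontal strips of [t] boxes. The index set is
    literally the one of the branching rule [num_ssyt_branch]. *)
Lemma shift_sum_jt_sign k s t : size s = size k -> sorted geq k ->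
  shift_sum s t (jt_sign k) =
  \sum_(g : {ffun 'I_(size k) -> 'I_(sumn k).+1} |
      interlaced (size k) k (row_seq g) && (sumn (row_seq g) + t == sumn k)%N)
     jt_sign (row_seq g) s.
Proof.
move=> sk kk; rewrite (shift_sum_jt_det t sk erefl) le_det_expand // mulr_sumr.
rewrite big_mkcondr /=; apply: eq_bigr => g _.
rewrite -[jt_det _ _ _]jt_signE ?size_row_seq //.
have [/eqP ->|H] := boolP (jt_sign (row_seq g) s == 0).
  by rewrite mulr0; case: ifP.
rewrite (jt_sign_sumn _ H) ?size_row_seq //.
by case: eqP => _; rewrite ?mul1r ?mul0r.
Qed.

(** * Adding operators and the Jacobi-Trudi sum *)

Lemma rem_strip_nil lo d k f : rem_strip lo d k.+2 f [::] = 0.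
Proof.
by elim: d k => [|d IHd] k //; rewrite rem_stripS fctE IHd add0r.
Qed.

(** The empty composition has no box to remove, so only the empty strips contribute. *)
Lemma strips_sum_nil M lo d l (eps : seq nat -> rat) f :
  strips_sum M.+1 lo d (nseq l [::]) eps f [::] = eps (nseq l 0%N) * f [::].
Proof.
elim: l eps => [|l IHl] eps //.
rewrite strips_sum_cons fct_sumE big_ord_recl big1 => [|i _].
  by rewrite addr0 rem_strip1 /= IHl.
by rewrite /bump rem_strip_nil.
Qed.

Lemma strips_sum_sum M lo d ws (I : Type) (r : seq I) (c : I -> rat)
    (e : I -> seq nat -> rat) f :
  strips_sum M lo d ws (fun s => \sum_(i <- r) c i * e i s) f =
  \sum_(i <- r) c i *: strips_sum M lo d ws (e i) f.
Proof.
elim: ws e => [|w ws IHws] e.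
  by rewrite /strips_sum scaler_suml; apply: eq_bigr => i _; rewrite scalerA.
rewrite strips_sum_cons; under eq_bigr do rewrite IHws !linear_sum.
rewrite exchange_big; apply: eq_bigr => i _; rewrite strips_sum_cons scaler_sumr.
by apply: eq_bigr => a _; rewrite !linearZ.
Qed.

Lemma strips_sum_ext M lo d ws (eps eps' : seq nat -> rat) f :
  (forall s, size s = size ws -> eps s = eps' s) ->
  strips_sum M lo d ws eps f = strips_sum M lo d ws eps' f.
Proof.
move=> E; rewrite (strips_sum_scale _ _ _ (k := 1) (eps' := eps')) ?scale1r //.
by move=> s /E ->; rewrite mul1r.
Qed.

Lemma sum_shift_index M i (Z : nat -> rat) :
  (forall a, (M <= a + i)%N -> Z a = 0) ->
  \sum_(a < M | (i <= a)%N) Z (a - i)%N = \sum_(a < M) Z a.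
Proof.
move=> Z0; rewrite -(big_mkord (leq i) (fun a => Z (a - i)%N)) -(big_mkord xpredT Z).
case: (leqP i M) => iM; last first.
  rewrite big_nat_cond big1 => [|a /andP[/andP[_ aM] ia]]; last by move: (leq_ltn_trans ia aM); lia.
  by rewrite big_nat big1 // => a /andP[_ aM]; apply: Z0; lia.
rewrite (@big_cat_nat _ _ _ i) //= big_nat_cond big1 ?add0r => [|a /andP[/andP[_ ai] ia]]; last by lia.
rewrite [RHS](@big_cat_nat _ _ _ (M - i)) ?leq_subr //= [X in _ = _ + X]big_nat [X in _ = _ + X]big1 ?addr0; last first.
  by move=> a /andP[ia _]; apply: Z0; lia.
  have E : \sum_(0 + i <= a < M) Z (a - i)%N = \sum_(0 <= a < M - i) Z a.
    by rewrite big_addn; apply: eq_bigr => a _; rewrite addnK.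
  rewrite -E add0n big_nat_cond [RHS]big_nat_cond; apply: eq_bigl => a.
  by case: (i <= a)%N; rewrite ?andbT.
Qed.

Lemma sum_triangle k (G : nat -> nat -> rat) :
  \sum_(u < k.+1) \sum_(i < u.+1) G i (u - i)%N =
  \sum_(i < k.+1) \sum_(t < (k - i).+1) G i t.
Proof.
elim: k => [|k IHk]; first by rewrite !big_ord1.
rewrite big_ord_recr IHk [RHS]big_ord_recr /= subnn big_ord1.
rewrite [X in _ + X]big_ord_recr /= subnn addrA -big_split /=; congr (_ + _).
apply: eq_bigr => i _; have ik : (i <= k)%N by rewrite -ltnS.
by rewrite (subSn ik) [RHS]big_ord_recr.
Qed.

Lemma shift_sum_bounded M u t (eps : seq nat -> rat) :
  (forall s, size s = size u -> has (leq M) s -> eps s = 0) ->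
  has (leq M) u -> shift_sum u t eps = 0.
Proof.
elim: u t eps => //= a u IHu t eps E /orP[Ma|Mu]; apply: big1 => i _.
  rewrite -[RHS](_ : shift_sum u (t - i) (fun=> 0) = 0); last first.
    elim: u (t - i)%N {IHu E} => [|b u IHu] v /=; first by rewrite mulr0.
    by apply: big1 => j _; exact: IHu.
  apply: shift_sum_ext => s Hs _; apply: E; rewrite /= ?Hs //.
  by rewrite (leq_trans Ma) ?leq_addr.
by apply: IHu => // s Hs hs; apply: E; rewrite /= ?Hs // hs orbT.
Qed.

(** A box lost by the adding operator on passing a strip is also lost by that strip. Indexed by the
    shortened strips, [eps] is evaluated at the original longer lengths, which is a [shift_sum] by
    the total number [t] of boxes lost. *)
Lemma add_strips_sum M N l k (eps : seq nat -> rat) f b :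
  (forall s, size s = l -> has (leq M) s -> eps s = 0) ->
  (sumn b + k <= N)%N ->
  add_strip N k.+1 (strips_sum M 0 N (nseq l [::]) eps f) b =
  \sum_(t < k.+1) strips_sum M 0 N (nseq l [::]) (fun u => shift_sum u t eps)
                    (add_strip N (k - t).+1 f) b.
Proof.
elim: l k eps b => [|l IHl] k eps b bnd bN.
  have E eps' g : strips_sum M 0 N (nseq 0 [::]) eps' g = eps' [::] *: g by [].
  rewrite E linearZ big_ord_recl big1 => [|i _]; last by rewrite E /= mul0r scale0r.
  by rewrite E addr0 /= mul1r subn0.
pose J := strips_sum M 0 N (nseq l [::]).
pose e a s := eps (a :: s).
have bnd' a : (forall s, size s = l -> has (leq M) s -> e a s = 0).
  by move=> s Hs hs; apply: bnd; rewrite /= ?Hs // hs orbT.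
pose Y a i t := rem_strip 0 N a.+1 (J (fun u => shift_sum u t (e (a + i)%N))
                  (add_strip N (k - (i + t)).+1 f)) b.
have JE eps' g : strips_sum M 0 N (nseq l.+1 [::]) eps' g =
    \sum_(a < M) rem_strip 0 N a.+1 (J (fun s => eps' (val a :: s)) g).
  rewrite strips_sum_cons; apply: eq_bigr => a _ /=; congr (rem_strip _ _ _ _).
  by apply: strips_sum_ext => s _; rewrite addn0.
rewrite JE linear_sum fct_sumE.
transitivity (\sum_(a < M) \sum_(i < k.+1 | (i <= a)%N) \sum_(t < (k - i).+1) Y (a - i)%N i t).
  apply: eq_bigr => a _; rewrite /= add_rem_strip_sum //; apply: eq_bigr => i ia.
  rewrite [LHS](@rem_strip_local _ _ _ _ (\sum_(t < (k - i).+1) J (fun u => shift_sum u t (e a))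
    (add_strip N (k - i - t).+1 f))).
    rewrite linear_sum fct_sumE; apply: eq_bigr => t _.
    by rewrite /Y subnK // subnDA.
  move=> g Hg; rewrite fct_sumE; apply: IHl; first exact: bnd'.
  by have := ltn_ord i; lia.
transitivity (\sum_(i < k.+1) \sum_(a < M) \sum_(t < (k - i).+1) Y a i t).
  under eq_bigr do rewrite big_mkcond.
  rewrite exchange_big; apply: eq_bigr => i _ /=; rewrite -big_mkcond.
  (* The index becomes the shortened length; the values that the new range adds contribute nothing,
     because [eps] vanishes on lengths from [M] on. *)
  rewrite (@sum_shift_index M i (fun a => \sum_(t < (k - i).+1) Y a i t)) //.
  move=> a Ma; apply: big1 => t _; rewrite /Y /J strips_sum0 ?linear0 // => s Hs.
  rewrite -[RHS](_ : shift_sum s t (fun=> 0) = 0); last first.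
    elim: (s) (nat_of_ord t) => [|x u IHu] v /=; first by rewrite mulr0.
    by apply: big1 => j _; exact: IHu.
  apply: shift_sum_ext => v Hv _; apply: bnd; rewrite /= ?Ma //.
  by rewrite Hv Hs size_nseq.
under [RHS]eq_bigr do rewrite JE fct_sumE.
rewrite [RHS]exchange_big [LHS]exchange_big; apply: eq_bigr => a _ /=.
apply: etrans (esym (sum_triangle k (Y a))) _; apply: eq_bigr => u _.
have -> : J (fun s => \sum_(i < u.+1) shift_sum s (u - i) (fun u0 => eps ((a + i)%N :: u0)))
     (add_strip N (k - u).+1 f) =
   \sum_(i < u.+1) J (fun s => shift_sum s (u - i) (e (a + i)%N)) (add_strip N (k - u).+1 f).
  have := @strips_sum_sum M 0 N (nseq l [::]) _ (index_enum 'I_u.+1) (fun=> 1)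
    (fun i s => shift_sum s (u - i) (e (a + i)%N)) (add_strip N (k - u).+1 f).
  under [X in _ = X]eq_bigr do rewrite scale1r.
  by move=> <-; apply: strips_sum_ext => s _; apply: eq_bigr => i _; rewrite mul1r.
rewrite linear_sum fct_sumE; apply: eq_bigr => i _ /=; rewrite /Y subnKC //.
by rewrite -ltnS.
Qed.

(** The head of [b] counts the smallest entries; its strip is innermost, hence the last to be
    added. *)
Fixpoint add_strips (N : nat) (b : seq nat) (f : fct) : fct :=
  if b is k :: b' then add_strips N b' (add_strip N k.+1 f) else f.

Lemma add_strips_is_linear N b : linear (add_strips N b).
Proof. by elim: b => //= k b IHb a f g; rewrite linearP IHb. Qed.
HB.instance Definition _ N b :=
  GRing.isLinear.Build rat fct fct _ (add_strips N b) (add_strips_is_linear N b).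

Lemma add_strips_local N b (f h : fct) g0 :
  (forall g, sumn g = (sumn g0 + sumn b)%N -> f g = h g) ->
  add_strips N b f g0 = add_strips N b h g0.
Proof.
elim: b f h => [|k b IHb] f h fh /=; first by apply: fh; rewrite /= addn0.
apply: IHb => g Hg; apply: add_strip_local => g' Hg'; apply: fh.
by rewrite Hg' Hg /=; lia.
Qed.

Fixpoint shift_sums (a : seq nat) (eps : seq nat -> rat) : seq nat -> rat :=
  if a is t :: a' then shift_sums a' (fun u => shift_sum u t eps) else eps.

Fixpoint splits (b : seq nat) : seq (seq nat * seq nat) :=
  if b is k :: b' then
    [seq (i :: p.1, (k - i)%N :: p.2) | i <- iota 0 k.+1, p <- splits b']
  else [:: ([::], [::])].

Lemma add_strips_strips_sum M N l b (eps : seq nat -> rat) f g :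
  (forall s, size s = l -> has (leq M) s -> eps s = 0) ->
  (sumn g + sumn b <= N)%N ->
  add_strips N b (strips_sum M 0 N (nseq l [::]) eps f) g =
  \sum_(p <- splits b) strips_sum M 0 N (nseq l [::]) (shift_sums p.1 eps)
                         (add_strips N p.2 f) g.
Proof.
elim: b eps f => [|k b IHb] eps f bnd gN; first by rewrite /= big_seq1.
rewrite -[splits _]/[seq (i :: p.1, (k - i)%N :: p.2) | i <- index_iota 0 k.+1, p <- splits b].
rewrite big_allpairs_dep big_mkord /=.
rewrite (@add_strips_local _ _ _ (\sum_(t < k.+1) strips_sum M 0 N (nseq l [::])
   (fun u => shift_sum u t eps) (add_strip N (k - t).+1 f))); last first.
  by move=> h Hh; rewrite fct_sumE; apply: add_strips_sum => //; move: gN => /=; lia.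
rewrite linear_sum fct_sumE; apply: eq_bigr => t _ /=; apply: IHb.
  by move=> s Hs hs; apply: shift_sum_bounded hs => s'; rewrite Hs; exact: bnd.
by move: gN => /=; lia.
Qed.

Local Open Scope nat_scope.

(** * Branching of semistandard Young tableaux *)

Definition fillings (P : pred (seq (seq nat))) (sh c : seq nat) :=
  [seq reshape sh w | w <- permutations c & reads P sh w].

Lemma size_fillings P sh c : size (fillings P sh c) = num_tableaux P sh c.
Proof. by rewrite size_map size_filter. Qed.

Lemma fillings_uniq P sh c : uniq (fillings P sh c).
Proof.
rewrite map_inj_in_uniq ?filter_uniq ?permutations_uniq // => u v.
rewrite !mem_filter => /andP[/andP[/eqP su _] _] /andP[/andP[/eqP sv _] _] E.
by rewrite -(reshapeKr (sh := sh) (s := u)) ?su // E reshapeKr ?sv.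
Qed.

Lemma mem_fillings P sh c T :
  (T \in fillings P sh c) = [&& shape T == sh, perm_eq (flatten T) c & P T].
Proof.
apply/mapP/idP => [[w]|/and3P[/eqP <- Tc PT]].
  rewrite mem_filter mem_permutations => /andP[/andP[/eqP sw Pw] wc] ->.
  by rewrite reshapeKl ?sw // eqxx reshapeKr ?sw // wc Pw.
exists (flatten T); last by rewrite flattenK.
by rewrite mem_filter mem_permutations Tc /reads size_flatten eqxx flattenK PT.
Qed.

Lemma num_tableaux_perm P sh c c' :
  perm_eq c c' -> num_tableaux P sh c = num_tableaux P sh c'.
Proof. by move=> /perm_permutations/seq.permP; apply. Qed.

Lemma num_tableaux_size P sh c : size c != sumn sh -> num_tableaux P sh c = 0.
Proof.
move=> H; apply/eqP; rewrite -leqn0 leqNgt -has_count; apply/hasP => -[w].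
rewrite mem_permutations => /perm_size wc /andP[/eqP E _].
by move: H; rewrite -wc E eqxx.
Qed.

Lemma is_ssytP T :
  reflect ((forall i, sorted leq (nth [::] T i)) /\
    forall i j m, i < j -> j < size T -> m < size (nth [::] T j) ->
      entry T i m < entry T j m)
    (is_ssyt T).
Proof.
apply: (iffP andP) => -[H1 H2]; split.
- move=> i; case: (ltnP i (size T)) => iT; last by rewrite nth_default.
  by apply: (allP H1); apply: mem_nth.
- move=> i j m ij jT mj; have iT := ltn_trans ij jT.
  have /forallP/(_ (Ordinal jT)) /= /implyP/(_ ij) := forallP H2 (Ordinal iT).
  by move/forallP/(_ (Ordinal mj)).
- by apply/(all_nthP [::]) => i _; exact: H1.
- apply/forallP => i; apply/forallP => j; apply/implyP => ij; apply/forallP => m.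
  exact: H2.
Qed.

Definition strip_entry (x : nat) (T : seq (seq nat)) : seq (seq nat) :=
  [seq filter (predC1 x) r | r <- T].

Definition pad_rows (x : nat) (k : seq nat) (T : seq (seq nat)) : seq (seq nat) :=
  [seq p.2 ++ nseq (p.1 - size p.2) x | p <- zip k T].

Lemma nth_strip_entry x T i :
  nth [::] (strip_entry x T) i = filter (predC1 x) (nth [::] T i).
Proof.
case: (ltnP i (size T)) => iT; first by rewrite (nth_map [::]).
by rewrite !nth_default ?size_map.
Qed.

Lemma size_pad_rows x k T : size T = size k -> size (pad_rows x k T) = size k.
Proof. by move=> E; rewrite size_map size_zip E minnn. Qed.

Lemma nth_pad_rows x k T i : size T = size k ->
  nth [::] (pad_rows x k T) i =
  nth [::] T i ++ nseq (nth 0 k i - size (nth [::] T i)) x.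
Proof.
move=> E; case: (ltnP i (size k)) => ik.
  by rewrite (nth_map (0, [::])) ?nth_zip //= size_zip E minnn.
by rewrite !nth_default ?size_pad_rows ?E.
Qed.

Lemma sorted_split_max x r : sorted leq r -> all (leq^~ x) r ->
  r = filter (predC1 x) r ++ nseq (size r - size (filter (predC1 x) r)) x.
Proof.
elim: r => //= y r IHr sr /andP[yx rx]; have [yE|yx'] := eqVneq y x.
  subst y; have -> : r = nseq (size r) x.
    apply/all_pred1P/allP => z zr; rewrite /= eqn_leq (allP rx) //=.
    by have := order_path_min leq_trans sr; move/allP/(_ _ zr).
  by rewrite size_nseq (_ : filter _ _ = [::]) // filter_nseq /= eqxx.
by rewrite /= subSS -IHr // (path_sorted sr).
Qed.

Lemma entry_cat r s m : m < size r -> nth 0 (r ++ s) m = nth 0 r m.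
Proof. by move=> mr; rewrite nth_cat mr. Qed.

Section Branching.

Variables (x : nat) (k : seq nat).
Hypothesis k_sorted : sorted geq k.

Lemma nth_sorted_geq i j : i <= j -> nth 0 k j <= nth 0 k i.
Proof.
move=> ij; case: (ltnP j (size k)) => jk; last by rewrite nth_default.
have tr : transitive geq by move=> a b c /= ba ac; exact: leq_trans ac ba.
apply: (sorted_leq_nth tr (fun x => leqnn x) 0 k_sorted); rewrite ?inE //.
exact: leq_ltn_trans ij jk.
Qed.

Lemma pad_rows_ssyt h T : shape T = h -> size h = size k ->
  interlaced (size k) k h -> all (gtn x) (flatten T) -> is_ssyt T ->
  is_ssyt (pad_rows x k T) /\ shape (pad_rows x k T) = k.
Proof.
move=> Th hk /forallP ilc Tx /is_ssytP [rows cols].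
have Tk : size T = size k by rewrite -hk -Th size_map.
have szT i : size (nth [::] T i) = nth 0 h i by rewrite -Th nth_shape.
have ilc' i : i < size k -> nth 0 k i.+1 <= nth 0 h i <= nth 0 k i.
  by move=> ik; exact: (ilc (Ordinal ik)).
have lex i m : m < size (nth [::] T i) -> nth 0 (nth [::] T i) m < x.
  move=> mi; apply: (allP Tx); apply/flattenP; exists (nth [::] T i).
    by apply: mem_nth; case: (ltnP i (size T)) mi => // iT; rewrite nth_default.
  exact: mem_nth.
split; last first.
  apply: (eq_from_nth (x0 := 0)); rewrite size_map size_pad_rows // => i ik.
  rewrite nth_shape nth_pad_rows // size_cat size_nseq szT subnKC //.
  by have /andP[] := ilc' i ik.
apply/is_ssytP; split=> [i|i j m ij].
  rewrite nth_pad_rows // (sorted_pairwise leq_trans) pairwise_cat.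
  rewrite -!(sorted_pairwise leq_trans) rows /=; apply/andP; split.
    apply/allrelP => a b /(nthP 0) [m mi <-] /nseqP [-> _]; exact/ltnW/lex.
  by apply/(sortedP 0) => m; rewrite size_nseq => H; rewrite !nth_nseq H (ltnW H).
rewrite size_pad_rows // => jk; rewrite /entry !nth_pad_rows //.
rewrite size_cat size_nseq szT subnKC => [mk|]; last by have /andP[] := ilc' j jk.
have mi : m < nth 0 h i.
  have /andP[+ _] := ilc' i (ltn_trans ij jk); apply: leq_trans.
  by apply: leq_trans mk _; exact: nth_sorted_geq.
rewrite entry_cat ?szT // nth_cat szT nth_nseq; case: (ltnP m (nth 0 h j)) => mj.
  by apply: cols => //; rewrite ?Tk ?szT.
by rewrite ltn_sub2r // ?lex ?szT //; exact: leq_ltn_trans mj mk.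
Qed.

Lemma strip_entry_ssyt T : shape T = k -> all (geq x) (flatten T) -> is_ssyt T ->
  is_ssyt (strip_entry x T) /\
  interlaced (size k) k (shape (strip_entry x T)).
Proof.
move=> Tk Tx /is_ssytP [rows cols].
have sTk : size T = size k by rewrite -Tk size_map.
have szT i : size (nth [::] T i) = nth 0 k i by rewrite -Tk nth_shape.
have rx i : all (leq^~ x) (nth [::] T i).
  case: (ltnP i (size T)) => iT; last by rewrite nth_default.
  apply/allP => y yi; apply: (allP Tx); apply/flattenP.
  by exists (nth [::] T i) => //; apply: mem_nth.
pose g i := size (filter (predC1 x) (nth [::] T i)).
have gE i : nth 0 (shape (strip_entry x T)) i = g i.
  by rewrite nth_shape nth_strip_entry.
have gk i : g i <= nth 0 k i by rewrite -szT /g size_filter count_size.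
have ent i m : m < g i -> entry T i m = nth 0 (filter (predC1 x) (nth [::] T i)) m.
  by move=> mg; rewrite /entry {1}(sorted_split_max (rows i) (rx i)) entry_cat.
have entx i m : g i <= m -> m < nth 0 k i -> entry T i m = x.
  move=> gm mk; rewrite /entry {1}(sorted_split_max (rows i) (rx i)) nth_cat.
  rewrite ltnNge gm /= nth_nseq szT ltn_sub2r // -/(g i); exact: leq_ltn_trans gm mk.
have entle i m : entry T i m <= x.
  rewrite /entry; case: (ltnP m (size (nth [::] T i))) => mi; last by rewrite nth_default.
  by apply: (allP (rx i)); apply: mem_nth.
have kg i : i < size k -> nth 0 k i.+1 <= g i.
  move=> ik; rewrite leqNgt; apply/negP => gk1.
  have ik1 : i.+1 < size T.
    by rewrite sTk ltnNge; apply/negP => H; move: gk1; rewrite nth_default.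
  have := cols i i.+1 (g i) (ltnSn i) ik1; rewrite szT => /(_ gk1).
  have -> : entry T i (g i) = x.
    by apply: entx => //; apply: leq_trans gk1 _; exact: nth_sorted_geq.
  by rewrite ltnNge entle.
split; last first.
  by apply/forallP => i; rewrite gE kg // gk.
apply/is_ssytP; split=> [i|i j m ij].
  by rewrite nth_strip_entry; apply: sorted_filter => //; exact: leq_trans.
rewrite size_map sTk => jk; rewrite nth_strip_entry -/(g j) => mj.
have mi : m < g i.
  apply: leq_trans mj _; apply: leq_trans (gk j) _.
  apply: leq_trans (nth_sorted_geq ij) _; apply: kg; exact: ltn_trans ij jk.
rewrite /entry !nth_strip_entry -!ent //; apply: cols; rewrite ?sTk ?szT //.
exact: leq_trans mj (gk j).
Qed.

Lemma pad_rowsK T : size T = size k -> all (gtn x) (flatten T) ->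
  strip_entry x (pad_rows x k T) = T.
Proof.
move=> Tk Tx; apply: (eq_from_nth (x0 := [::])).
  by rewrite size_map size_pad_rows.
move=> i; rewrite size_map size_pad_rows // => ik.
rewrite nth_strip_entry nth_pad_rows // filter_cat filter_nseq /= eqxx cats0.
apply/all_filterP/allP => y yi; rewrite /= ltn_eqF //; apply: (allP Tx).
by apply/flattenP; exists (nth [::] T i) => //; apply: mem_nth; rewrite Tk.
Qed.

Lemma strip_entryK T : shape T = k -> all (geq x) (flatten T) -> is_ssyt T ->
  pad_rows x k (strip_entry x T) = T.
Proof.
move=> Tk Tx /is_ssytP [rows _]; have sTk : size T = size k by rewrite -Tk size_map.
have ssTk : size (strip_entry x T) = size k by rewrite size_map.
apply: (eq_from_nth (x0 := [::])); first by rewrite size_pad_rows.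
move=> i; rewrite size_pad_rows // => ik; rewrite nth_pad_rows // nth_strip_entry.
rewrite -Tk nth_shape -sorted_split_max //; apply/allP => y yi; apply: (allP Tx).
by apply/flattenP; exists (nth [::] T i) => //; apply: mem_nth; rewrite sTk.
Qed.

Lemma flatten_strip_entry T :
  flatten (strip_entry x T) = filter (predC1 x) (flatten T).
Proof. by rewrite filter_flatten. Qed.

(** The largest entry occupies the ends of rows and forms a horizontal strip, so deleting it and
    padding the rows with it are inverse to each other. Shapes keep [size k] rows, possibly empty,
    to agree with the matrices of [jt_sign]. *)
Lemma num_ssyt_branch t c : all (gtn x) c ->
  num_tableaux is_ssyt k (nseq t x ++ c) =
  \sum_(g : {ffun 'I_(size k) -> 'I_(sumn k).+1} |
      interlaced (size k) k (row_seq g) && (sumn (row_seq g) + t == sumn k))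
    num_tableaux is_ssyt (row_seq g) c.
Proof.
move=> cx; rewrite -size_fillings -sum1_size.
have Fx T : T \in fillings is_ssyt k (nseq t x ++ c) ->
    [/\ shape T = k, all (geq x) (flatten T), is_ssyt T & perm_eq (flatten T) (nseq t x ++ c)].
  rewrite mem_fillings => /and3P[/eqP Tk Tc TT]; split=> //.
  rewrite (perm_all _ Tc) all_cat all_nseq /= leqnn orbT.
  by apply: sub_all cx => y /= /ltnW.
have filt u : perm_eq u (nseq t x ++ c) -> perm_eq (filter (predC1 x) u) c.
  move/(perm_filter (predC1 x)); rewrite filter_cat filter_nseq /= eqxx /=.
  rewrite (_ : filter _ c = c) //; apply/all_filterP; apply: sub_all cx => y /= yx.
  by rewrite ltn_eqF.
(* Exactly one [g] is the shape left after deletion, so inserting this sum counts each tableau once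
   and allows the exchange of summations. *)
have key T : T \in fillings is_ssyt k (nseq t x ++ c) ->
    (\sum_(g : {ffun 'I_(size k) -> 'I_(sumn k).+1} |
      interlaced (size k) k (row_seq g) && (sumn (row_seq g) + t == sumn k))
      (row_seq g == shape (strip_entry x T)) = 1)%N.
  case/Fx => Tk Tx TT Tc; have [sT il] := strip_entry_ssyt Tk Tx TT.
  have size_h : size (shape (strip_entry x T)) = size k by rewrite !size_map -Tk size_map.
  pose g0 := [ffun j : 'I_(size k) => inord (nth 0 (shape (strip_entry x T)) j)]
    : {ffun 'I_(size k) -> 'I_(sumn k).+1}.
  have g0E : row_seq g0 = shape (strip_entry x T).
    apply: (eq_from_nth (x0 := 0)); rewrite size_row_seq ?size_h // => i ik.
    rewrite (nth_row_seq g0 (Ordinal ik)) ffunE inordK // ltnS.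
    have /andP[_ /leq_trans] := forallP il (Ordinal ik); apply.
    exact: leq_nth_sumn.
  rewrite (bigD1 g0) /=; last first.
    rewrite g0E il -size_flatten flatten_strip_entry (perm_size (filt _ Tc)).
    by rewrite -[X in sumn X]Tk -size_flatten (perm_size Tc) size_cat size_nseq addnC eqxx.
  rewrite g0E eqxx big1 // => g /andP[_ gg0]; case: eqP => // E; case/negP: gg0.
  apply/eqP/ffunP => j; apply: val_inj.
  by have := nth_row_seq g j; rewrite E -g0E nth_row_seq ; exact: esym.
rewrite big_seq -[LHS](eq_bigr _ key) -big_seq exchange_big; apply: eq_bigr => g.
case/andP => il sg; rewrite -size_fillings -big_mkcond sum1_count -size_filter.
rewrite -[LHS](size_map (strip_entry x)); apply: perm_size; apply: uniq_perm.
- rewrite map_inj_in_uniq ?filter_uniq ?fillings_uniq // => T U.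
  rewrite !mem_filter => /andP[_ /Fx[Tk Tx TT _]] /andP[_ /Fx[Uk Ux UU _]] E.
  by rewrite -(strip_entryK Tk Tx TT) E strip_entryK.
- exact: fillings_uniq.
move=> T; apply/mapP/idP => [[U]|].
  rewrite mem_filter => /andP[/eqP rg /Fx[Uk Ux UU Uc]] ->.
  have [sU _] := strip_entry_ssyt Uk Ux UU.
  by rewrite mem_fillings -rg eqxx flatten_strip_entry filt.
rewrite mem_fillings => /and3P[/eqP rg Tc TT].
have Tx : all (gtn x) (flatten T) by rewrite (perm_all _ Tc).
have Tk : size T = size k by rewrite -(size_row_seq g) -rg size_map.
have [pT pk] := pad_rows_ssyt rg (size_row_seq g) il Tx TT.
exists (pad_rows x k T); last by rewrite pad_rowsK.
rewrite mem_filter pad_rowsK // rg eqxx mem_fillings pk eqxx pT andbT /=.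
have step U h : size U = size h -> 
  perm_eq (flatten (pad_rows x h U))
    (nseq (\sum_(p <- zip h U) (p.1 - size p.2)) x ++ flatten U).
  elim: U h => [|r U IHU] [|y h] //=; first by rewrite big_nil.
  case=> E; rewrite big_cons nseqD; have /seq.permP H := IHU h E.
  by apply/seq.permP => p; have := H p; rewrite /= -/(pad_rows x h U) !count_cat; lia.
rewrite (perm_trans (step T k Tk)) //.
have E := perm_size (step T k Tk).
rewrite size_cat size_nseq !size_flatten pk rg addnC in E.
have <- : \sum_(p <- zip k T) (p.1 - size p.2) = t.
  by apply: (@addnI (sumn (row_seq g))); rewrite -E; apply/esym/eqP.
by rewrite perm_cat2l.
Qed.

End Branching.

Lemma all_flatten (A : Type) (p : pred A) (T : seq (seq A)) :
  all p (flatten T) = all (all p) T.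
Proof. by elim: T => //= r T <-; rewrite all_cat. Qed.

Lemma is_ssctP T :
  reflect [/\ all (leq 1) (flatten T),
              forall i, sorted geq (nth [::] T i),
              forall a b, a < b -> b < size T -> entry T a 0 < entry T b 0 &
              forall a b m, a < b -> b < size T -> entry T b m.+1 != 0 ->
                entry T a m.+1 <= entry T b m.+1 -> entry T a m < entry T b m.+1]
    (is_ssct T).
Proof.
have headE i : head 0 (nth [::] T i) = entry T i 0 by rewrite /entry nth0.
apply: (iffP and4P) => -[H1 H2 H3 H4]; split.
- by rewrite all_flatten.
- move=> i; case: (ltnP i (size T)) => iT; last by rewrite nth_default.
  by apply: (allP H2); apply: mem_nth.
- move=> a b ab bT; move: H3; rewrite (sorted_pairwise ltn_trans) => /(pairwiseP 0).
  move=> /(_ a b); rewrite !inE size_map => /(_ (ltn_trans ab bT) bT ab).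
  by rewrite !(nth_map [::]) ?headE //; exact: ltn_trans ab bT.
- move=> a b m ab bT bm0 abm; have aT := ltn_trans ab bT.
  have mP : m < (\max_(row <- T) size row).-1.
    have mb : m.+1 < size (nth [::] T b).
      by rewrite ltnNge; apply: contra bm0 => mb; rewrite /entry nth_default.
    have : size (nth [::] T b) <= \max_(row <- T) size row.
      by apply: leq_bigmax_seq; rewrite ?mem_nth.
    by lia.
  have /forallP/(_ (Ordinal bT)) /= /implyP/(_ ab) := forallP H4 (Ordinal aT).
  by move/forallP/(_ (Ordinal mP))/implyP; apply; rewrite /= bm0 abm.
- by rewrite -all_flatten.
- by apply/(all_nthP [::]) => i _; exact: H2.
- rewrite (sorted_pairwise ltn_trans); apply/(pairwiseP 0) => a b.
  rewrite !inE size_map => aT bT ab; rewrite !(nth_map [::]) // !headE.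
  exact: H3.
- apply/forallP => a; apply/forallP => b; apply/implyP => ab; apply/forallP => m.
  by apply/implyP => /andP[bm abm]; apply: H4.
Qed.

(** * Generation of semistandard composition tableaux *)

Fixpoint tableau_bump (x j : nat) (T : seq (seq nat)) : option (seq (seq nat)) :=
  if T is r :: T' then
    if size r == j then Some (rcons r x :: T') else omap (cons r) (tableau_bump x j T')
  else None.

Definition tableau_grow (x j : nat) (T : seq (seq nat)) : option (seq (seq nat)) :=
  if j == 0 then Some ([:: x] :: T) else tableau_bump x j T.

Lemma shape_tableau_grow x j T : omap shape (tableau_grow x j T) = grow j (shape T).
Proof.
rewrite /tableau_grow /grow; case: (j =P 0) => //= _.
elim: T => //= r T IHT; case: eqP => [<-|_] /=; first by rewrite size_rcons.
by rewrite -IHT; case: (tableau_bump x j T).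
Qed.

Lemma tableau_bumpP x j T U :
  tableau_bump x j T = Some U <->
  exists i, [/\ i < size T, size (nth [::] T i) = j,
    forall a, a < i -> size (nth [::] T a) <> j &
    U = set_nth [::] T i (rcons (nth [::] T i) x)].
Proof.
elim: T U => [|r T IHT] U /=; first by split=> // -[i []].
case: eqP => rj.
  split=> [[<-]|[[|i] [_ sj Hi ->]]] //; first by exists 0; split.
  by case: (Hi 0 isT rj).
split.
  case E: (tableau_bump x j T) => [V|] //= [<-].
  have [i [iT sj Hi ->]] := (IHT V).1 E; exists i.+1; split=> //.
  by case=> [|a] ai //=; exact: Hi.
case=> -[|i] [iT sj Hi ->] //=.
rewrite (_ : tableau_bump x j T = Some (set_nth [::] T i (rcons (nth [::] T i) x))) //.
by apply/IHT; exists i; split=> // a ai; exact: (Hi a.+1).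
Qed.

Definition column_free (x j : nat) (T : seq (seq nat)) : Prop :=
  forall i m, j <= m -> entry T i m != x.

Lemma entry_ge x T i m : all (leq x) (flatten T) -> entry T i m != 0 -> x <= entry T i m.
Proof.
move=> Tx; rewrite /entry => H; apply: (allP Tx); apply/flattenP.
have mi : m < size (nth [::] T i).
  by rewrite ltnNge; apply: contra H => mi; rewrite nth_default.
exists (nth [::] T i); last exact: mem_nth.
by apply: mem_nth; rewrite ltnNge; apply/negP => iT; move: mi; rewrite nth_default.
Qed.

Lemma entry_eq0 T i m : all (leq 1) (flatten T) ->
  (entry T i m == 0) = (size (nth [::] T i) <= m).
Proof.
move=> T1; case: leqP => mi; first by rewrite /entry nth_default.
apply/negbTE; rewrite -lt0n; apply: (allP T1); apply/flattenP.
exists (nth [::] T i); last exact: mem_nth.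
by apply: mem_nth; rewrite ltnNge; apply/negP => iT; move: mi; rewrite nth_default.
Qed.

Lemma entry_set T i x a m : i < size T ->
  entry (set_nth [::] T i (rcons (nth [::] T i) x)) a m =
  if (a == i) && (m == size (nth [::] T i)) then x else entry T a m.
Proof.
move=> iT; rewrite /entry nth_set_nth /=; case: eqP => //= ->.
by rewrite nth_rcons; case: ltngtP => // H; rewrite nth_default // ltnW.
Qed.

Lemma perm_flatten_set (T : seq (seq nat)) i x : i < size T ->
  perm_eq (flatten (set_nth [::] T i (rcons (nth [::] T i) x))) (x :: flatten T).
Proof.
elim: T i => // r T IHT [_|i iT] /=.
  by rewrite cat_rcons -cat1s perm_catCA.
by rewrite -cat1s perm_sym perm_catCA perm_cat2l perm_sym IHT.
Qed.

(** The new entry is minimal, and other entries [x] lie in earlier columns. A row above the extended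
    one does not have length [j], as the topmost such row was chosen: it is either shorter, with 0
    in column j - 1, or longer, with an entry above [x] in column [j]. Both satisfy the triple
    condition. *)
Lemma tableau_grow_ssct x j T U : 0 < x -> is_ssct T -> [::] \notin T ->
  all (leq x) (flatten T) -> column_free x j T -> tableau_grow x j T = Some U ->
  [/\ is_ssct U, [::] \notin U, perm_eq (flatten U) (x :: flatten T) &
      column_free x j.+1 U /\ exists i, entry U i j = x].
Proof.
move=> x0 /is_ssctP [T1 rows heads trip] Tne Tx cf.
have gtx i m : j <= m -> entry T i m != 0 -> x < entry T i m.
  by move=> jm /(entry_ge Tx) H; rewrite ltn_neqAle H andbT eq_sym cf.
have ne i : i < size T -> entry T i 0 != 0.
  move=> iT; rewrite entry_eq0 // -ltnNge lt0n size_eq0.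
  by apply: contraNneq Tne => <-; apply: mem_nth.
rewrite /tableau_grow; case: (j =P 0) => [j0 [<-]|/eqP j0 /tableau_bumpP].
  subst j; split=> //; last 1 first.
  - split=> [[|i] [|m] //|]; last by exists 0.
      by move=> _; rewrite /entry /= nth_nil; case: (x) x0.
    by move=> _; apply: cf.
  - apply/is_ssctP; split.
    + by rewrite /= x0.
    + by case.
    + by case=> [|a] [|b] //= ab bT; [apply: gtx => //; exact: ne | exact: heads].
    + case=> [|a] [|b] m //= ab bT bm abm; last exact: trip.
      case: m bm abm => [|m] bm abm; first exact: gtx.
      by rewrite {1}/entry /= nth_nil lt0n.
case=> i [iT sj Hi ->]; set r := nth [::] T i.
have E := entry_set x _ _ iT; rewrite -/r sj in E.
have pf := perm_flatten_set x iT.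
split=> //.
- have U1 : all (leq 1) (flatten (set_nth [::] T i (rcons r x))).
    by rewrite (perm_all _ pf) /= x0.
  apply/is_ssctP; split=> //.
  + move=> a; rewrite nth_set_nth /=; case: eqP => // _.
    have tr : transitive geq by move=> a' b c /= ba ac; exact: leq_trans ac ba.
    rewrite -cats1 (sorted_pairwise tr) pairwise_cat -(sorted_pairwise tr) rows /= andbT.
    apply/allrelP => y z yr; rewrite inE => /eqP ->; apply: (allP Tx).
    by apply/flattenP; exists r => //; apply: mem_nth.
  + move=> a b ab; rewrite size_set_nth (maxn_idPr iT) => bT; rewrite !E.
    by rewrite !(eq_sym 0) (negPf j0) !andbF; exact: heads.
  + move=> a b m ab; rewrite size_set_nth (maxn_idPr iT) => bT; rewrite !E.
    case: (b =P i) => [bi|_] /=.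
      subst b; rewrite (ltn_eqF ab) /=; case: (m.+1 =P j) => [mj _|_]; last exact: trip.
      rewrite leqNgt; case: (posnP (entry T a m.+1)) => [|am].
        move/eqP; rewrite entry_eq0 // mj => aj _.
        have : size (nth [::] T a) <= m.
          by rewrite -ltnS mj ltn_neqAle aj andbT; apply/eqP; exact: Hi.
        by rewrite -entry_eq0 // => /eqP ->.
      by rewrite gtx ?mj // -lt0n // -mj.
    case: (a =P i) => [ai|_] /=; last exact: trip.
    subst a; move=> bm; case: (m.+1 =P j) => [mj|_].
      rewrite ltn_eqF -?mj // => _; apply: trip => //.
      by rewrite (eqP (_ : entry T i m.+1 == 0)) ?entry_eq0 // mj sj.
    case: (m =P j) => [mj|_]; last exact: trip.
    by move=> _; apply: gtx => //; rewrite mj.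
- apply/negP => /(nthP [::]) [a aU]; rewrite nth_set_nth /=.
  case: eqP => [_ /(congr1 size)|_ Ea]; first by rewrite size_rcons.
  have aT : a < size T by move: aU; rewrite size_set_nth (maxn_idPr iT).
  by case/negP: Tne; rewrite -Ea mem_nth.
- split=> [a m jm|]; last by exists i; rewrite E !eqxx.
  by rewrite E (gtn_eqF jm) andbF; apply: cf; exact: ltnW.
Qed.

Definition tableau_cut (x j : nat) (T : seq (seq nat)) : seq (seq nat) :=
  if j == 0 then behead T
  else [seq if nth 0 r j == x then take j r else r | r <- T].

Lemma tableau_growK x j T U : 0 < x -> column_free x j T ->
  tableau_grow x j T = Some U -> tableau_cut x j U = T.
Proof.
move=> x0 cf; rewrite /tableau_grow /tableau_cut; case: (j =P 0) => [_ [<-]|j0] //.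
elim: T U cf => //= r T IHT U cf.
have rx : (nth 0 r j == x) = false by apply/negbTE; exact: (cf 0).
have cfT : column_free x j T by move=> i m; exact: (cf i.+1).
have mapT : [seq if nth 0 r j == x then take j r else r | r <- T] = T.
  apply: map_id_in => s /(nthP [::]) [i iT <-]; case: ifP => // /eqP H.
  by have /eqP := cfT i j (leqnn j).
case: eqP => [rj [<-]|_].
  rewrite /= mapT nth_rcons rj ltnn !eqxx -cats1 take_size_cat //.
by case E: (tableau_bump x j T) => [V|] // [<-] /=; rewrite rx (IHT V).
Qed.

(** This [x] is the only one in its column and ends its row. A higher row of length [j] > 0 would
    have 0 in column [j] and an entry at least [x] in column j - 1, against the triple condition; so
    regrowing puts the box back in the same row. *)
Lemma tableau_cut_ssct x j U i : 0 < x -> is_ssct U -> [::] \notin U ->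
  all (leq x) (flatten U) -> column_free x j.+1 U -> entry U i j = x ->
  exists T, [/\ tableau_grow x j T = Some U, is_ssct T, [::] \notin T,
     perm_eq (flatten U) (x :: flatten T) & column_free x j T].
Proof.
move=> x0 /is_ssctP [U1 rows heads trip] Une Ux cf Eij.
have iU : i < size U.
  by rewrite ltnNge; apply/negP => iU; move: Eij x0; rewrite /entry (nth_default [::] iU) nth_nil => <-.
have uniq_i a : a < size U -> entry U a j = x -> a = i.
  wlog ai : a i iU Eij / a < i => [W aU Ea|aU Ea].
    by case: (ltngtP a i) => // ai; [apply: W | apply/esym; apply: W].
  case: j cf Eij Ea => [|j] cf Eij Ea.
    by have := heads a i ai iU; rewrite Eij Ea ltnn.
  have := trip a i j ai iU; rewrite Eij Ea -lt0n x0 leqnn => /(_ isT isT).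
  have aj : entry U a j != 0.
    rewrite entry_eq0 // -ltnNge; apply: leq_trans (leqnSn _) _; rewrite ltnNge -entry_eq0 //.
    by rewrite Ea -lt0n.
  by rewrite ltnNge (entry_ge Ux aj).
have szi : size (nth [::] U i) = j.+1.
  apply/eqP; rewrite eqn_leq -[X in X && _]entry_eq0 // ltnNge -entry_eq0 //.
  rewrite Eij -lt0n x0 andbT; apply/negPn/negP => H.
  have := entry_ge Ux H; have := rows i.
  rewrite /entry in Eij *.
  move: (cf i j.+1 (leqnn _)); rewrite /entry.
  have tr : transitive geq by move=> a' b c /= ba ac; exact: leq_trans ac ba.
  move=> ne srt xle.
  have sz : j.+1 < size (nth [::] U i) by rewrite ltnNge -entry_eq0.
  have := sorted_ltn_nth tr 0 srt; move=> /(_ j j.+1); rewrite !inE sz (ltnW sz).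
  by move=> /(_ isT isT (ltnSn j)) /=; rewrite Eij => le; case/eqP: ne; lia.
case: (j =P 0) => [j0|/eqP j0].
  subst j; have i0 : i = 0.
    case: i iU Eij uniq_i szi => // i iU Eij _ _.
    have := heads 0 i.+1 isT iU; rewrite Eij ltnNge (entry_ge Ux) //.
    rewrite entry_eq0 // -ltnNge lt0n size_eq0; apply: contraNneq Une => <-.
    by apply: mem_nth; exact: leq_trans iU.
  subst i; case: U U1 rows heads trip Une Ux cf Eij iU uniq_i szi => // r T.
  move=> U1 rows heads trip Une Ux cf Eij iU uniq_i szi.
  have rE : r = [:: x] by move: szi Eij; rewrite /entry /=; case: (r) => [|y [|]] //= _ ->.
  subst r; exists T; split=> //.
  - apply/is_ssctP; split=> //.
    + by case/andP: U1.
    + by move=> a; exact: (rows a.+1).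
    + by move=> a b; exact: (heads a.+1 b.+1).
    + by move=> a b m; exact: (trip a.+1 b.+1 m).
  - move=> a [|m] jm; last exact: (cf a.+1).
    apply/eqP => E; suff : a.+1 = 0 by []; apply: uniq_i => //.
    rewrite ltnNge; apply/negP => sT; move: E x0.
    by rewrite /entry (nth_default [::]) // nth_nil => <-.
set r := nth [::] U i in szi.
have rE : r = rcons (take j r) x.
  by rewrite -Eij -/r /entry -/r -take_nth ?szi // -szi take_size.
pose T := set_nth [::] U i (take j r).
have sT : size T = size U by rewrite size_set_nth (maxn_idPr iU).
have iT : i < size T by rewrite sT.
have Ti : nth [::] T i = take j r by rewrite nth_set_nth /= eqxx.
have TU : set_nth [::] T i (rcons (nth [::] T i) x) = U.
  apply: (eq_from_nth (x0 := [::])); first by rewrite size_set_nth (maxn_idPr iT).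
  by move=> a _; rewrite Ti -rE nth_set_nth /= nth_set_nth /=; case: eqP => // ->.
have sTi : size (nth [::] T i) = j by rewrite Ti size_take szi ltnSn.
have E a m : entry T a m = if (a == i) && (m == j) then 0 else entry U a m.
  have := entry_set x a m iT; rewrite TU sTi => ->.
  case: (a =P i) => [->|] //=; case: (m =P j) => [->|] //=.
  by rewrite /entry nth_default // sTi.
have pf : perm_eq (flatten U) (x :: flatten T) by rewrite -{1}TU perm_flatten_set.
have [T1 Tx] : all (leq 1) (flatten T) /\ all (leq x) (flatten T).
  by split; [move: U1 | move: Ux]; rewrite (perm_all _ pf) => /andP[].
exists T; split=> //.
- rewrite /tableau_grow (negPf j0); apply/tableau_bumpP; exists i; split=> // a ai.
  have aU := ltn_trans ai iU.
  move=> sa; have := trip a i j.-1 ai iU; rewrite prednK ?lt0n // Eij -lt0n x0.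
  have Na : nth [::] T a = nth [::] U a by rewrite nth_set_nth /= ltn_eqF.
  have -> : entry U a j = 0 by rewrite /entry -Na nth_default // sa.
  move=> /(_ isT isT); rewrite ltnNge (entry_ge Ux) //.
  by rewrite entry_eq0 // -ltnNge -Na sa prednK ?lt0n.
- apply/is_ssctP; split=> //.
  + move=> a; rewrite nth_set_nth /=; case: eqP => // _; apply: take_sorted.
    exact: rows.
  + by move=> a b ab; rewrite sT !E !(eq_sym 0) (negPf j0) !andbF; exact: heads.
  + move=> a b m ab; rewrite sT => bU; rewrite !E; case: ifP => // _ bm.
    move=> abm; have {}abm : entry U a m.+1 <= entry U b m.+1.
      case: ifP abm => // /andP[/eqP -> /eqP mj] _; rewrite mj Eij -mj.
      exact: entry_ge.
    by case: ifP => [_|_]; [rewrite lt0n | exact: trip].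
- apply/negP => /(nthP [::]) [a]; rewrite sT => aU; rewrite nth_set_nth /=.
  case: eqP => [_ /(congr1 size)|_ Ea].
    by rewrite size_take szi ltnSn => /eqP; rewrite (negPf j0).
  by case/negP: Une; rewrite -Ea mem_nth.
move=> a m jm; rewrite E; case: (m =P j) => [->|/eqP mj].
  case: (a =P i) => [_|ai] /=; first by rewrite ltn_eqF.
  apply/eqP => Ea; case: ai; apply: uniq_i => //.
  by rewrite ltnNge; apply/negP => sa; move: Ea x0; rewrite /entry (nth_default [::] sa) nth_nil => <-.
by rewrite andbF; apply: cf; rewrite ltn_neqAle eq_sym mj.
Qed.

Fixpoint tableau_strip (x c k : nat) (L : seq (seq (seq nat))) : seq (seq (seq nat)) :=
  match c, k with
  | 0, 1 => L
  | c'.+1, k'.+1 =>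
      tableau_strip x c' k L ++ pmap (tableau_grow x c') (tableau_strip x c' k' L)
  | _, _ => [::]
  end.

Definition ssct_level (x c : nat) (w : seq nat) (T : seq (seq nat)) : Prop :=
  [/\ is_ssct T, [::] \notin T, perm_eq (flatten T) w & column_free x c T].

(** Equal entries lie in distinct columns, so each tableau is built in a unique way from left to
    right. The two lists joined at each step are told apart by whether column [c] contains [x]. *)
Lemma mem_tableau_strip x c k L w : 0 < x -> all (ltn x) w ->
  (forall T, T \in L <-> ssct_level x 0 w T) -> uniq L ->
  uniq (tableau_strip x c k.+1 L) /\
  (forall T, T \in tableau_strip x c k.+1 L <-> ssct_level x c (nseq k x ++ w) T).
Proof.
move=> x0 wx HL uL; have wx' k' : all (leq x) (nseq k' x ++ w).
  by rewrite all_cat all_nseq leqnn orbT /=; apply: sub_all wx => y /= /ltnW.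
elim: c k => [|c IHc] k.
  case: k => [|k] //=; split=> // T; split=> // -[_ _ Tw cf]; exfalso.
  have : x \in flatten T by rewrite (perm_mem Tw) inE eqxx.
  case/flattenP => r /(nthP [::]) [i iT <-] /(nthP 0) [m mr Em].
  by have := cf i m isT; rewrite /entry Em eqxx.
have [u1 m1] := IHc k.
case: k u1 m1 => [|k] u1 m1.
  have -> : tableau_strip x c.+1 1 L = tableau_strip x c 1 L.
    by rewrite /=; case: (c) => [|c'] /=; rewrite cats0.
  split=> // T; rewrite m1; split=> -[H1 H2 H3 H4]; split=> // i m cm.
    by apply: H4; exact: ltnW.
  apply/eqP => E; have : x \in flatten T.
    have mi : m < size (nth [::] T i).
      by rewrite ltnNge; apply/negP => mi; move: E x0; rewrite /entry nth_default // => <-.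
    apply/flattenP; exists (nth [::] T i); last by rewrite -E; exact: mem_nth.
    by apply: mem_nth; rewrite ltnNge; apply/negP => iT; move: mi; rewrite nth_default.
  by rewrite (perm_mem H3) => /(allP wx); rewrite /= ltnn.
have [u2 m2] := IHc k.
have grown T U : T \in tableau_strip x c k.+1 L -> tableau_grow x c T = Some U ->
  ssct_level x c.+1 (nseq k.+1 x ++ w) U /\ exists i, entry U i c = x.
  move=> /m2 [H1 H2 H3 H4] G.
  have Tx : all (leq x) (flatten T) by rewrite (perm_all _ H3) wx'.
  have [G1 G2 G3 [G4 G5]] := tableau_grow_ssct x0 H1 H2 Tx H4 G.
  by split=> //; split=> //; rewrite (perm_trans G3) //= perm_cons.
rewrite [tableau_strip _ _ _ _]/=; split.
  rewrite cat_uniq u1 /=; apply/andP; split.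
    apply/hasPn => U; rewrite mem_pmap => /mapP[T TL /esym G] /=.
    have [_ [i Ei]] := grown T U TL G.
    by apply/negP => /m1 [_ _ _ /(_ i c (leqnn c))]; rewrite Ei eqxx.
  have : {in tableau_strip x c k.+1 L &, forall T U,
      tableau_grow x c T != None -> tableau_grow x c T = tableau_grow x c U -> T = U}.
    move=> T U /m2[_ _ _ cT] /m2[_ _ _ cU]; case G: (tableau_grow x c T) => [V|] // _ G'.
    by rewrite -(tableau_growK x0 cT G) (tableau_growK x0 cU (esym G')).
  elim: (tableau_strip x c k.+1 L) u2 => //= T L' IH /andP[TL' uL'] inj.
  have IH' : uniq (pmap (tableau_grow x c) L').
    by apply: IH => // U V UL VL; apply: inj; rewrite inE ?UL ?VL orbT.
  case G: (tableau_grow x c T) => [V|] //=; rewrite IH' andbT mem_pmap.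
  apply/mapP => -[U UL' G']; case/negP: TL'.
  by rewrite (inj T U) ?inE ?eqxx ?UL' ?orbT ?G.
move=> U; rewrite mem_cat mem_pmap; split.
  case/orP=> [/m1 [H1 H2 H3 H4]|/mapP[T TL /esym G]].
    by split=> // i m /ltnW; exact: H4.
  by have [] := grown T U TL G.
case=> H1 H2 H3 H4.
have Ux : all (leq x) (flatten U) by rewrite (perm_all _ H3) wx'.
have [/hasP [i iP /eqP Ei]|cfc] := boolP (has (fun i => entry U i c == x) (iota 0 (size U))).
  have [T [G T1 T2 T3 T4]] := tableau_cut_ssct x0 H1 H2 Ux H4 Ei.
  apply/orP; right; apply/mapP; exists T => //; apply/m2; split=> //.
  by have := perm_trans (eq_rect _ _ T3 _ (perm_sym _ _)) H3; rewrite /= perm_cons.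
apply/orP; left; apply/m1; split=> // i m; rewrite leq_eqVlt => /predU1P[<-|]; last exact: H4.
case: (ltnP i (size U)) => iU; last by rewrite /entry (nth_default [::] iU) nth_nil eq_sym -lt0n.
by have /hasPn := cfc; apply; rewrite mem_iota.
Qed.

Fixpoint ssct_list (N x : nat) (b : seq nat) : seq (seq (seq nat)) :=
  if b is k :: b' then tableau_strip x N k.+1 (ssct_list N x.+1 b') else [:: [::]].

Fixpoint weight_from (x : nat) (b : seq nat) : seq nat :=
  if b is k :: b' then nseq k x ++ weight_from x.+1 b' else [::].

Lemma weight_wordE b : weight_word b = weight_from 1 b.
Proof.
rewrite /weight_word -[RHS](_ : flatten [seq nseq (nth 0 b k) (1 + k) | k <- iota 0 (size b)] = _) //.
elim: b 1 => //= k b IHb x; rewrite addn0 -IHb -[1]/(1 + 0) iotaDl -map_comp.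
by congr (_ ++ flatten _); apply: eq_map => i /=; rewrite add1n addSnnS.
Qed.

Lemma weight_from_ge x b : all (leq x) (weight_from x b).
Proof.
elim: b x => //= k b IHb x; rewrite all_cat all_nseq leqnn orbT /=.
by apply: sub_all (IHb x.+1) => y /= /ltnW.
Qed.

Lemma size_weight_from x b : size (weight_from x b) = sumn b.
Proof. by elim: b x => //= k b IHb x; rewrite size_cat size_nseq IHb. Qed.

(** No row is longer than the number of boxes, so the column bound [N] excludes no tableau. *)
Lemma mem_ssct_list N x b : 0 < x -> sumn b <= N ->
  uniq (ssct_list N x b) /\
  (forall T, T \in ssct_list N x b <->
     [/\ is_ssct T, [::] \notin T & perm_eq (flatten T) (weight_from x b)]).
Proof.
elim: b x => [|k b IHb] x x0 bN.
  split=> // T; rewrite inE; split=> [/eqP ->|[_ Tne]].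
    split=> //; apply/is_ssctP; split=> // i; by rewrite nth_nil.
  by move/perm_nilP; case: T Tne => // r T; rewrite inE => /norP[+ _] /=; case: r.
have [uL mL] := IHb x.+1 isT (leq_trans (leq_addl _ _) bN).
have wx : all (ltn x) (weight_from x.+1 b) by exact: weight_from_ge.
have notx T i m : x \notin flatten T -> entry T i m != x.
  move=> Tx; apply/eqP => E; case/negP: Tx; have mi : m < size (nth [::] T i).
    by rewrite ltnNge; apply/negP => mi; move: E x0; rewrite /entry nth_default // => <-.
  apply/flattenP; exists (nth [::] T i); last by rewrite -E; exact: mem_nth.
  by apply: mem_nth; rewrite ltnNge; apply/negP => iT; move: mi; rewrite nth_default.
have HL T : T \in ssct_list N x.+1 b <-> ssct_level x 0 (weight_from x.+1 b) T.
  rewrite mL; split=> -[H1 H2 H3] //; split=> // i m _; apply: notx.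
  by rewrite (perm_mem H3); apply/negP => /(allP wx); rewrite /= ltnn.
have [u m] := mem_tableau_strip N k x0 wx HL uL.
split=> // T; rewrite m; split=> [[]|[H1 H2 H3]] //; split=> // i c Nc.
rewrite /entry nth_default; first by rewrite eq_sym -lt0n.
apply: leq_trans Nc; apply: leq_trans bN.
have := perm_size H3; rewrite size_cat size_nseq size_weight_from => E; rewrite /= -E.
case: (ltnP i (size T)) => iT; last by rewrite nth_default.
by rewrite size_flatten -(nth_shape T i); exact: leq_nth_sumn.
Qed.

Lemma sum_tableau_strip x c k L (f : fct) :
  (\sum_(T <- tableau_strip x c k L) f (shape T) =
  \sum_(T <- L) add_strip c k f (shape T))%R.
Proof.
elim: c k f => [|c IHc] [|k] f.
- by rewrite big_nil big1.
- by case: k => [|k] //; rewrite big_nil big1.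
- by rewrite big_nil big1.
rewrite [tableau_strip _ _ _ _]/= big_cat IHc /=.
have -> : (\sum_(T <- pmap (tableau_grow x c) (tableau_strip x c k L)) f (shape T) =
    \sum_(T <- tableau_strip x c k L) up c f (shape T))%R.
  elim: (tableau_strip x c k L) => [|T L' IH]; first by rewrite !big_nil.
  rewrite big_cons /= /up -(shape_tableau_grow x).
  by case: (tableau_grow x c T) => [U|] /=; rewrite ?big_cons IH ?add0r.
by rewrite IHc -big_split.
Qed.

Definition indicator (a : seq nat) : fct := fun b => (b == a)%:R%R.

Lemma add_stripsE N x b (f : fct) :
  (add_strips N b f [::] = \sum_(T <- ssct_list N x b) f (shape T))%R.
Proof.
elim: b x f => [|k b IHb] x f; first by rewrite big_seq1.
by rewrite /= sum_tableau_strip (IHb x.+1).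
Qed.

(** [is_ssct] admits an empty first row, whereas the generated tableaux have nonempty rows only;
    hence the condition that [a] has no zero part. *)
Lemma kostka_ssctE N a b : 0 \notin a -> sumn b <= N ->
  (kostka_ssct a b)%:R%R = add_strips N b (indicator a) [::].
Proof.
move=> a0 bN; have [u m] := @mem_ssct_list N 1 b isT bN.
rewrite /kostka_ssct -size_fillings weight_wordE.
have -> : size (fillings is_ssct a (weight_from 1 b)) =
    count (fun T => shape T == a) (ssct_list N 1 b).
  rewrite -size_filter; apply: perm_size; apply: uniq_perm.
  - exact: fillings_uniq.
  - exact: filter_uniq.
  move=> T; rewrite mem_fillings mem_filter; case: eqP => //= sT; apply/andP/idP.
    case=> Tw TT; apply/m; split=> //; apply: contra a0 => T0.
    by rewrite -sT; apply/mapP; exists [::].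
  by case/m.
rewrite (add_stripsE N 1) -sum1_count natr_sum big_mkcond /=.
by apply: eq_bigr => T _; rewrite /indicator; case: eqP.
Qed.

(** * Shifted Jacobi-Trudi coefficients and Young tableaux *)

Lemma shift_sums_ext a s (eps eps' : seq nat -> rat) :
  (forall u, size u = size s -> eps u = eps' u) ->
  shift_sums a eps s = shift_sums a eps' s.
Proof.
elim: a eps eps' => [|t a IHa] eps eps' E /=; first exact: E.
by apply: IHa => u Hu; apply: shift_sum_ext => v Hv _; apply: E; rewrite Hv.
Qed.

Lemma shift_sums_sum a s (I : Type) (r : seq I) (P : pred I) (e : I -> seq nat -> rat) :
  (shift_sums a (fun u => \sum_(i <- r | P i) e i u) s =
  \sum_(i <- r | P i) shift_sums a (e i) s)%R.
Proof.
elim: a e => //= t a IHa e; rewrite -IHa; apply: shift_sums_ext => u _.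
have E := @shift_sum_sum u t _ r (fun i => (P i)%:R%R) e.
apply: etrans (etrans E _).
  apply: shift_sum_ext => v _ _; rewrite big_mkcond.
  by apply: eq_bigr => i _; case: (P i); rewrite ?mul1r ?mul0r.
rewrite [RHS]big_mkcond.
by apply: eq_bigr => i _; case: (P i); rewrite ?mul1r ?mul0r.
Qed.

Lemma shift_sums_rcons a t (eps : seq nat -> rat) s :
  shift_sums (rcons a t) eps s = shift_sums a (fun u => shift_sum u t eps) s.
Proof.
elim: a eps => //= t' a IHa eps; rewrite IHa; apply: shift_sums_ext => u _.
exact: shift_sumC.
Qed.

Definition content (a vs : seq nat) : seq nat :=
  flatten [seq nseq p.1 p.2 | p <- zip a vs].

Lemma content_rcons a t vs v : size a = size vs ->
  content (rcons a t) (rcons vs v) = content a vs ++ nseq t v.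
Proof. by move=> E; rewrite /content zip_rcons // map_rcons flatten_rcons. Qed.

(** The shift for the largest value is brought next to [jt_sign], which is possible since shifts
    commute. Then [shift_sum_jt_sign] and [num_ssyt_branch] give the same recursion on both
    sides. *)
Lemma shift_sums_jt_sign a vs k :
  size a = size vs -> sorted ltn vs -> sorted geq k ->
  shift_sums a (jt_sign k) (nseq (size k) 0) =
  (num_tableaux is_ssyt k (content a vs))%:R%R.
Proof.
move=> sa svs; elim/last_ind: a vs k sa svs => [|a t IHa] vs k.
  case: vs => // _ _ kk; rewrite /= jt_sign_partition ?size_nseq //; last first.
    by apply/(sortedP 0) => i _; rewrite !nth_nseq !if_same.
  congr (_%:R)%R; rewrite /num_tableaux /content /= /reads addn0 /= eq_sym.
  have -> : is_ssyt (reshape k [::]).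
    have nil i : nth [::] (reshape k [::]) i = [::].
      by elim: (k) i => [|x k' IHk] [|i] //=.
    by apply/is_ssytP; split=> [i|i j m _ _]; rewrite nil.
  rewrite andbT (eq_sym 0); congr (nat_of_bool _).
  by elim: (k) => //= x k' IHk; rewrite addn_eq0 -IHk eqseq_cons.
case/lastP: vs => [|vs v]; first by rewrite size_rcons.
rewrite !size_rcons => -[sa] svs kk.
have [svs' vv] : sorted ltn vs /\ all (gtn v) vs.
  move: svs; rewrite !(sorted_pairwise ltn_trans) pairwise_rcons => /andP[H ->].
  by split.
rewrite shift_sums_rcons (@shift_sums_ext _ _ _ (fun u => \sum_(g : {ffun 'I_(size k) -> 'I_(sumn k).+1} |
      interlaced (size k) k (row_seq g) && (sumn (row_seq g) + t == sumn k))
     jt_sign (row_seq g) u)%R); last first.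
  by move=> u; rewrite size_nseq => su; apply: shift_sum_jt_sign.
have pc : perm_eq (content a vs ++ nseq t v) (nseq t v ++ content a vs).
  by rewrite perm_catC.
rewrite shift_sums_sum content_rcons // (num_tableaux_perm _ _ pc).
rewrite num_ssyt_branch //; last first.
  apply/allP => y /flattenP [r /mapP[p pz ->]] /nseqP [-> _].
  apply: (allP vv); have := map_f snd pz; rewrite -/(unzip2 _) unzip2_zip //.
  by rewrite sa.
rewrite natr_sum; apply: eq_bigr => g /andP[il _].
have := IHa vs (row_seq g) sa svs' (interlaced_sorted (size_row_seq g) il).
by rewrite size_row_seq.
Qed.

Lemma add_strips_filter N b f :
  add_strips N (filter (predC1 0) b) f = add_strips N b f.
Proof.
elim: b f => //= k b IHb f; case: (k =P 0) => [->|_] /=; last exact: IHb.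
by rewrite add_strip1 IHb.
Qed.

(** * Monomial coefficients as values of operators *)

Definition exps (m : {mset nat}%mset) : seq nat :=
  [seq m i | i <- sort leq (finsupp m)].

Lemma sumn_exps (m : {mset nat}%mset) : sumn (exps m) = size m.
Proof.
rewrite (perm_sumn (s2 := [seq m i | i <- finsupp m])); last first.
  by rewrite perm_map // perm_sort.
rewrite EnumMset.E size_flatten /shape -map_comp; congr sumn.
by apply: eq_map => i /=; rewrite size_nseq.
Qed.

Lemma exps_neq0 m : 0 \notin exps m.
Proof.
apply/mapP => -[i]; rewrite mem_sort mem_finsupp => /negP H E.
by apply: H; rewrite -E.
Qed.

Lemma qschurE n (a : composition n) m : qschur a m = (kostka_ssct a (exps m))%:R%R.
Proof.
have sa : sumn a = n by have /andP[/eqP] := partsP a.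
rewrite /qschur /mono_qsym -/(exps m).
have [mn|mn] := eqVneq (size m) n; last first.
  rewrite /kostka_ssct num_tableaux_size ?weight_wordE ?size_weight_from ?sumn_exps ?sa //.
  rewrite big1 // => b _; case: eqP => E; last by rewrite mulr0.
  by case/eqP: mn; rewrite -sumn_exps E; have /andP[/eqP ->] := partsP b.
have cP : is_composition n (exps m) by rewrite /is_composition sumn_exps mn eqxx exps_neq0.
rewrite (bigD1 (Composition cP)) //= eqxx mulr1 big1 ?addr0 // => b bN.
case: eqP => [E|]; last by rewrite mulr0.
by case/eqP: bN; apply: val_inj; rewrite /= E.
Qed.

Lemma exps_vars (m : {mset nat}%mset) vs : sorted ltn vs -> {subset finsupp m <= vs} ->
  exps m = filter (predC1 0) [seq m v | v <- vs].
Proof.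
move=> svs sub; rewrite filter_map /exps; congr map.
have tr := ltn_trans; have irr : irreflexive ltn by exact: ltnn.
apply: (irr_sorted_eq tr irr) => [||v].
- rewrite ltn_sorted_uniq_leq sort_uniq fset_uniq; exact: sort_sorted leq_total _.
- by apply: sorted_filter.
rewrite mem_sort mem_filter mem_finsupp /=; case: eqP => //= vm; apply/esym/sub.
by rewrite mem_finsupp; apply/eqP.
Qed.

(** Zero exponents are allowed, so that both factors of a product can be read on the common list of
    variables of the full monomial. *)
Lemma qschur_vars N n (a : composition n) (m : {mset nat}%mset) vs :
  sorted ltn vs -> {subset finsupp m <= vs} -> size m <= N ->
  qschur a m = add_strips N [seq m v | v <- vs] (indicator a) [::].
Proof.
move=> svs sub mN; rewrite qschurE (kostka_ssctE (N := N)) ?sumn_exps //.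
  by rewrite (exps_vars svs sub) add_strips_filter.
by have /andP[] := partsP a.
Qed.

Lemma perm_content (m : {mset nat}%mset) vs : uniq vs -> {subset finsupp m <= vs} ->
  perm_eq m (content [seq m v | v <- vs] vs).
Proof.
move=> uvs sub; apply/allP => x _ /=; rewrite count_mem_mset.
have -> : content [seq m v | v <- vs] vs = flatten [seq nseq (m v) v | v <- vs].
  by congr flatten; elim: (vs) => //= v s ->.
rewrite count_flatten -map_comp.
have E : [seq (count_mem x \o (fun v => nseq (m v) v)) v | v <- vs] =
    [seq (if v == x then m v else 0) | v <- vs].
  by apply: eq_map => v /=; rewrite count_nseq /=; case: eqP => _; rewrite ?mul1n ?mul0n.
rewrite E sumnE big_map; have [xv|xv] := boolP (x \in vs).
  by rewrite (bigD1_seq x) //= eqxx big1 ?addn0 // => v /negPf ->.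
rewrite big_seq big1 => [|v vv]; last by case: eqP => // vx; rewrite -vx vv in xv.
by rewrite mset_eq0 -msuppE; apply: contra xv; exact: sub.
Qed.

Lemma schur_vars k (m : {mset nat}%mset) vs :
  sorted geq k -> sorted ltn vs -> {subset finsupp m <= vs} ->
  schur k m = shift_sums [seq m v | v <- vs] (jt_sign k) (nseq (size k) 0).
Proof.
move=> kk svs sub; rewrite (shift_sums_jt_sign (vs := vs)) ?size_map // /schur.
congr (_%:R)%R; apply: num_tableaux_perm; apply: perm_content => //.
exact: (sorted_uniq ltn_trans ltnn svs).
Qed.

Lemma mem_splits b p :
  (p \in splits b) = [&& size p.1 == size b, size p.2 == size b &
     [seq q.1 + q.2 | q <- zip p.1 p.2] == b].
Proof.
elim: b p => [|k b IHb] [a c]; first by rewrite inE; case: a c => [|x a] [|y c].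
apply/allpairsPdep/and3P => [[i [q [ik qb [-> ->]]]]|[]].
  move: qb; rewrite IHb => /and3P[s1 s2 /eqP s3]; rewrite /= !eqSS s1 s2 s3; split=> //.
  by rewrite subnKC // -ltnS; move: ik; rewrite mem_iota.
case: a c => [|x a] [|y c] //=; rewrite !eqSS => s1 s2 /eqP [xy ac].
exists x, (a, c); rewrite -[0 :: _]/(iota 0 k.+1) mem_iota IHb /= s1 s2 ac eqxx; split=> //.
  by rewrite add0n ltnS -xy leq_addr.
by rewrite -xy addKn.
Qed.

Lemma splits_uniq b : uniq (splits b).
Proof.
elim: b => // k b IHb.
apply: (@allpairs_uniq _ _ _ (fun i p => (i :: p.1, (k - i) :: p.2)) (iota 0 k.+1)
  (splits b)) => //; first exact: iota_uniq.
by move=> [i [a c]] [j [a' c']] _ _ [-> -> _ ->].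
Qed.

Lemma submsetsP (m u : {mset nat}%mset) :
  reflect (forall v, u v <= m v) (u \in submsets m).
Proof.
rewrite mem_undup; apply: (iffP mapP) => [[t _ ->] v|H].
  by rewrite mset_seqE -(count_mem_mset v m) leq_count_mask.
have /count_maskP [t st ut] : forall v, count_mem v u <= count_mem v m.
  by move=> v; rewrite !count_mem_mset.
exists (Tuple (introT eqP st)); first by rewrite mem_enum.
by rewrite /= -[LHS]seq_mset_id; apply/eq_seq_msetP.
Qed.

Lemma com_mul_splits N n (a : composition n) k (m : {mset nat}%mset) :
  sorted geq k -> size m <= N ->
  (com_mul (qschur a) (schur k) m =
  \sum_(p <- splits (exps m)) shift_sums p.1 (jt_sign k) (nseq (size k) 0%N) *
     add_strips N p.2 (indicator a) [::])%R.
Proof.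
move=> kk mN; pose vs := sort leq (finsupp m).
have svs : sorted ltn vs.
  rewrite ltn_sorted_uniq_leq sort_uniq fset_uniq; exact: sort_sorted leq_total _.
have mvs v : m v != 0 -> v \in vs by rewrite mem_sort mem_finsupp.
(* The exponents of the Schur factor come first, those of the quasisymmetric factor second, as in
   [add_strips_strips_sum]. *)
pose phi (u : {mset nat}%mset) := ([seq (m `\` u)%mset v | v <- vs], [seq u v | v <- vs]).
have sub (u : {mset nat}%mset) : (forall v, u v <= m v) -> {subset finsupp u <= vs}.
  move=> um v; rewrite mem_finsupp => uv; apply: mvs; move: uv (um v).
  by rewrite -!lt0n; exact: leq_trans.
have subB (u : {mset nat}%mset) : {subset finsupp (m `\` u)%mset <= vs}.
  move=> v; rewrite mem_finsupp msetE2 => H; apply: mvs.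
  by apply: contraNneq H => ->.
have uvs : uniq vs := sorted_uniq ltn_trans ltnn svs.
transitivity (\sum_(p <- map phi (submsets m)) shift_sums p.1 (jt_sign k) (nseq (size k) 0%N) *
     add_strips N p.2 (indicator a) [::])%R.
  rewrite big_map /com_mul big_seq [RHS]big_seq; apply: eq_bigr => u /submsetsP um.
  rewrite (qschur_vars (N := N) a svs (sub u um)); last first.
    apply: leq_trans mN; rewrite -(sumn_exps m) !sumnE /exps -/vs big_map.
    rewrite (perm_size (perm_content uvs (sub u um))) size_flatten sumnE.
    have -> : shape [seq nseq p.1 p.2 | p <- zip [seq u v | v <- vs] vs] = [seq u v | v <- vs].
      by elim: (vs) => //= v s ->; rewrite size_nseq.
    by rewrite big_map; apply: leq_sum => v _.
  by rewrite (schur_vars kk svs (subB u)) mulrC.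
apply: perm_big; apply: uniq_perm.
- rewrite map_inj_in_uniq ?undup_uniq // => u u' /submsetsP um /submsetsP um' [_].
  move/eq_in_map => E; apply/msetP => v; have [/E //|vvs] := boolP (v \in vs).
  have mv : m v = 0 by apply/eqP; rewrite -[_ == _]negbK; apply: contra vvs; exact: mvs.
  by have := um v; have := um' v; rewrite mv !leqn0 => /eqP -> /eqP ->.
- exact: splits_uniq.
move=> p; rewrite mem_splits !size_map; apply/mapP/and3P => [[u /submsetsP um ->]|[/eqP s1 /eqP s2 /eqP s3]].
  rewrite !size_map; split=> //; apply/eqP.
  by rewrite /exps -/vs /=; elim: (vs) => //= v s ->; rewrite msetE2 subnK.
pose u : {mset nat}%mset := [fsfun v in finsupp m => nth 0 p.2 (index v vs)].
have mvs' v : (v \in vs) = (v \in finsupp m) by rewrite mem_sort.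
have nth3 i : i < size vs -> nth 0 p.1 i + nth 0 p.2 i = m (nth 0 vs i).
  move=> ivs; have := congr1 (nth 0 ^~ i) s3; rewrite /exps -/vs.
  by rewrite (nth_map (0, 0)) ?nth_zip ?size_zip ?s1 ?s2 ?minnn //= (nth_map 0).
have uE v : u v = if v \in vs then nth 0 p.2 (index v vs) else 0.
  by rewrite fsfunE mvs'.
have um v : u v <= m v.
  rewrite uE; case: ifP => // vv; have := nth3 (index v vs).
  by rewrite index_mem vv nth_index // => <- //; exact: leq_addl.
exists u; first exact/submsetsP.
rewrite [p]surjective_pairing /phi; congr pair; apply: (eq_from_nth (x0 := 0)).
- by rewrite size_map s1.
- move=> i; rewrite s1 => ivs; rewrite (nth_map 0) // msetE2 -nth3 // uE.
  by rewrite mem_nth // index_uniq // addnK.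
- by rewrite size_map s2.
- move=> i; rewrite s2 => ivs; rewrite (nth_map 0) // uE.
  by rewrite mem_nth // index_uniq.
Qed.

(** * Expansion of the product *)

Fixpoint rem_word (w b : seq nat) : option (seq nat) :=
  if w is c :: w' then obind (rem_word w') (shrink c b) else Some b.

Lemma dn_word_indicator a w b :
  dn_word w (indicator a) b = (rem_word w b == Some a)%:R%R.
Proof.
elim: w b => [|c w IHw] b; first by rewrite /indicator /=; congr (_%:R)%R; case: eqVneq => [->|]; rewrite ?eqxx.
by rewrite /= /dn; case: (shrink c b).
Qed.

Lemma rem_word_sumn w b a : rem_word w b = Some a -> sumn b = sumn a + size w.
Proof.
elim: w b => [|c w IHw] b /=; first by case=> ->; rewrite addn0.
by case E: (shrink c b) => [g|] //= /IHw; rewrite (shrink_sumn E) => ->; rewrite addnS.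
Qed.

(** Only letters below [sumn b] can act on [b], so every [N] from [sumn b] on gives the same
    number. *)
Definition lr_coef (N : nat) (a k b : seq nat) : nat :=
  count (fun W => (map size W == k) && (rem_word (flatten W) b == Some a))
    (yam N (size k)).

Lemma lr_coef_neq0 N a k b : lr_coef N a k b != 0 -> sumn b = sumn a + sumn k.
Proof.
rewrite -lt0n -has_count => /hasP[W _ /andP[/eqP Wk /eqP /rem_word_sumn ->]].
by rewrite size_flatten /shape Wk.
Qed.

(** The same value is computed in two ways. Moving the adding operators inwards and evaluating at
    the empty composition gives the sum over splittings of the exponents; straightening instead
    leaves the configurations with row lengths exactly [k], each with coefficient 1. *)
Lemma com_mul_add_strips N n (a : composition n) k (m : {mset nat}%mset) :
  sorted geq k -> size m <= N ->
  com_mul (qschur a) (schur k) m =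
  add_strips N (exps m) (fun b => (lr_coef N a k b)%:R%R) [::].
Proof.
move=> kk mN; rewrite (com_mul_splits a kk mN).
have bnd s : size s = size k -> has (leq (sumn k + size k).+1) s -> jt_sign k s = 0%R.
  by move=> sk; apply: jt_sign_bounded.
transitivity (add_strips N (exps m)
   (strips_sum (sumn k + size k).+1 0 N (nseq (size k) [::]) (jt_sign k) (indicator a)) [::]).
  rewrite (add_strips_strips_sum _ bnd) ?sumn_exps //.
  by apply: eq_bigr => p _; rewrite strips_sum_nil.
congr add_strips; rewrite strips_sum_yam //; last first.
  by move=> s x y t; exact: jt_sign_swap.
apply/funext => b; rewrite fct_sumE /lr_coef -sum1_count natr_sum [RHS]big_mkcond /=.
rewrite big_seq [RHS]big_seq; apply: eq_bigr => W /yam_good [_ sW srt].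
rewrite fctE dn_word_indicator jt_sign_partition ?size_map //.
by case: eqP => _; case: eqP => _ /=; rewrite ?scale1r ?scale0r ?mul1r ?mul0r.
Qed.

Lemma sum_indicator n (f : seq nat -> rat) g :
  is_composition n g -> (\sum_(b : composition n) f b * indicator b g = f g)%R.
Proof.
move=> gP; rewrite (bigD1 (Composition gP)) //= /indicator eqxx mulr1 big1 ?addr0 // => b.
rewrite -val_eqE /= eq_sym => /negPf bg; by rewrite bg mulr0.
Qed.

Lemma qschur_expand N n (m : {mset nat}%mset) (f : fct) : size m = n -> n <= N ->
  (add_strips N (exps m) f [::] = \sum_(c : composition n) f c * qschur c m)%R.
Proof.
move=> mn nN; have eN : sumn (exps m) <= N by rewrite sumn_exps mn.
have [_ mem] := @mem_ssct_list N 1 (exps m) isT eN.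
under eq_bigr => c _.
  rewrite qschurE (kostka_ssctE (N := N)) //; last by have /andP[] := partsP c.
  rewrite (add_stripsE N 1) mulr_sumr; over.
rewrite (add_stripsE N 1) exchange_big /= big_seq [RHS]big_seq.
apply: eq_bigr => T /mem [_ Tne Tw].
rewrite (@sum_indicator n) //; apply/andP; split.
  by rewrite -size_flatten (perm_size Tw) size_weight_from sumn_exps mn.
by apply: contra Tne => /mapP[r rT /esym/size0nil <-].
Qed.

Lemma com_mul_qschur n n' (a : composition n') k :
  sorted geq k -> n' + sumn k = n -> forall m,
  (com_mul (qschur a) (schur k) m =
  \sum_(b : composition n) (lr_coef n a k b)%:R * qschur b m)%R.
Proof.
move=> kk nk m; have sa : sumn a = n' by have /andP[/eqP] := partsP a.
have [mn|mn] := eqVneq (size m) n.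
  rewrite (com_mul_add_strips (N := n) a kk) ?mn //.
  by rewrite (qschur_expand (fun b => (lr_coef n a k b)%:R%R) mn).
rewrite (com_mul_add_strips (N := size m) a kk) // big1 => [|b _]; last first.
  rewrite qschurE /kostka_ssct num_tableaux_size ?mulr0 //.
  rewrite weight_wordE size_weight_from sumn_exps.
  by have /andP[/eqP ->] := partsP b.
rewrite (@add_strips_local _ _ _ 0%R) ?linear0 // => g.
rewrite add0n sumn_exps => gm; case: (eqVneq (lr_coef (size m) a k g) 0) => [->//|].
by move/lr_coef_neq0; rewrite sa nk gm => mn'; rewrite mn' eqxx in mn.
Qed.

(** Only one strip survives, the one that opens a new first row and puts all [k] boxes there. The
    others keep the number of rows or end with a first row shorter than [k], and [f] vanishes on
    both kinds. *)
Lemma add_strip_top c k (f : fct) g : 0 < k ->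
  (forall h, size h = size g -> f h = 0%R) ->
  (forall i h, 0 < i < k -> size h = size g -> f (i :: h) = 0%R) ->
  add_strip c k.+1 f g = (if k <= c then f (k :: g) else 0%R).
Proof.
elim: c k f => [|c IHc] k f k0 f0 f1; first by case: k k0 {f1}.
have bump_size h h' : bump_part c h = Some h' -> size h' = size h.
  elim: h h' => //= x h IHh h'; case: eqP => [_ [<-] //|_].
  by case: (bump_part c h) IHh => // h'' IHh [<-] /=; rewrite (IHh h'').
rewrite add_stripS !fctE IHc //; case: k k0 f1 => // k _ f1.
case: (posnP k) => [->|k0].
  rewrite add_strip1 /up /grow; case: (c =P 0) => [->|/eqP c0]; first by rewrite /= add0r.
  rewrite lt0n c0 ltnS leq0n; case E: (bump_part c g) => [h|]; rewrite ?addr0 //.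
  by rewrite (f0 _ (bump_size _ _ E)) addr0.
case: (posnP c) => [->|c0].
  by case: (k) k0 => // k' _; rewrite /= !addr0.
have upE h : up c f h = if bump_part c h is Some h' then f h' else 0%R.
  by rewrite /up /grow -[c == 0]negbK -lt0n c0.
rewrite IHc // => [|h hg|i h /andP[i0 ik] hg]; first 1 last.
- by rewrite upE; case E: (bump_part c h) => [h'|] //; apply: f0; rewrite (bump_size _ _ E).
- rewrite upE /=; case: eqP => [ic|_]; first by apply: f1; rewrite //= -ic ltnS.
  by case E: (bump_part c h) => [h'|] //=; apply: f1; rewrite ?i0 ?(bump_size _ _ E) ?hg //= ltnW.
rewrite upE /=; case: (k =P c) => [->|/eqP kc].
  by rewrite ltnn leqnn ltnSn add0r.
have -> : (match omap (cons k) (bump_part c g) with Some g0 => f g0 | None => 0 end)%R = 0%R.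
  by case E: (bump_part c g) => [h'|] //=; apply: f1; rewrite ?k0 ?ltnSn ?(bump_size _ _ E).
by rewrite if_same addr0 ltnS [k <= c]leq_eqVlt (negPf kc).
Qed.

Fixpoint lex_lt (a b : seq nat) : bool :=
  match a, b with
  | x :: a', y :: b' => (x < y) || ((x == y) && lex_lt a' b')
  | _, _ => false
  end.

(* The order with respect to which the Kostka matrix is unitriangular. *)
Definition lower (a b : seq nat) : bool :=
  (size a < size b) || ((size a == size b) && lex_lt a b).

Lemma lex_lt_trans : transitive lex_lt.
Proof.
move=> b a c; elim: a b c => [|x a IHa] [|y b] [|z c] //=.
case/orP=> [xy|/andP[/eqP xy ab]] /orP[yz|/andP[/eqP yz bc]].
- by rewrite (ltn_trans xy yz).
- by rewrite -yz xy.
- by rewrite xy yz.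
- by rewrite xy yz eqxx (IHa b c) ?orbT.
Qed.

Lemma lower_trans : transitive lower.
Proof.
move=> b a c; rewrite /lower.
case/orP=> [ab|/andP[/eqP sab ab]] /orP[bc|/andP[/eqP sbc bc]].
- by rewrite (ltn_trans ab bc).
- by rewrite -sbc ab.
- by rewrite sab bc.
- by rewrite sab sbc eqxx (lex_lt_trans ab bc) orbT.
Qed.

Lemma lower_irr : irreflexive lower.
Proof. by move=> a; rewrite /lower ltnn eqxx /=; elim: a => //= x a ->; rewrite ltnn andbF. Qed.

Lemma lower_cons k a b : lower a b -> lower (k :: a) (k :: b).
Proof. by rewrite /lower /= ltnS eqSS ltnn eqxx. Qed.

Lemma lower_head i k a b : i < k -> size a <= size b -> lower (i :: a) (k :: b).
Proof. by rewrite /lower /= ltnS eqSS => -> /=; rewrite andbT leq_eqVlt orbC. Qed.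

(** The parts of [b] are built from the last to the first, each as a complete new first row; every
    other way of placing the boxes ends at a lower composition. *)
Lemma add_strips_top N b g (f : fct) : 0 \notin b -> sumn b <= N ->
  (forall h, lower h (b ++ g) -> f h = 0%R) ->
  add_strips N b f g = f (b ++ g).
Proof.
elim: b f => //= k b IHb f; rewrite inE negb_or eq_sym -lt0n => /andP[k0 b0] bN low.
have kN : k <= N := leq_trans (leq_addr _ _) bN.
have top h : (size h <= size (b ++ g)) -> add_strip N k.+1 f h = f (k :: h).
  move=> hs; rewrite add_strip_top ?kN // => [h' h'h|i h' /andP[i0 ik] h'h]; apply: low.
    by rewrite /lower /= h'h ltnS hs.
  by apply: lower_head => //; rewrite h'h.
rewrite IHb //; first by rewrite top.
- exact: leq_trans (leq_addl _ _) bN.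
move=> h hb; rewrite top; first by apply: low; exact: lower_cons.
by case/orP: hb => [/ltnW|/andP[/eqP ->]].
Qed.

Lemma weight_from_lt x b : all (gtn (x + size b)) (weight_from x b).
Proof.
elim: b x => //= k b IHb x; rewrite all_cat all_nseq -addSnnS IHb andbT.
by rewrite /= ltn_addr ?ltnSn ?orbT.
Qed.

Definition mono_mset (b : seq nat) : {mset nat}%mset := seq_mset (weight_from 1 b).

Lemma mono_msetE b : [seq mono_mset b v | v <- iota 1 (size b)] = b.
Proof.
rewrite /mono_mset; elim: b 1 => //= k b IHb x.
rewrite mset_seqE /= count_cat count_nseq /= eqxx mul1n.
have cx c y : x < y -> count_mem x (weight_from y c) = 0.
  move=> xy; apply/count_memPn; apply/negP => /(allP (weight_from_ge y c)) /=.
  by rewrite leqNgt xy.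
rewrite cx // addn0; congr cons; rewrite -[RHS](IHb x.+1); apply/eq_in_map => v.
rewrite mem_iota => /andP[xv _]; rewrite !mset_seqE count_cat count_nseq /=.
by rewrite ltn_eqF.
Qed.

(** The coefficient of the monomial with exponents [b] is [e b] plus contributions of compositions
    lower than [b], which vanish by induction on the number of these. *)
Lemma qschur_independent n (e : composition n -> rat) :
  (forall m, \sum_(b : composition n) e b * qschur b m = 0)%R -> forall b, e b = 0%R.
Proof.
move=> e0 b; pose f g : rat := (\sum_(b : composition n) e b * indicator b g)%R.
have fE c : f (parts c) = e c.
  rewrite /f (bigD1 c) //= /indicator eqxx mulr1 big1 ?addr0 // => d.
  by rewrite -val_eqE /= eq_sym => /negPf ->; rewrite mulr0.
have fN g : ~~ is_composition n g -> f g = 0%R.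
  move=> gN; rewrite /f big1 // => c _; rewrite /indicator.
  by case: eqP => [E|]; rewrite ?mulr0 //; case/negP: gN; rewrite E partsP.
have vanish (c : composition n) : add_strips n c f [::] = 0%R.
  have /andP[/eqP cn c0] := partsP c.
  rewrite -[RHS](e0 (mono_mset c)).
  have -> : f = (\sum_(b : composition n) e b *: indicator b)%R :> fct.
    by apply/funext => g; rewrite fct_sumE.
  rewrite linear_sum fct_sumE; apply: eq_bigr => d _; rewrite linearZ /= fctE.
  rewrite (qschur_vars (N := n) d (vs := iota 1 (size c))) ?mono_msetE //.
  - exact: iota_ltn_sorted.
  - move=> v; rewrite mem_finsupp mset_seqE => vc; rewrite mem_iota.
    have : v \in weight_from 1 c by rewrite -has_pred1 has_count lt0n.
    move=> vw; have := allP (weight_from_ge 1 c) v vw; rewrite /= => ->.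
    exact: (allP (weight_from_lt 1 c) v vw).
  - by rewrite (perm_size (perm_eq_seq_mset _)) size_weight_from cn.
have [k] := ubnP #|[set c : composition n | lower c b]|.
elim: k b => // k IHk b bk; rewrite -fE -[RHS](vanish b).
have /andP[/eqP bn b0] := partsP b.
rewrite add_strips_top ?cats0 ?bn // => h hb.
have [hP|/fN //] := boolP (is_composition n h).
rewrite -[h]/(parts (Composition hP)) fE IHk //.
rewrite ltnS in bk; apply: leq_trans bk; apply: proper_card; apply/properP; split.
  by apply/subsetP => c; rewrite !inE => ch; exact: lower_trans ch hb.
by exists (Composition hP); rewrite !inE ?hb // lower_irr.
Qed.

(** * Coefficients of the lifted functions *)

Section SetCompositions.

Variable m : nat.
Implicit Type th : seq {set 'I_m}.

Lemma mem_bigcup_seq th x :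
  (x \in \bigcup_(B <- th) B) = has (fun B : {set 'I_m} => x \in B) th.
Proof. by elim: th => [|B th IH]; rewrite ?big_nil ?inE // big_cons inE IH. Qed.

Lemma block_lt th x : is_set_composition th -> block th x < size th.
Proof.
by case/and3P=> _ _ /eqP H; rewrite /block -has_find -mem_bigcup_seq H inE.
Qed.

Lemma mem_block th x i : is_set_composition th -> i < size th ->
  (x \in nth set0 th i) = (block th x == i).
Proof.
move=> thc ith; have xlt := block_lt x thc.
have xb : x \in nth set0 th (block th x).
  by apply: (@nth_find _ set0 (fun B : {set 'I_m} => x \in B)); rewrite has_find.
apply/idP/eqP => [xi|<- //]; case/and3P: thc => _ /(pairwiseP set0) dis _.
have sep j j' : j < size th -> j' < size th -> j < j' ->
    x \in nth set0 th j -> x \in nth set0 th j' -> False.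
  move=> js js' jj' xj xj'; have := dis j j' js js' jj'.
  by move/pred0P/(_ x); rewrite /= xj xj'.
by case: (ltngtP (block th x) i) => // lt; [case: (sep _ _ xlt ith lt) | case: (sep _ _ ith xlt lt)].
Qed.

Definition values (w : seq nat) : seq nat := sort leq (finsupp (seq_mset w)).

Lemma values_sorted w : sorted ltn (values w).
Proof.
rewrite ltn_sorted_uniq_leq sort_uniq fset_uniq; exact: sort_sorted leq_total _.
Qed.

Lemma mem_values w v : (v \in values w) = (v \in w).
Proof. by rewrite mem_sort mem_finsupp mset_seqE -lt0n -has_count has_pred1. Qed.

Lemma exps_values w : exps (seq_mset w) = [seq count_mem v w | v <- values w].
Proof. by apply: eq_map => v; rewrite mset_seqE. Qed.

Definition level_sets (w : seq nat) : seq {set 'I_m} :=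
  [seq [set x : 'I_m | nth 0 w x == v] | v <- values w].

Lemma card_level_sets w : size w = m ->
  [seq #|B| | B : {set 'I_m} <- level_sets w] = exps (seq_mset w).
Proof.
move=> wm; rewrite exps_values -map_comp; apply: eq_map => v /=.
by rewrite -sum1_count (big_nth 0) big_mkord wm sum1dep_card.
Qed.

Lemma find_level_sets w vs (x : 'I_m) :
  find (fun B : {set 'I_m} => x \in B) [seq [set x : 'I_m | nth 0 w x == v] | v <- vs] =
  index (nth 0 w x) vs.
Proof. by elim: vs => //= v vs ->; rewrite inE eq_sym. Qed.

Lemma level_sets_composition w : size w = m -> is_set_composition (level_sets w).
Proof.
move=> wm; have xw (x : 'I_m) : nth 0 w x \in w by rewrite mem_nth ?wm.
apply/and3P; split.
- apply/mapP => -[v]; rewrite mem_values => /(nthP 0)[i iw <-] /setP.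
  rewrite wm in iw; move/(_ (Ordinal iw)); rewrite !inE eqxx //.
- rewrite pairwise_map; apply/(pairwiseP 0) => i j il jl ij.
  apply/pred0P => x; rewrite /= !inE; apply/negP => /andP[/eqP -> /eqP E].
  move: ij; rewrite ltn_neqAle -(nth_uniq 0 il jl) ?E ?eqxx //.
  exact: (sorted_uniq ltn_trans ltnn (values_sorted w)).
- apply/eqP/setP => x; rewrite mem_bigcup_seq inE; apply/hasP.
  exists [set y : 'I_m | nth 0 w y == nth 0 w x]; last by rewrite inE.
  by apply: map_f; rewrite mem_values.
Qed.

Lemma level_sets_pattern w : size w = m -> has_pattern (level_sets w) w.
Proof.
move=> wm; rewrite /has_pattern wm eqxx /=; apply/forallP => x; apply/forallP => y.
have xv (z : 'I_m) : nth 0 w z \in values w by rewrite mem_values mem_nth ?wm.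
rewrite /block !find_level_sets; apply/andP; split.
  apply/eqP; apply/eqP/eqP => [->//|E].
  by rewrite -(nth_index 0 (xv x)) E nth_index.
apply/implyP => lt; rewrite -(nth_index 0 (xv x)) -(nth_index 0 (xv y)).
have := sorted_ltn_nth ltn_trans 0 (values_sorted w).
by apply; rewrite // inE index_mem xv.
Qed.

(** The letters found on successive blocks increase strictly and exhaust those of [w], so their list
    [V] must be [values w]. Each word thus belongs to exactly one monomial function. *)
Lemma has_pattern_level_sets th w :
  is_set_composition th -> has_pattern th w -> th = level_sets w.
Proof.
move=> thc /andP[/eqP wm /forallP pat].
have patE (x y : 'I_m) : (nth 0 w x == nth 0 w y) = (block th x == block th y).
  by have /forallP/(_ y)/andP[/eqP] := pat x.
have patL (x y : 'I_m) : block th x < block th y -> nth 0 w x < nth 0 w y.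
  by have /forallP/(_ y)/andP[_ /implyP] := pat x.
have ex i : i < size th -> exists x : 'I_m, block th x == i.
  move=> ith; have /and3P[ne _ _] := thc.
  have : nth set0 th i != set0 by apply: contraNneq ne => <-; apply: mem_nth.
  by case/set0Pn => x; rewrite mem_block // => xi; exists x.
pose V := [seq (if [pick x : 'I_m | block th x == i] is Some x then nth 0 w x else 0)
          | i <- iota 0 (size th)].
have VE i x : block th x = i -> nth 0 V i = nth 0 w x.
  move=> xi; have ith : i < size th by rewrite -xi block_lt.
  rewrite (nth_map 0) ?size_iota // nth_iota // add0n; case: pickP => [y /eqP yi|/(_ x)].
    by apply/eqP; rewrite patE xi yi.
  by rewrite xi eqxx.
have sV : size V = size th by rewrite size_map size_iota.
have VV : V = values w.
  apply: (irr_sorted_eq ltn_trans ltnn) (values_sorted w) _.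
    apply/(sortedP 0) => i; rewrite sV => iV.
    have [x /eqP xi] := ex i (ltnW iV); have [y /eqP yi] := ex i.+1 iV.
    by rewrite (VE _ _ xi) (VE _ _ yi); apply: patL; rewrite xi yi.
  move=> v; rewrite mem_values; apply/(nthP 0)/(nthP 0) => -[i].
    rewrite sV => ith; have [x /eqP xi] := ex i ith; rewrite (VE _ _ xi) => <-.
    by exists x; rewrite ?wm.
  rewrite wm => im <-; exists (block th (Ordinal im)); first by rewrite sV block_lt.
  exact: (VE _ (Ordinal im) erefl).
apply: (eq_from_nth (x0 := set0)) => [|i ith].
  by rewrite size_map -VV sV.
apply/setP => x; rewrite mem_block // (nth_map 0) -?VV ?sV // inE.
have [y /eqP yi] := ex i ith.
by rewrite (VE _ _ yi) patE yi.
Qed.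

Lemma sum_patterns (b w : seq nat) : size w = m ->
  (\sum_(th : (size b).-tuple {set 'I_m} |
      is_set_composition th && ([seq #|B| | B : {set _} <- th] == b)) nc_mono th w =
  (exps (seq_mset w) == b)%:R)%R.
Proof.
move=> wm; case: eqP => [E|bN]; last first.
  rewrite big1 // => th /andP[thc /eqP thb]; rewrite /nc_mono.
  case: (boolP (has_pattern th w)) => // /(has_pattern_level_sets thc) E.
  by case: bN; rewrite -thb E card_level_sets.
have st : size (level_sets w) == size b.
  by rewrite size_map -E size_map.
rewrite (bigD1 (Tuple st)) /=; last first.
  by rewrite level_sets_composition // card_level_sets // E eqxx.
rewrite /nc_mono level_sets_pattern // big1 ?addr0 // => th /andP[/andP[thc _] thN].
case: (boolP (has_pattern th w)) => // /(has_pattern_level_sets thc) E'.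
by case/eqP: thN; apply: val_inj.
Qed.

Lemma lifted_qschurE (a : composition m) (w : seq nat) :
  (lifted_qschur a w = (if size w == m then
     (composition_fact (exps (seq_mset w)))%:R * qschur a (seq_mset w) else 0))%R.
Proof.
rewrite /lifted_qschur; case: eqP => [wm|wm]; last first.
  rewrite big1 // => b _; rewrite big1 ?mulr0 // => th _.
  by rewrite /nc_mono /has_pattern; case: eqP => // wm'; case: wm.
under eq_bigr do rewrite sum_patterns //.
rewrite /qschur mulr_sumr; apply: eq_bigr => b _.
rewrite /mono_qsym -/(exps _) natrM; case: eqP => [->|_]; rewrite ?mulr1 ?mulr0 //.
Qed.

End SetCompositions.

(** * The star product *)

Section StarReps.

Variables (r n : nat).
Implicit Types (k : nat) (x d h : 'S_n).

Definition fixing k : {set 'S_n} := [set x : 'S_n | [forall p : 'I_n, (k <= p) ==> (x p == p)]].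

Lemma fixingP k x : reflect (forall p : 'I_n, k <= p -> x p = p) (x \in fixing k).
Proof.
rewrite inE; apply: (iffP forallP) => H p; last by apply/implyP => /H ->.
by move=> kp; have /implyP/(_ kp)/eqP := H p.
Qed.

Definition swap_in (k : 'I_n) (A : {set 'S_n}) : {set 'S_n} :=
  [set (p.1 * tperm p.2 k)%g | p in setX A [set i : 'I_n | i <= k]].

Lemma sum_swap_in (k : 'I_n) (A : {set 'S_n}) (phi : 'S_n -> rat) :
  A \subset fixing k ->
  (\sum_(x in swap_in k A) phi x =
  \sum_(d in A) \sum_(i : 'I_n | (i <= k)%N) phi (d * tperm i k)%g)%R.
Proof.
move=> Ak; rewrite big_imset /=; last first.
  move=> [d i] [d' i']; rewrite !inE /= => /andP[dA _] /andP[dA' _] E.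
  have fix_k x : x \in A -> x k = k by move/(subsetP Ak)/fixingP; apply.
  have := congr1 (fun x : 'S_n => x k) E; rewrite /= !permM (fix_k d dA) (fix_k d' dA') !tpermR => ii.
  by move: E; rewrite ii => /mulIg ->.
rewrite pair_big_dep /=; apply: eq_bigl => -[d i] /=; by rewrite !inE.
Qed.

Lemma fixingS (k : 'I_n) : fixing k.+1 = swap_in k (fixing k).
Proof.
apply/setP => x; apply/idP/imsetP => [/fixingP xk|[[d i]]].
  have xk' : x k <= k.
    rewrite leqNgt; apply/negP => lt; have /perm_inj E := xk _ lt.
    by move: lt; rewrite E ltnn.
  exists ((x * tperm (x k) k)%g, x k); last by rewrite /= -mulgA tperm2 mulg1.
  rewrite !inE /= xk' andbT; apply/forallP => p; apply/implyP; rewrite leq_eqVlt permM.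
  case/predU1P => [/val_inj <-|kp]; first by rewrite tpermL.
  by rewrite (xk p kp) tpermD // -val_eqE /= neq_ltn ?kp // (leq_ltn_trans xk' kp).
rewrite in_setX inE /= => /andP[/fixingP dk ik] ->; apply/fixingP => p kp.
by rewrite permM dk ?(ltnW kp) // tpermD // -val_eqE /= neq_ltn ?kp // (leq_ltn_trans ik kp).
Qed.

Definition swaps (f : {ffun 'I_n -> 'I_n}) (p : nat) : 'S_n :=
  if insub p is Some o then tperm (f o) o else 1%g.

Definition reps k : {set 'S_n} :=
  [set (\prod_(n - r <= p < k) swaps f p)%g | f : {ffun 'I_n -> 'I_n} & [forall p, f p <= p]].

Lemma star_repsE : star_reps r n = reps n.
Proof.
apply: eq_imset => f; rewrite big_geq_mkord; apply: eq_bigr => p _.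
by rewrite /swaps valK.
Qed.

Lemma repsS (k : 'I_n) : n - r <= k -> reps k.+1 = swap_in k (reps k).
Proof.
move=> rk; apply/setP => x; apply/imsetP/imsetP => [[f]|[[d i]]].
  rewrite inE => fP ->; exists ((\prod_(n - r <= p < k) swaps f p)%g, f k).
    rewrite !inE /= (forallP fP k) andbT; apply/imsetP; exists f; rewrite ?inE //.
  by rewrite big_nat_recr //= /swaps valK.
rewrite !inE /= => /andP[/imsetP [f]]; rewrite inE => /forallP fP -> ik ->.
exists [ffun p => if p == k then i else f p].
  by rewrite inE; apply/forallP => p; rewrite ffunE; case: eqP => [->|_].
rewrite big_nat_recr //= [X in _ = (_ * X)%g]/swaps valK ffunE eqxx; congr (_ * _)%g.
rewrite big_nat [RHS]big_nat; apply: eq_bigr => p /andP[_ pk]; rewrite /swaps.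
by case: insubP => // o _ Eo; rewrite ffunE -val_eqE /= Eo ltn_eqF.
Qed.

Lemma reps_fixing k : n - r <= k -> k <= n -> reps k \subset fixing k.
Proof.
elim: k => [|k IHk] rk kn.
  apply/subsetP => x /imsetP [f _ ->]; rewrite big_geq //; apply/fixingP => p _.
  by rewrite perm1.
move: rk; rewrite leq_eqVlt => /predU1P[rk|rk].
  apply/subsetP => x /imsetP [f _ ->]; rewrite big_geq ?rk //; apply/fixingP => p _.
  by rewrite perm1.
rewrite -[k]/(val (Ordinal kn)) repsS // fixingS; apply: imsetS; apply: setXS => //.
exact: (IHk rk (ltnW kn)).
Qed.

(** Peeling off the last transposition leaves the function of [d] obtained by summing phi(d (i k'))
    over i <= k'. It has the same invariance: conjugation by an [h] that fixes all positions from n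
    - r on permutes these transpositions among themselves. *)
Lemma sum_reps (phi : 'S_n -> rat) k : n - r <= k -> k <= n ->
  (forall x h, h \in fixing (n - r) -> phi (x * h)%g = phi x) ->
  (\sum_(x in fixing k) phi x = #|fixing (n - r)|%:R * \sum_(x in reps k) phi x)%R.
Proof.
move=> rk; rewrite -(subnKC rk); elim: (k - (n - r)) phi => [|j IHj] phi kn inv.
  rewrite addn0; have -> : reps (n - r) = [set 1%g].
    apply/setP => x; rewrite inE; apply/imsetP/eqP => [[f _ ->]|->].
      by rewrite big_geq.
    exists [ffun p => p]; last by rewrite big_geq.
    by rewrite inE; apply/forallP => p; rewrite ffunE.
  rewrite big_set1 mulr_natl -sumr_const; apply: eq_bigr => x xh.
  by rewrite -[x]mul1g inv.
move: kn; rewrite addnS => kn; set k' := Ordinal kn.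
have rk' : n - r <= k' := leq_addr _ _.
rewrite -[(n - r + j)]/(val k') fixingS repsS // !sum_swap_in //; last first.
  exact: reps_fixing rk' (ltnW kn).
apply: IHj (ltnW kn) _ => x h hH.
have hk : h k' = k' by move/fixingP: hH; apply.
have hle (i : 'I_n) : (h i <= k') = (i <= k').
  case: (leqP (n - r) i) => ri; first by move/fixingP: hH => ->.
  rewrite [RHS](leq_trans (ltnW ri) rk'); apply: leq_trans rk'; rewrite leqNgt.
  apply/negP => lt; have /fixingP/(_ _ (ltnW lt)) /perm_inj E := hH.
  by move: lt; rewrite E ltnNge (ltnW ri).
rewrite (reindex_inj (@perm_inj _ h)) /=; apply: eq_big => [i|i _]; first exact: hle.
rewrite -[RHS](inv _ h hH); congr phi; rewrite -!mulgA; congr (_ * _)%g.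
have -> : tperm (h i) k' = (tperm i k' ^ h)%g by rewrite tpermJ hk.
by rewrite conjgE !mulgA mulgV mul1g.
Qed.

Lemma card_fixing k : k <= n -> #|fixing k| = k`!.
Proof.
move=> kn; have -> : fixing k = Sym [set p : 'I_n | p < k].
  apply/setP => x; rewrite !inE; apply/forallP/subsetP => [H p|H p].
    rewrite !inE; apply: contraNT; rewrite -leqNgt => kp.
    by have /implyP/(_ kp) := H p.
  apply/implyP => kp; apply: contraTT kp => xp; rewrite -ltnNge.
  by have := H p; rewrite !inE; apply.
rewrite card_Sym; congr factorial; rewrite -sum1dep_card -(big_mkord (fun i => i < k) (fun=> 1)).
rewrite -(big_nat_widen 0 k n xpredT (fun=> 1) kn) sum_nat_const_nat subn0.
exact: muln1.
Qed.

Lemma sum_star_reps (phi : 'S_n -> rat) :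
  (forall x h, h \in fixing (n - r) -> phi (x * h)%g = phi x) ->
  (\sum_x phi x = (n - r)`!%:R * \sum_(x in star_reps r n) phi x)%R.
Proof.
move=> inv; rewrite star_repsE -(card_fixing (leq_subr r n)).
rewrite -(sum_reps (leq_subr r n) (leqnn n) inv); apply: eq_bigl => x.
by apply/esym/fixingP => p; rewrite leqNgt ltn_ord.
Qed.

End StarReps.

(** * Rearrangements of a word *)

Lemma perm_permutations_rem (s : seq nat) : s != [::] ->
  perm_eq (permutations s)
    [seq x :: t | x <- undup s, t <- permutations (rem x s)].
Proof.
move=> s0; apply: uniq_perm; first exact: permutations_uniq.
  apply: allpairs_uniq_dep; first exact: undup_uniq.
    by move=> x _; exact: permutations_uniq.
  by move=> [x t] [y u] _ _ /= [-> ->].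
move=> t; rewrite mem_permutations; apply/idP/allpairsPdep => [ts|[x [u [xs us ->]]]].
  case: t ts => [|x t] ts; first by move/perm_size/esym/size0nil: ts s0 => ->.
  have xs : x \in s by rewrite -(perm_mem ts) inE eqxx.
  exists x, t; rewrite mem_undup mem_permutations; split=> //.
  by rewrite -(perm_cons x) (perm_trans ts) // perm_to_rem.
rewrite mem_undup in xs; rewrite mem_permutations in us.
by rewrite perm_sym (perm_trans (perm_to_rem xs)) // perm_cons perm_sym.
Qed.

(** The multinomial formula. The list [U] may contain absent letters, so it stays the same while
    letters of [s] are removed in the induction. *)
Lemma size_permutations_mult (s U : seq nat) : uniq U -> {subset s <= U} ->
  size (permutations s) * \prod_(v <- U) (count_mem v s)`! = (size s)`!.
Proof.
move=> uU; have [m] := ubnP (size s); elim: m s => // m IHm s sm sU.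
have [s0|s0] := eqVneq s [::]; first by rewrite s0 /= big1.
rewrite (perm_size (perm_permutations_rem s0)) size_allpairs_dep sumnE big_map big_distrl /=.
transitivity (\sum_(x <- undup s) count_mem x s * (size s).-1`!).
  rewrite [LHS]big_seq [RHS]big_seq; apply: eq_bigr => x; rewrite mem_undup => xs.
  have xU := sU x xs; have sr : size (rem x s) = (size s).-1 by rewrite size_rem.
  rewrite -sr -(IHm (rem x s)); first last.
  - by move=> y /mem_rem /sU.
  - by rewrite sr; case: (s) s0 sm => //= y s' _; rewrite ltnS.
  rewrite mulnCA; congr (_ * _); rewrite (bigD1_seq x) //= [in RHS](bigD1_seq x) //=.
  rewrite count_rem xs /= eqxx subn1 mulnA; congr (_ * _).
    have : 0 < count_mem x s by rewrite -has_count has_pred1.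
    by case: (count_mem x s) => // c _; rewrite factS.
  by apply: eq_bigr => v vx; rewrite count_rem xs /= (eq_sym x) (negPf vx) subn0.
rewrite -big_distrl /=; have -> : \sum_(x <- undup s) count_mem x s = size s.
  rewrite -(perm_size (perm_count_undup s)) size_flatten sumnE /shape -map_comp big_map.
  by apply: eq_bigr => x _ /=; rewrite size_nseq.
by case: (s) s0 => //= x s' _; rewrite factS.
Qed.

Lemma composition_fact_exps (w : seq nat) :
  size (permutations w) * composition_fact (exps (seq_mset w)) = (size w)`!.
Proof.
rewrite -(@size_permutations_mult w (values w)).
- by rewrite /composition_fact exps_values big_map.
- exact: (sorted_uniq ltn_trans ltnn (values_sorted w)).
- by move=> v; rewrite mem_values.
Qed.

Section Star.

Variable n : nat.
Implicit Types (x y d : 'S_n) (w v : seq nat).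

Lemma size_act_word d w : size (act_word d w) = n.
Proof. by rewrite size_map size_enum_ord. Qed.

Lemma nth_act_word d w (k : 'I_n) : nth 0 (act_word d w) k = nth 0 w (d^-1%g k).
Proof. by rewrite (nth_map k) ?size_enum_ord // nth_ord_enum. Qed.

Lemma act_wordM x y w : act_word (x * y)%g w = act_word y (act_word x w).
Proof.
apply: (eq_from_nth (x0 := 0)) => [|i]; rewrite size_act_word ?size_act_word // => iN.
by rewrite -[i]/(val (Ordinal iN)) !nth_act_word invMg permM.
Qed.

Lemma act_word1 w : size w = n -> act_word (1 : 'S_n)%g w = w.
Proof.
move=> wn; apply: (eq_from_nth (x0 := 0)) => [|i]; rewrite size_act_word ?wn // => iN.
by rewrite -[i]/(val (Ordinal iN)) nth_act_word invg1 perm1.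
Qed.

Lemma perm_act_word d w : size w = n -> perm_eq (act_word d w) w.
Proof.
move=> wn; rewrite -[X in perm_eq _ X](act_word1 wn).
have -> : act_word d w = [seq nth 0 w (val i) | i <- [seq d^-1%g k | k <- enum 'I_n]].
  by rewrite -map_comp.
have -> : act_word (1 : 'S_n)%g w = [seq nth 0 w (val i) | i <- enum 'I_n].
  by rewrite /act_word; apply: eq_map => i; rewrite invg1 perm1.
apply: perm_map; apply: uniq_perm.
- by rewrite map_inj_uniq ?enum_uniq //; exact: perm_inj.
- exact: enum_uniq.
move=> i; rewrite mem_enum; apply/mapP; exists (d i); rewrite ?mem_enum ?permK //.
Qed.

Lemma act_word_transitive v w : size w = n -> perm_eq v w -> exists x, act_word x w = v.
Proof.
move=> wn vw; have wn' : size w == n by rewrite wn.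
have /tuple_permP[p vE] : perm_eq v (Tuple wn') by [].
exists p^-1%g; apply: (eq_from_nth (x0 := 0)) => [|i].
  by rewrite size_act_word (perm_size vw) wn.
rewrite size_act_word => iN; rewrite -[i]/(val (Ordinal iN)) nth_act_word invgK.
by rewrite vE -tnth_nth tnth_mktuple (tnth_nth 0).
Qed.

Lemma act_word_inj y v w : size v = n -> size w = n -> 
  (act_word y v == act_word y w) = (v == w).
Proof.
move=> vn wn; apply/eqP/eqP => [E|->//].
by rewrite -(act_word1 vn) -(act_word1 wn) -(mulgV y) !act_wordM E.
Qed.

(** By transitivity all rearrangements are reached by the same number of permutations. The constant
    function 1 determines this number from the multinomial formula. *)
Lemma sum_act_word (psi : seq nat -> rat) w : size w = n ->
  (\sum_(x : 'S_n) psi (act_word x w) =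
   (composition_fact (exps (seq_mset w)))%:R * \sum_(v <- permutations w) psi v)%R.
Proof.
move=> wn; pose c v : nat := \sum_(x : 'S_n) (act_word x w == v).
have cE v : v \in permutations w -> c v = c w.
  rewrite mem_permutations => /(act_word_transitive wn)[y <-].
  rewrite /c (reindex_inj (mulIg y)) /=; apply: eq_bigr => x _.
  by rewrite act_wordM act_word_inj ?size_act_word.
have sumE f : (\sum_(x : 'S_n) f (act_word x w) = (c w)%:R * \sum_(v <- permutations w) f v :> rat)%R.
  transitivity (\sum_(v <- permutations w) \sum_(x : 'S_n) (act_word x w == v)%:R * f v)%R.
    rewrite exchange_big /=; apply: eq_bigr => x _.
    rewrite (bigD1_seq (act_word x w)) ?permutations_uniq //=; last first.
      by rewrite mem_permutations perm_act_word.
    by rewrite eqxx mul1r big1 ?addr0 // => v vx; rewrite eq_sym (negPf vx) mul0r.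
  rewrite mulr_sumr [LHS]big_seq [RHS]big_seq; apply: eq_bigr => v /cE <-.
  by rewrite -mulr_suml natr_sum.
rewrite sumE; congr (_%:R * _)%R.
have := sumE (fun=> 1%R); rewrite sumr_const big_const_seq count_predT iter_addr_0.
have -> : #|'S_n| = n`! by rewrite -card_Sn; apply: eq_card => x; rewrite inE.
rewrite -natrM => /eqP; rewrite eqr_nat -wn -composition_fact_exps mulnC.
rewrite eqn_pmul2r => [/eqP //|]; case: (permutations w) (mem_permutations w w) => //.
by rewrite perm_refl.
Qed.

End Star.

Section Split.
Local Open Scope mset_scope.

Lemma sum_permutations_split k (w : seq nat) (F : seq nat -> seq nat -> rat) : (k <= size w)%N ->
  (\sum_(v <- permutations w) F (take k v) (drop k v) =
  \sum_(u <- submsets (seq_mset w) | size (enum_mset u) == k)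
    \sum_(x <- permutations u) \sum_(y <- permutations (seq_mset w `\` u)) F x y)%R.
Proof.
move=> kw; set m := seq_mset w.
pose pairs (u : {mset nat}) := [seq (x, y) | x <- permutations u, y <- permutations (m `\` u)].
have mem_perm (u : {mset nat}) (x : seq nat) : (x \in permutations u) = (seq_mset x == u).
  rewrite mem_permutations -[in RHS](seq_mset_id u).
  by apply/idP/eqP => /eq_seq_msetP.
have diffE (x y : seq nat) : (seq_mset y == m `\` seq_mset x) && (seq_mset x \in submsets m) =
    perm_eq (x ++ y) w.
  apply/andP/idP => [[/eqP E /submsetsP xm]|xyw].
    apply/allP => v _ /=; apply/eqP; rewrite count_cat -(mset_seqE y) E msetE2 !mset_seqE.
    by have := xm v; rewrite !mset_seqE => /subnKC ->.
  have cE v : count_mem v x + count_mem v y = count_mem v w by rewrite -count_cat (seq.permP xyw).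
  split; last by apply/submsetsP => v; rewrite !mset_seqE -cE leq_addr.
  by apply/eqP/msetP => v; rewrite msetE2 !mset_seqE -cE addKn.
have mem_pairs u p : (p \in pairs u) = (seq_mset p.1 == u) && (seq_mset p.2 == m `\` u).
  rewrite -!mem_perm; apply/allpairsP/andP => [[q [qu qm ->]] //|[pu pm]].
  by exists p; split=> //; case: (p).
pose us := [seq u : {mset nat} <- submsets m | size u == k].
have LE : perm_eq [seq (take k v, drop k v) | v <- permutations w] [seq p | u <- us, p <- pairs u].
  apply: uniq_perm.
  - rewrite map_inj_uniq ?permutations_uniq // => v v' [E1 E2].
    by rewrite -(cat_take_drop k v) E1 E2 cat_take_drop.
  - apply: allpairs_uniq_dep; first by rewrite filter_uniq ?undup_uniq.
      move=> u _; apply: allpairs_uniq; rewrite ?permutations_uniq //.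
      by move=> [x y] [x' y'].
    move=> [u p] [u' p'] /allpairsPdep[u1 [p1 [_ pu [-> ->]]]] /allpairsPdep[u2 [p2 [_ pu' [-> ->]]]] /= pp.
    by move: pu pu'; rewrite -pp !mem_pairs => /andP[/eqP <- _] /andP[/eqP <- _].
  - move=> [x y]; apply/mapP/allpairsPdep => [[v]|[u [p []]]].
      rewrite mem_permutations => vw [-> ->].
      have sv : size v = size w by rewrite (perm_size vw).
      have := diffE (take k v) (drop k v); rewrite cat_take_drop vw => /andP[E1 E2].
      exists (seq_mset (take k v)), (take k v, drop k v); split=> //.
        rewrite mem_filter E2 (perm_size (perm_eq_seq_mset _)) size_takel ?sv //.
        by rewrite eqxx.
      by rewrite mem_pairs eqxx.
    rewrite mem_filter mem_pairs => /andP[/eqP uk um] /andP[/eqP pu E] ->.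
    exists (p.1 ++ p.2).
      by rewrite mem_permutations -diffE pu E um.
    have sp : size p.1 = k by rewrite -uk -pu (perm_size (perm_eq_seq_mset _)).
    by rewrite take_size_cat ?drop_size_cat //; case: (p).
transitivity (\sum_(p <- [seq (take k v, drop k v) | v <- permutations w]) F p.1 p.2)%R.
  by rewrite big_map.
rewrite (perm_big _ LE) /= big_allpairs_dep big_filter; apply: eq_bigr => u _.
by rewrite big_allpairs.
Qed.
End Split.

Lemma qschur_homogeneous k (a : composition k) (m : {mset nat}%mset) :
  size m <> k -> qschur a m = 0%R.
Proof.
move=> mk; have sa : sumn a = k by have /andP[/eqP] := partsP a.
rewrite qschurE /kostka_ssct num_tableaux_size ?weight_wordE ?size_weight_from ?sumn_exps ?sa //.
exact/eqP.
Qed.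

Lemma sum_nc_schur lam (m : {mset nat}%mset) :
  (\sum_(y <- permutations m) nc_schur lam y = schur lam m)%R.
Proof.
rewrite /nc_schur /schur /num_tableaux -sum1_count natr_sum [RHS]big_mkcond /=.
by apply: eq_bigr => y _; case: reads.
Qed.

(** The factorials in the lifted function complement the number of rearrangements of the first [k]
    letters: their product is k!, whatever the multiset of these letters. *)
Lemma sum_permutations_lifted k (a : composition k) lam w : k <= size w ->
  (\sum_(v <- permutations w) lifted_qschur a (take k v) * nc_schur lam (drop k v) =
   k`!%:R * com_mul (qschur a) (schur lam) (seq_mset w))%R.
Proof.
move=> kw; rewrite (@sum_permutations_split k w (fun x y => lifted_qschur a x * nc_schur lam y)%R kw).
rewrite /com_mul mulr_sumr big_mkcond; apply: eq_bigr => u _; case: eqP => uk; last first.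
  by rewrite qschur_homogeneous // mul0r mulr0.
under eq_bigr do rewrite -mulr_sumr sum_nc_schur.
rewrite -mulr_suml mulrA; congr (_ * _)%R.
transitivity (\sum_(x <- permutations u) (composition_fact (exps u))%:R * qschur a u)%R.
  rewrite [LHS]big_seq [RHS]big_seq; apply: eq_bigr => x; rewrite mem_permutations => xu.
  have -> : u = seq_mset x by rewrite -[LHS]seq_mset_id; apply/esym/eq_seq_msetP.
  by rewrite lifted_qschurE (perm_size xu) uk eqxx.
rewrite big_const_seq count_predT iter_addr_0 -mulrnAl -mulrnA mulnC.
by have := composition_fact_exps u; rewrite seq_mset_id uk => ->.
Qed.

Lemma nc_mul_lifted k (a : composition k) (G : nc_series) w : k <= size w ->
  nc_mul (lifted_qschur a) G w = (lifted_qschur a (take k w) * G (drop k w))%R.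
Proof.
move=> kw; rewrite /nc_mul (bigD1 (Ordinal (kw : k < (size w).+1))) //= big1 ?addr0 // => i ik.
rewrite lifted_qschurE size_takel; last by rewrite -ltnS.
by rewrite -val_eqE /= in ik; rewrite (negPf ik) mul0r.
Qed.

Lemma act_word_fixing n k (d h : 'S_n) w : h \in fixing n k -> size w = n -> k <= n ->
  perm_eq (take k (act_word (d * h)%g w)) (take k (act_word d w)) /\
  drop k (act_word (d * h)%g w) = drop k (act_word d w).
Proof.
move=> /fixingP hk wn kn.
have E : drop k (act_word (d * h)%g w) = drop k (act_word d w).
  apply: (eq_from_nth (x0 := 0)) => [|i]; rewrite !size_drop !size_act_word // => ik.
  have kin : k + i < n by rewrite -ltn_subRL.
  rewrite !nth_drop -[k + i]/(val (Ordinal kin)) !nth_act_word invMg permM.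
  by congr (nth 0 w (d^-1%g _)); apply: (canLR (permK h)); rewrite hk ?leq_addr.
split=> //; rewrite -(perm_cat2r (drop k (act_word d w))) -[X in perm_eq (_ ++ X)]E !cat_take_drop.
by rewrite (perm_trans (perm_act_word _ wn)) // perm_sym perm_act_word.
Qed.

Lemma star_lifted_qschur n r (a : composition (n - r)) lam w :
  star r n (lifted_qschur a) (nc_schur lam) w =
  (if size w == n then
     (composition_fact (exps (seq_mset w)))%:R * com_mul (qschur a) (schur lam) (seq_mset w)
   else 0)%R.
Proof.
rewrite /star /act_series; case: eqP => [wn|_]; last by rewrite big1.
pose psi v := (lifted_qschur a (take (n - r) v) * nc_schur lam (drop (n - r) v))%R.
have inv (x h : 'S_n) : h \in fixing n (n - r) ->
    psi (act_word (x * h)%g w) = psi (act_word x w).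
  move=> hf; have [E1 E2] := act_word_fixing x hf wn (leq_subr r n).
  rewrite /psi E2 !lifted_qschurE (perm_size E1); congr ((if _ then _%:R * _ else _) * _)%R.
    by congr (composition_fact (exps _)); apply/eq_seq_msetP.
  by congr (qschur a _); apply/eq_seq_msetP.
have := @sum_star_reps r n (fun d => psi (act_word d w)) inv.
rewrite sum_act_word // sum_permutations_lifted ?wn ?leq_subr //.
(* The factor (n - r)! cancels: on one side it is the size of a coset, on the other it comes from
   the lifting of the first factor. *)
rewrite mulrCA => /mulfI -> //; last by rewrite pnatr_eq0 -lt0n fact_gt0.
apply: eq_bigr => d _; rewrite invgK nc_mul_lifted ?size_act_word ?leq_subr //.
Qed.

Theorem theorem6p3 (n r : nat) (hn : 2 <= n) (hr : 1 <= r <= n - 1)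
    (alpha : composition (n - r)) (lam : seq nat) (hlam : is_partition r lam) :
  exists C : composition n -> nat,
    (forall c : composition n -> rat,
       qschur_expansion (com_mul (qschur alpha) (schur lam)) c <->
       (forall beta, c beta = (C beta)%:R%R)) /\
    (forall w : seq nat,
       star r n (lifted_qschur alpha) (nc_schur lam) w =
       (\sum_(beta : composition n) (C beta)%:R * lifted_qschur beta w)%R).
Proof.
have rn : r <= n by lia.
have /andP[/andP[/eqP lr _] slam] := hlam.
have mulE : qschur_expansion (com_mul (qschur alpha) (schur lam))
    (fun beta : composition n => (lr_coef n alpha lam beta)%:R%R).
  by move=> m; rewrite (com_mul_qschur (n := n)) ?lr ?subnK.
exists (fun beta => lr_coef n alpha lam beta); split=> [c|w].
  split=> [cE beta|cE m]; last by rewrite mulE; apply: eq_bigr => beta _; rewrite cE.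
  apply/eqP; rewrite -subr_eq0; apply/eqP; move: beta.
  apply: qschur_independent => m; under eq_bigr do rewrite mulrBl.
  by rewrite sumrB -cE -mulE subrr.
rewrite star_lifted_qschur //; under eq_bigr do rewrite lifted_qschurE.
case: eqP => _; last by rewrite big1 // => beta _; rewrite mulr0.
rewrite mulE mulr_sumr; apply: eq_bigr => beta _; exact: mulrCA.
Qed.
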